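(* Let $0\le\alpha<1$ and $\beta>2$, and let $\mu\in\mathcal M_\sigma(\Sigma^+_{\alpha,\beta})$ be a $\sigma$-invariant Borel probability measure on the $(\alpha$-$\beta)$-shift with $h(\mu)>0$. Then for any $\epsilon>0$ and any neighborhood $\mathcal U$ of $\mu$ in $\mathcal M(\Sigma^+_{\alpha,\beta})$, there exist a finite set $\mathcal F\subset\mathcal D$ of vertices of the Hofbauer Markov diagram and an ergodic measure $\rho\in\mathcal M^e_\sigma(\pi(\Psi(\mathcal X(\mathcal F))))$ such that $\rho\in\mathcal U$ and $|h(\mu)-h(\rho)|\le\epsilon$.
   Context: **The $(\alpha$-$\beta)$-shift.** Let $T=T_{\alpha,\beta}\colon[0,1)\to[0,1)$, $T(x)=\beta x+\alpha \pmod 1$. Let $k$ be the smallest integer not less than $\alpha+\beta$, and put $I_1=\left(0,\frac{1-\alpha}{\beta}\right)$, $I_j=\left(\frac{j-1-\alpha}{\beta},\frac{j-\alpha}{\beta}\right)$ for $2\le j\le k-1$, and $I_k=\left(\frac{k-1-\alpha}{\beta},1\right)$. Let $X=\bigcap_{n=0}^\infty T^{-n}\left(\bigcup_{j=1}^kI_j\right)$. For $x\in X$ define $\mathrm{It}(x)\in\{1,\dots,k\}^{\mathbb N}$ ($\mathbb N=\{1,2,\dots\}$) by $\mathrm{It}(x)_i=j$ if $T^{i-1}(x)\in I_j$. The $(\alpha$-$\beta)$-shift is $\Sigma^+_{\alpha,\beta}=\mathrm{cl}\{\mathrm{It}(x):x\in X\}\subset\{1,\dots,k\}^{\mathbb N}$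 (product topology), with shift map $\sigma(\omega_1\omega_2\cdots)=\omega_2\omega_3\cdots$. The two-sided $(\alpha$-$\beta)$-shift is $\Sigma_{\alpha,\beta}=\{x\in\{1,\dots,k\}^{\mathbb Z}:x_ix_{i+1}\cdots\in\Sigma^+_{\alpha,\beta}\text{ for all }i\in\mathbb Z\}$, and $\pi\colon\Sigma_{\alpha,\beta}\to\Sigma^+_{\alpha,\beta}$, $(x_i)_{i\in\mathbb Z}\mapsto(x_i)_{i\in\mathbb N}$, is the canonical projection. **Hofbauer's Markov diagram.** For $1\le i\le k$ let $[i]=\{x\in\Sigma^+_{\alpha,\beta}:x_1=i\}$. If $D\subset\Sigma^+_{\alpha,\beta}$ is closed and contained in some $[i]$, a non-empty closed set $C\subset\Sigma^+_{\alpha,\beta}$ is a successor of $D$, written $D\to C$, if $C=[j]\cap\sigma(D)$ for some $1\le j\le k$. Let $\mathcal D_0=\{[1],\dots,[k]\}$, $\mathcal D_{n+1}=\mathcal D_n\cup\{C: C\text{ is a successor of some }D\in\mathcal D_n\}$, and $\mathcal D=\bigcup_{n\ge0}\mathcal D_n$. The oriented graph $(\mathcal D,\to)$ is the Hofbauer Markov diagram. For $\mathcal C\subset\mathcal D$, $\mathcal X(\mathcal C)$ is the set of all two-sided infinite paths in $\mathcal C$, i.e. sequences $(D_i)_{i\in\mathbb Z}\in\mathcal C^{\mathbb Z}$ with $D_i\to D_{i+1}$ for all $i$. For $D\in\mathcal D$ let $\psi(D)$ be the unique $i\in\{1,\dots,k\}$ with $D\subset[i]$, and define $\Psi((D_i)_{i\in\mathbb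 Z})=(\psi(D_i))_{i\in\mathbb Z}$ on $\mathcal X(\mathcal D)$; it is a known fact that $\Psi$ takes values in $\Sigma_{\alpha,\beta}$. **Measures.** For a subshift $\Sigma$, $\mathcal M(\Sigma)$ is the set of Borel probability measures on $\Sigma$ with the weak$^*$ topology, $\mathcal M_\sigma(\Sigma)$ the set of $\sigma$-invariant ones, and $\mathcal M^e_\sigma(\Sigma)$ the set of ergodic ones. A measure on $\pi(\Psi(\mathcal X(\mathcal F)))$ is regarded as a measure on $\Sigma^+_{\alpha,\beta}$ supported on that subset. The metric entropy is $h(\mu)=\lim_{n\to\infty}\frac1n\sum_w-\mu[w]\log\mu[w]$, the sum being over all words $w$ of length $n$ whose cylinder $[w]=\{x\in\Sigma:x_i=w_i,\ 1\le i\le n\}$ is non-empty (with $0\log0=0$). *)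

(* Defs.v *)
From mathcomp Require Import all_boot all_order all_algebra.
From mathcomp Require Import all_classical all_reals all_analysis.

Set Implicit Arguments.
Unset Strict Implicit.
Unset Printing Implicit Defensive.

Import Order.TTheory GRing.Theory Num.Theory.
Import numFieldNormedType.Exports.

Local Open Scope classical_set_scope.
Local Open Scope ring_scope.

(* One-sided sequences, with the product of the discrete topologies on nat.
   The symbols of the (alpha-beta)-shift are the naturals 1, ..., k, and
   {1,...,k}^N is a closed subspace of [oneseq], so closures may be taken in
   [oneseq].  Coordinates are numbered from 0: the coordinate of index i >= 1
   of the mathematical sequence w is (w i.-1). *)
Definition oneseq := prod_topology (fun _ : nat => nat).

Definition twoseq := int -> nat.

Definition seq_shift (w : oneseq) : oneseq := fun n => w n.+1.

(* Natural projection; the coordinate of index n.+1 in Z becomes the one of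
   index n here.  It is used on sequences of the two-sided shift only. *)
Definition proj_pos (x : twoseq) : oneseq := fun n => x n.+1%:Z.

Section AlphaBetaShift.
Context {R : realType}.
Variables alpha beta : R.

Definition Tab (x : R) : R :=
  beta * x + alpha - (Num.floor (beta * x + alpha))%:~R.

Definition nsymb : nat := `|Num.ceil (alpha + beta)|%N.

Definition Iab (j : nat) : set R :=
  if j == 1%N then `]0, ((1 - alpha) / beta)[%classic
  else if j == nsymb then `](((nsymb%:R - 1) - alpha) / beta), 1[%classic
  else `](((j%:R - 1) - alpha) / beta), ((j%:R - alpha) / beta)[%classic.

Definition symbols : set nat := [set j | (1 <= j <= nsymb)%N].

Definition Xab : set R :=
  [set x | 0 <= x < 1 /\
     forall n, (\bigcup_(j in symbols) Iab j) (iter n Tab x)].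

Definition It (x : R) : oneseq :=
  fun n => xget 0%N [set j | symbols j /\ Iab j (iter n Tab x)].

Definition Sigma_plus : set oneseq := closure (It @` Xab).

Definition letter (i : nat) : set oneseq :=
  [set w | Sigma_plus w /\ w 0%N = i].

Definition successor (D C : set oneseq) : Prop :=
  [/\ closed D,
      exists2 i, symbols i & D `<=` letter i,
      closed C,
      C !=set0 &
      exists2 j, symbols j & C = letter j `&` (seq_shift @` D)].

Fixpoint vertices_upto (n : nat) : set (set oneseq) :=
  if n is m.+1 then
    vertices_upto m `|`
      [set C | exists2 D, vertices_upto m D & successor D C]
  else letter @` symbols.

Definition vertices : set (set oneseq) :=
  \bigcup_(n in [set: nat]) vertices_upto n.

Definition paths (F : set (set oneseq)) : set (int -> set oneseq) :=
  [set p | (forall i, F (p i)) /\ (forall i, successor (p i) (p (i + 1)))].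

Definition psi (D : set oneseq) : nat :=
  xget 0%N [set i | symbols i /\ D `<=` letter i].

Definition Psi (p : int -> set oneseq) : twoseq := fun i => psi (p i).

End AlphaBetaShift.

Definition borel_oneseq := g_sigma_algebraType (@open oneseq).

Section Measures.
Context {R : realType}.

(* Borel probability measures on S, viewed as measures on [oneseq] carried by
   S.  Negligibility keeps this meaningful without assuming S measurable; for
   Borel S it says that mu S = 1. *)
Definition carried (mu : probability borel_oneseq R) (S : set oneseq) : Prop :=
  mu.-negligible (~` S).

Definition measures_on (S : set oneseq) : Type :=
  set_type [set mu : probability borel_oneseq R | carried mu S].

Definition continuous_on (S : set oneseq) : Type :=
  set_type [set f : oneseq -> R | {within S, continuous f}].

Definition pairing (S : set oneseq) (mu : measures_on S) :
    prod_topology (fun _ : continuous_on S => R) :=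
  fun f => (\int[set_val mu]_(x in S) (set_val f x))%R.

Definition weak_star (S : set oneseq) := initial_topology (@pairing S).

Definition shift_invariant (mu : probability borel_oneseq R) : Prop :=
  forall A : set borel_oneseq,
    measurable A -> mu (seq_shift @^-1` A) = mu A.

Definition ergodic (mu : probability borel_oneseq R) : Prop :=
  shift_invariant mu /\
  forall A : set borel_oneseq,
    measurable A -> seq_shift @^-1` A = A -> mu A = 0%E \/ mu A = 1%E.

Definition cylinder (S : set oneseq) (n : nat) (w : n.-tuple nat) :
    set oneseq :=
  [set x | S x /\ forall i : 'I_n, x i = tnth w i].

(* The sum has finite support on subsets of {1,...,k}^N; 0 * ln 0 = 0. *)
Definition block_entropy (S : set oneseq) (mu : probability borel_oneseq R)
    (n : nat) : R :=
  \sum_(w \in [set w : n.-tuple nat | cylinder S w !=set0])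
     - (fine (mu (cylinder S w)) * ln (fine (mu (cylinder S w)))).

Definition entropy (S : set oneseq) (mu : probability borel_oneseq R) : R :=
  limn (fun n => n%:R^-1 * block_entropy S mu n).

End Measures.

(* Main.v *)
(* A word w is full when T^|w| maps the interval of points with itinerary w onto
   (0,1); full words concatenate freely.  Words of length n of the shift are
   recoded as full words of one common length L = n (1 + o(1)), with almost the
   same numbers of occurrences of each subword and with at most exp(o(n)) words
   sharing a code.  Indeed a word with a small image splits into pieces which
   follow the itinerary of 0 or of 1 up to their last letter; changing that letter
   gives a piece that can be repeated, or completed to a full word at bounded
   cost, and after sorting the modified pieces these costs are paid rarely.
   A Bernoulli sequence of blocks distributed as the code of the first n letters
   under mu, averaged over the L shifts, is an ergodic measure rho carried by the
   paths through finitely many vertices.  By Gibbs' inequality, L h(rho) is the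
   entropy of the code, which lies between H_n(mu) - o(n) and H_n(mu), and the
   cylinder probabilities of rho are close to those of mu. *)
From HB Require Import structures.
Require Import Defs.
From mathcomp Require Import all_boot all_order all_algebra.
From mathcomp Require Import all_classical all_reals all_analysis.
From mathcomp Require Import measurable_realfun.
From mathcomp Require Import ring lra zify.

Set Implicit Arguments.
Unset Strict Implicit.
Unset Printing Implicit Defensive.

Import Order.TTheory GRing.Theory Num.Theory.
Import numFieldNormedType.Exports.

Local Open Scope classical_set_scope.
Local Open Scope ring_scope.

(** The hypothesis [2 < beta] drives the recursion. When a letter cuts an image and both this letter
    and its neighbour keep less than [eta], their two pieces make up [beta] times the previous
    image, which was therefore shorter than [eta] already. Smallness passes to shorter words and can
    be traced back from cut to cut. The obstacle is that a piece with its last letter changed may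
    again have a tiny image, so that no uniform bound on its completion exists. Two scales answer
    this. Pieces of length at most [M] form a finite list, and a possibly huge completion is needed
    only once per element of the list. A longer piece is split further until the changed letter
    leaves an image of length at least [eta], for which a fixed number [N] of letters suffices; with
    [M = D * N] these completions add at most [n / D] letters. Grouping equal pieces requires that
    they can be repeated, which is why the changed letter must keep at least as much of the image as
    the original one. *)

(** * Images of words under the iterates of T, cuts and extremal words *)

Section Words.
Context {R : realType}.
Variables alpha beta : R.
Hypothesis halpha : 0 <= alpha < 1.
Hypothesis hbeta : 2 < beta.

Ltac lrab := have ? := hbeta; lra.

(* The boolean side [false] refers to the endpoint 0 and [true] to the endpoint 1.
   [dst b w] is the distance from that endpoint to the image under T^|w| of the
   interval of points with itinerary [w], so that [sz w] is the length of this
   image.  [aff] is the same recursion without truncation, and [fol b x w] says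
   that no truncation occurs on side [b] along [w]. *)
Definition off (b : bool) (j : nat) : R :=
  if b then alpha + beta - j%:R else j%:R - 1 - alpha.

Definition nb (b : bool) (j : nat) : nat := if b then j.+1 else j.-1.

Definition dfrom (b : bool) (x : R) (w : seq nat) : R :=
  foldl (fun x j => Num.max 0 (beta * x - off b j)) x w.

Definition dst b w := dfrom b 0 w.

Definition aff (b : bool) (x : R) (w : seq nat) : R :=
  foldl (fun x j => beta * x - off b j) x w.

Definition sz w := 1 - dst false w - dst true w.

Definition ok w := 0 < sz w.

Fixpoint fol (b : bool) (x : R) (w : seq nat) : bool :=
  if w is j :: v then
    (0 <= beta * x - off b j) && fol b (beta * x - off b j) v
  else true.

(** For an [ok] word this means that [w] begins the limit itinerary of the endpoint on side [b]. *)
Definition pure b w := fol b 0 w.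

Definition cut b Y j := beta * dst b Y - off b j < 0.

Lemma offC b j : off (~~ b) j = beta - 1 - off b j.
Proof. by case: b => /=; rewrite /off /=; ring. Qed.

Lemma szE b w : sz w = 1 - dst b w - dst (~~ b) w.
Proof. by case: b => /=; rewrite /sz //; ring. Qed.

Lemma off_nb b j : (0 < j)%N -> off b (nb b j) = off b j - 1.
Proof.
by case: j => // j _; case: b; rewrite /off /nb /= -!natr1; ring.
Qed.

Lemma dfrom_rcons b x w j :
  dfrom b x (rcons w j) = Num.max 0 (beta * dfrom b x w - off b j).
Proof. by rewrite /dfrom foldl_rcons. Qed.

Lemma dst_rcons b w j :
  dst b (rcons w j) = Num.max 0 (beta * dst b w - off b j).
Proof. exact: dfrom_rcons. Qed.

Lemma aff_rcons b x w j : aff b x (rcons w j) = beta * aff b x w - off b j.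
Proof. by rewrite /aff foldl_rcons. Qed.

Lemma dst_cat b u v : dst b (u ++ v) = dfrom b (dst b u) v.
Proof. by rewrite /dst /dfrom foldl_cat. Qed.

Lemma fol_rcons b x w j :
  fol b x (rcons w j) = fol b x w && (0 <= beta * aff b x w - off b j).
Proof.
elim: w x => [|i w IH] x /=; first by rewrite andbT.
by rewrite IH andbA.
Qed.

Lemma fol_cat b x u v : fol b x (u ++ v) = fol b x u && fol b (aff b x u) v.
Proof. by elim: u x => [//|i u IH] x /=; rewrite IH andbA. Qed.

Lemma fol_dfrom b x w : fol b x w -> dfrom b x w = aff b x w.
Proof.
elim: w x => [//|j w IH] x /= /andP[h /IH]; rewrite /dfrom /aff /= => <-.
by rewrite max_r.
Qed.

Lemma dfrom_ge0 b x w : 0 <= x -> 0 <= dfrom b x w.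
Proof. by move=> x0; case/lastP: w => [//|w j]; rewrite dfrom_rcons le_max lexx. Qed.

Lemma dst_ge0 b w : 0 <= dst b w.
Proof. exact: dfrom_ge0. Qed.

Lemma le_dfrom b x y w : x <= y -> dfrom b x w <= dfrom b y w.
Proof.
have b0 : 0 < beta by lrab.
elim/last_ind: w => [//|w j IH] xy; rewrite !dfrom_rcons.
by rewrite ge_max le_max lexx /= le_max lerD2r ler_pM2l // IH ?orbT.
Qed.

Lemma dst_suffix b u v : dst b v <= dst b (u ++ v).
Proof. by rewrite dst_cat; apply: le_dfrom; exact: dst_ge0. Qed.

Lemma sz_suffix u v : sz (u ++ v) <= sz v.
Proof.
rewrite /sz; have := dst_suffix false u v; have := dst_suffix true u v; lrab.
Qed.

Lemma dst_lt1 b w : ok w -> dst b w < 1.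
Proof. by rewrite /ok (szE b); have := dst_ge0 (~~ b) w; lrab. Qed.

(** Each step is nondecreasing and commutes with maxima, so the truncated orbit of [x] is the larger
    of the truncated orbit of 0 and the untruncated orbit of [x]. *)
Lemma dfrom_max b x w : 0 <= x -> dfrom b x w = Num.max (dst b w) (aff b x w).
Proof.
have b0 : 0 < beta by lrab.
move=> x0; elim/last_ind: w => [|w j IH]; first by rewrite /dst /aff /= max_r.
rewrite dfrom_rcons dst_rcons aff_rcons IH -maxA; congr (Num.max _ _).
by rewrite maxr_pMr ?ltW // addr_maxl.
Qed.

(** [x] and [1 - x] are the distances of one point from the two endpoints, and both recursions
    follow the same affine branches. *)
Lemma affD b x w : aff b x w + aff (~~ b) (1 - x) w = 1.
Proof.
elim/last_ind: w => [|w j IH]; first by rewrite /aff /=; ring.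
rewrite !aff_rcons offC.
have -> : aff (~~ b) (1 - x) w = 1 - aff b x w by move: IH; lra.
ring.
Qed.

Lemma aff_lin b x y w : aff b x w - aff b y w = beta ^+ size w * (x - y).
Proof.
elim/last_ind: w => [|w j IH]; first by rewrite /aff /= mul1r.
rewrite !aff_rcons size_rcons exprS -mulrA -IH; ring.
Qed.

Lemma sz_rcons_uncut w j : ~~ (cut false w j) -> ~~ (cut true w j) ->
  sz (rcons w j) = beta * sz w.
Proof.
rewrite /cut -!leNgt => h0 h1; rewrite /sz !dst_rcons !max_r //.
by rewrite /off /=; ring.
Qed.

Lemma ok_rcons w j : ok (rcons w j) -> ok w.
Proof.
rewrite /ok /sz !dst_rcons /off /= => h.
set x := Num.max _ _ in h; set y := Num.max _ _ in h.
have hx : beta * dst false w - (j%:R - 1 - alpha) <= x by rewrite le_max lexx orbT.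
have hy : beta * dst true w - (alpha + beta - j%:R) <= y by rewrite le_max lexx orbT.
have h2 : 0 < beta * (1 - dst false w - dst true w) by lrab.
by rewrite pmulr_rgt0 in h2 => //; lrab.
Qed.

Lemma ok_prefix u v : ok (u ++ v) -> ok u.
Proof.
elim/last_ind: v => [|v j IH]; first by rewrite cats0.
by rewrite -rcons_cat => /ok_rcons.
Qed.

Lemma ok_suffix u v : ok (u ++ v) -> ok v.
Proof. by rewrite /ok => /lt_le_trans; apply; exact: sz_suffix. Qed.

Lemma ok_letter w j : ok (rcons w j) -> (0 < j)%N /\ j%:R < alpha + beta + 1.
Proof.
move=> h.
have h0 := dst_lt1 false h; have h1 := dst_lt1 true h.
rewrite !dst_rcons !gt_max /off /= in h0 h1.
case/andP: h0 => _ h0; case/andP: h1 => _ h1.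
have b0 : 0 <= beta by lrab.
have d0 := mulr_ge0 b0 (dst_ge0 false w).
have d1 := mulr_ge0 b0 (dst_ge0 true w).
split; last by lrab.
by case: j {h h1} h0 => // h0; case/andP: halpha => ? ?; exfalso; lrab.
Qed.

(** The split is at the last letter that truncates. There is one, because a letter without
    truncation multiplies the length by [beta] and the empty word has length 1. *)
Lemma peel w : ok w -> sz w < 1 ->
  exists b Y j v, [/\ w = rcons Y j ++ v, cut b Y j &
     forall b', fol b' (dst b' (rcons Y j)) v].
Proof.
elim/last_ind: w => [|w j IH] okw szw.
  by move: szw; rewrite /sz /dst /= !subr0 ltxx.
have okw' := ok_rcons okw.
have [c0|c0] := boolP (cut false w j); first by exists false, w, j, [::]; rewrite cats0.
have [c1|c1] := boolP (cut true w j); first by exists true, w, j, [::]; rewrite cats0.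
have e := sz_rcons_uncut c0 c1.
have szw' : sz w < 1.
  move: szw; rewrite e => h; have hp : 0 < sz w by exact: okw'.
  have : 2 * sz w < beta * sz w by rewrite ltr_pM2r.
  by lrab.
have [b [Y [i [v [wE cY fY]]]]] := IH okw' szw'.
exists b, Y, i, (rcons v j); split=> //; first by rewrite wE rcons_cat.
move=> b'; rewrite fol_rcons fY /= -(fol_dfrom (fY b')) -dst_cat -wE.
by case: b'; rewrite leNgt.
Qed.

Lemma sz_uncut u v : (forall b, fol b (dst b u) v) ->
  sz (u ++ v) = beta ^+ size v * sz u.
Proof.
move=> f; rewrite /sz !dst_cat !fol_dfrom //.
have h1 := affD false (dst false u) v.
have h2 := aff_lin true (dst true u) (1 - dst false u) v.
rewrite /= in h1.
have -> : beta ^+ size v * (1 - dst false u - dst true u) =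
  - (beta ^+ size v * (dst true u - (1 - dst false u))) by ring.
by rewrite -h2; lra.
Qed.

Lemma sz_uncut_le u v : (forall b, fol b (dst b u) v) -> ok u -> sz u <= sz (u ++ v).
Proof.
move=> /sz_uncut ->; rewrite /ok => h; apply: ler_peMl; first exact: ltW.
by apply: exprn_ege1; lrab.
Qed.

Lemma dst_cut b Y j : cut b Y j -> dst b (rcons Y j) = 0.
Proof. by rewrite /cut dst_rcons => /ltW /max_l. Qed.

(* If the letter [j] cuts on side [b], the rest of the image is taken by the
   letter [nb b j]. *)
Lemma sz_toggle b Y j : cut b Y j -> ok (rcons Y j) ->
  [/\ dst (~~ b) (rcons Y (nb b j)) = 0,
      sz (rcons Y (nb b j)) = Num.min 1 (- (beta * dst b Y - off b j)),
      ok (rcons Y (nb b j)) &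
      sz (rcons Y j) < 1 -> sz (rcons Y (nb b j)) < 1 ->
      beta * sz Y = sz (rcons Y j) + sz (rcons Y (nb b j))].
Proof.
move=> cY okY; have [j0 _] := ok_letter okY.
have e0 := dst_cut cY; move: (cY); rewrite /cut => cY'.
have lt1 := dst_lt1 (~~ b) okY.
have d0 : dst (~~ b) (rcons Y (nb b j)) = 0.
  rewrite dst_rcons max_l // offC off_nb //.
  move: lt1; rewrite dst_rcons gt_max offC => /andP[_]; lrab.
have sE : sz (rcons Y (nb b j)) = Num.min 1 (- (beta * dst b Y - off b j)).
  rewrite (szE b) d0 dst_rcons off_nb // subr0.
  set z := beta * _; rewrite /Num.max /Num.min.
  by case: ifP; case: ifP => //; rewrite -/z in cY' *; lrab.
have okt : ok (rcons Y (nb b j)).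
  by rewrite /ok sE lt_min ltr01 /=; lrab.
split=> // szlt; rewrite sE gt_min ltxx /= => tlt.
rewrite min_r; last exact: ltW.
move: szlt; rewrite !(szE b) e0 dst_rcons subr0.
set y := beta * dst (~~ b) Y - _; rewrite /Num.max; case: ifP => hy h; last by lrab.
by rewrite /y offC; ring.
Qed.

(* [rcons y j] is terminal when it follows the extremal itinerary of one side and
   its last letter cuts on the other side. *)
Definition term b y j := pure (~~ b) y && (0 <= beta * aff (~~ b) 0 y - off (~~ b) j) && (beta * dst b y - off b j < 0).

Lemma termE b y j : term b y j = pure (~~ b) (rcons y j) && (beta * dst b y - off b j < 0).
Proof. by rewrite /term /pure fol_rcons. Qed.

Lemma expr_ge2 p : (0 < p)%N -> 2 <= beta ^+ p.
Proof.
case: p => // p _; rewrite exprS.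
have h : 1 <= beta ^+ p by apply: exprn_ege1; lrab.
by have := ler_pM2l (_ : 0 < beta) 1 (beta ^+ p); rewrite mulr1 h => /(_ _); lrab.
Qed.

(* Iterating, all powers of [rcons y (nb b j)] have the same image. *)
Lemma loop b y j W : term b y j -> ok (rcons y j) ->
  sz (rcons y j) <= sz (rcons y (nb b j)) ->
  (forall b', dst b' W = dst b' (rcons y (nb b j))) ->
  forall b', dst b' (W ++ rcons y (nb b j)) = dst b' (rcons y (nb b j)).
Proof.
rewrite termE => /andP[py cy] oky le hW.
have [j0 _] := ok_letter oky.
have [d0 sE okt _] := sz_toggle cy oky.
set z := rcons y (nb b j) in le hW d0 sE okt *.
suff h b' : b' = b \/ b' = ~~ b -> dst b' (W ++ z) = dst b' z.
  by move=> b'; apply: h; case: b' b {py cy le hW d0 sE okt oky z} => [] []; [left|right|right|left].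
case=> ->; last by rewrite dst_cat hW d0.
rewrite dst_cat hW dfrom_max; last exact: dst_ge0.
(* It remains to see that the affine orbit of [dst b z] along [z] ends no higher than it began. The
   branches of [z] and [rcons y j] differ by 1 in the last step, and the expansion by at least 2
   outweighs the gap [sz (rcons y j) <= sz z]. *)
apply: max_l.
have s1 : sz z = 1 - dst b z by rewrite (szE b) d0 subr0.
have s2 : sz (rcons y j) = 1 - dst (~~ b) (rcons y j).
  by rewrite (szE b) (dst_cut cy) subr0.
have e1 : dst (~~ b) (rcons y j) = aff (~~ b) 0 (rcons y j) by rewrite -fol_dfrom.
have := affD b 1 (rcons y j); rewrite subrr -e1 => e2.
have := aff_lin b (dst b z) 1 z => e3.
have e4 : aff b 1 z = aff b 1 (rcons y j) + 1.
  by rewrite /z !aff_rcons off_nb //; ring.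
have p2 : 2 <= beta ^+ size z by apply: expr_ge2; rewrite /z size_rcons.
have e5 : aff b (dst b z) z = 1 + sz (rcons y j) - beta ^+ size z * sz z.
  by rewrite s2 s1 -[LHS](subrK (aff b 1 z)) e3 e4; lrab.
rewrite e5; have : 2 * sz z <= beta ^+ size z * sz z.
  by rewrite ler_wpM2r //; exact: ltW.
by move: le; rewrite s1; lrab.
Qed.

(** * Splitting a word into terminal pieces *)

Section Decomposition.
Variables (eta : R) (M : nat).
Hypothesis heta : 0 < eta <= 1.

(** [j] makes the piece terminal; the letter actually found in the word may differ. The fourth
    clause makes the changed piece repeatable by [loop], and the last one gives the two ways to
    bound its completion: bounded length, or an image of length at least [eta]. *)
Definition atom b y j :=
  [/\ term b y j, ok (rcons y j), sz (rcons y j) < eta,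
     sz (rcons y j) <= sz (rcons y (nb b j)) &
     (size y < M)%N \/ eta <= sz (rcons y (nb b j)) ].

(* Triples (b, y, c): the side, the word without its last letter, and the
   actual last letter. *)
Definition flat (zs : seq (bool * seq nat * nat)) : seq nat :=
  flatten [seq rcons z.1.2 z.2 | z <- zs].

Definition atoms (zs : seq (bool * seq nat * nat)) :=
  forall z, z \in zs -> exists j, atom z.1.1 z.1.2 j.

Lemma flat_cat z1 z2 : flat (z1 ++ z2) = flat z1 ++ flat z2.
Proof. by rewrite /flat map_cat flatten_cat. Qed.

Lemma atoms_cat z1 z2 : atoms z1 -> atoms z2 -> atoms (z1 ++ z2).
Proof. by move=> h1 h2 z; rewrite mem_cat => /orP[/h1|/h2]. Qed.

Lemma pure_prefix b u v : pure b (u ++ v) -> pure b u.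
Proof. by rewrite /pure fol_cat => /andP[]. Qed.

Lemma pure_not_cut b Y j : pure b (rcons Y j) -> ~~ cut b Y j.
Proof.
rewrite /pure fol_rcons => /andP[f h].
by rewrite /cut /dst (fol_dfrom f) -leNgt.
Qed.

(* If a cut on side b is preceded by a cut on the same side, the word in
   between becomes terminal on the other side once its last letter is replaced
   by the neighbouring one. *)
Lemma term_toggle b Z v j : dst b Z = 0 -> fol b 0 v ->
  cut b (Z ++ v) j -> ok (rcons (Z ++ v) j) ->
  sz (rcons (Z ++ v) (nb b j)) < eta ->
  [/\ term (~~ b) v (nb b j), ok (rcons v (nb b j)) & sz (rcons v (nb b j)) < eta].
Proof.
move=> dZ fv cZ okZ szt.
have [j0 _] := ok_letter okZ.
have [_ sE okt _] := sz_toggle cZ okZ.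
have dE : dst b (Z ++ v) = aff b 0 v by rewrite dst_cat dZ fol_dfrom.
have dv : dst b v = aff b 0 v by rewrite /dst fol_dfrom.
rewrite sE in szt; move: (cZ); rewrite /cut dE => cZ'.
have le1 : - (beta * dst b (Z ++ v) - off b j) < eta.
  by move: szt; rewrite gt_min => /orP[] //; case/andP: heta; lrab.
rewrite dE in le1.
have lt1 := dst_lt1 (~~ b) okZ.
have hs := dst_suffix (~~ b) Z v.
have cz : cut (~~ b) v (nb b j).
  rewrite /cut offC off_nb //.
  move: lt1; rewrite dst_rcons gt_max => /andP[_]; rewrite offC.
  have : beta * dst (~~ b) v <= beta * dst (~~ b) (Z ++ v) by rewrite ler_pM2l //; lrab.
  lrab.
have d0 := dst_cut cz.
have d1 : dst b (rcons v (nb b j)) = 1 + (beta * aff b 0 v - off b j).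
  rewrite dst_rcons off_nb // dv max_r; first by ring.
  by case/andP: heta; lrab.
have s : sz (rcons v (nb b j)) = - (beta * aff b 0 v - off b j).
  by rewrite (szE b) d0 d1; ring.
split; last by rewrite s.
- rewrite /term negbK /pure fv /= off_nb //; apply/andP; split; last exact: cz.
  by case/andP: heta; lrab.
- by rewrite /ok s; lrab.
Qed.

(** If the piece is not an atom, the images for [j] and its neighbour are both shorter than [eta],
    hence so is that of [y], and the last cut of [y] yields two shorter terminal words. The second
    one is terminal for the neighbouring letter only, so the actual last letter [c] is carried
    separately and left arbitrary. *)
Lemma decomp_term b y j c : term b y j -> ok (rcons y j) -> sz (rcons y j) < eta ->
  exists2 zs, rcons y c = flat zs & atoms zs.
Proof.
have [n] := ubnP (size y); elim: n b y j c => // n IH b y j c.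
rewrite ltnS => ley ty oky szy.
have /andP[py cy] : pure (~~ b) (rcons y j) && (beta * dst b y - off b j < 0) by rewrite -termE.
have [_ sE okt sD] := sz_toggle cy oky.
have [[le H]|nat_] := pselect (sz (rcons y j) <= sz (rcons y (nb b j)) /\
   ((size y < M)%N \/ eta <= sz (rcons y (nb b j)))).
  exists [:: (b, y, c)]; first by rewrite /flat /= cats0.
  by move=> z; rewrite inE => /eqP -> /=; exists j; split.
have szt : sz (rcons y (nb b j)) < eta.
  rewrite ltNge; apply/negP => h; apply: nat_; split; last by right.
  by rewrite (le_trans (ltW szy)).
case/andP: heta => eta0 eta1.
have szy' : sz y < eta.
  have := sD (lt_le_trans szy eta1) (lt_le_trans szt eta1) => e.
  have : beta * sz y < 2 * eta by lrab.
  have := ok_rcons oky; rewrite /ok => p0.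
  have : 2 * sz y < beta * sz y by rewrite ltr_pM2r.
  by lrab.
have [b1 [Y [i [v [yE cY fv]]]]] := peel (ok_rcons oky) (lt_le_trans szy' eta1).
have pyv : pure (~~ b) y by move: py; rewrite -cats1 => /pure_prefix.
have pY : pure (~~ b) (rcons Y i) by move: pyv; rewrite yE => /pure_prefix.
have b1E : b1 = b.
  apply/eqP; apply/negPn/negP => /negP hb.
  have hb' : b1 = ~~ b by case: (b1) (b) hb => [] [].
  by move: (pure_not_cut pY); rewrite -hb' cY.
rewrite b1E in cY.
have okY : ok (rcons Y i) by move: (ok_rcons oky); rewrite yE => /ok_prefix.
have sY : sz (rcons Y i) < eta.
  by apply: le_lt_trans szy'; rewrite yE; exact: sz_uncut_le.
have tY : term b Y i by rewrite termE pY.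
have sizeE : size y = ((size Y).+1 + size v)%N by rewrite yE size_cat size_rcons.
have ltY : (size Y < n)%N by move: sizeE ley; clear; lia.
have ltv : (size v < n)%N by move: sizeE ley; clear; lia.
have [zs1 z1E z1A] := IH b Y i i ltY tY okY sY.
have [t1 o1 s1] : [/\ term (~~ b) v (nb b j), ok (rcons v (nb b j)) & sz (rcons v (nb b j)) < eta].
  apply: (@term_toggle b (rcons Y i)); rewrite -?yE //; first exact: dst_cut.
  by move: (fv b); rewrite dst_cut.
have [zs2 z2E z2A] := IH (~~ b) v (nb b j) c ltv t1 o1 s1.
exists (zs1 ++ zs2); last exact: atoms_cat.
by rewrite flat_cat -z1E -z2E yE rcons_cat.
Qed.

(** A word extremal on one side is cut on the other side only. Up to its last cut it is terminal;
    there the distance on the cut side is reset to 0, so the rest is extremal on that side. *)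
Lemma decomp_pure b w : pure b w -> ok w ->
  exists zs y, [/\ w = flat zs ++ y, atoms zs &
    y = [::] \/ exists2 b', pure b' y & eta <= sz y].
Proof.
have [n] := ubnP (size w); elim: n b w => // n IH b w.
rewrite ltnS => lew pw okw.
have [h|h] := leP eta (sz w).
  by exists [::], w; split => //; right; exists b.
case/andP: heta => eta0 eta1.
have [b1 [Y [i [v [wE cY fv]]]]] := peel okw (lt_le_trans h eta1).
have pY : pure b (rcons Y i) by move: pw; rewrite wE => /pure_prefix.
have b1E : b1 = ~~ b.
  by case: (b1) (b) cY pY => [] [] // cY /pure_not_cut; rewrite cY.
rewrite b1E in cY.
have okY : ok (rcons Y i) by move: okw; rewrite wE => /ok_prefix.
have sY : sz (rcons Y i) < eta.
  by apply: le_lt_trans h; rewrite wE; exact: sz_uncut_le.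
have tY : term (~~ b) Y i by rewrite termE negbK pY.
have [zs1 z1E z1A] := decomp_term i tY okY sY.
have pv : pure (~~ b) v by move: (fv (~~ b)); rewrite dst_cut.
have okv : ok v by move: okw; rewrite wE => /ok_suffix.
have sizeE : size w = ((size Y).+1 + size v)%N by rewrite wE size_cat size_rcons.
have ltY : (size Y < n)%N by move: sizeE lew; clear; lia.
have ltv : (size v < n)%N by move: sizeE lew; clear; lia.
have [zs2 [y [vE z2A hy]]] := IH (~~ b) v ltv pv okv.
exists (zs1 ++ zs2), y; split=> //; last exact: atoms_cat.
by rewrite flat_cat -catA -vE -z1E wE.
Qed.

(** The image is measured after a change of the last letter, so that a code can keep all other
    letters of [U]. *)
Definition head_good U :=
  U = [::] \/ exists Y c c', U = rcons Y c /\ eta <= sz (rcons Y c').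

(** Same halving argument, going back from each cut to the previous one. The word after the previous
    cut is terminal: with the neighbouring last letter if both cuts are on the same side, with [j]
    itself if they are on opposite sides. The recursion ends with a head whose changed last letter
    leaves a long image. *)
Lemma decomp_cut b Y j c : cut b Y j -> ok (rcons Y j) -> sz (rcons Y j) < eta ->
  exists U zs, [/\ rcons Y c = U ++ flat zs, head_good U & atoms zs].
Proof.
have [n] := ubnP (size Y); elim: n b Y j c => // n IH b Y j c.
rewrite ltnS => leY cY okY szY.
have [_ sE okt sD] := sz_toggle cY okY.
have [h|szt] := leP eta (sz (rcons Y (nb b j))).
  exists (rcons Y c), [::]; split=> //; first by rewrite cats0.
  by right; exists Y, c, (nb b j).
case/andP: (heta) => eta0 eta1.
have szY' : sz Y < eta.
  have := sD (lt_le_trans szY eta1) (lt_le_trans szt eta1) => e.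
  have : beta * sz Y < 2 * eta by lrab.
  have := ok_rcons okY; rewrite /ok => p0.
  have : 2 * sz Y < beta * sz Y by rewrite ltr_pM2r.
  by lrab.
have [b1 [Z [i [v [YE cZ fv]]]]] := peel (ok_rcons okY) (lt_le_trans szY' eta1).
have okZ : ok (rcons Z i) by move: (ok_rcons okY); rewrite YE => /ok_prefix.
have sZ : sz (rcons Z i) < eta.
  by apply: le_lt_trans szY'; rewrite YE; exact: sz_uncut_le.
have sizeE : size Y = ((size Z).+1 + size v)%N by rewrite YE size_cat size_rcons.
have ltY : (size Z < n)%N by move: sizeE leY; clear; lia.
have ltv : (size v < n)%N by move: sizeE leY; clear; lia.
have [U [zs1 [z1E hU z1A]]] := IH b1 Z i i ltY cZ okZ sZ.
have [b2 [j2 [t1 o1 s1]]] : exists b2 j2, [/\ term b2 v j2, ok (rcons v j2) & sz (rcons v j2) < eta].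
  have fz := fv b1; rewrite dst_cut // in fz.
  have [b1E|b1E] : b1 = b \/ b1 = ~~ b by case: (b1) (b) => [] []; [left|right|right|left].
    exists (~~ b), (nb b j); apply: (@term_toggle b (rcons Z i)); rewrite -?YE //.
    - by rewrite -b1E dst_cut.
    - by rewrite -b1E.
  rewrite b1E in fz cZ.
  have dE : dst (~~ b) Y = aff (~~ b) 0 v by rewrite YE dst_cat dst_cut // fol_dfrom.
  have dlt : 0 < dst (~~ b) (rcons Y j).
    by move: szY; rewrite (szE b) (dst_cut cY); lrab.
  have e : dst (~~ b) (rcons Y j) = beta * aff (~~ b) 0 v - off (~~ b) j.
    move: dlt; rewrite dst_rcons dE /Num.max; case: ifP => //; lrab.
  have cv : cut b v j.
    move: cY; rewrite /cut; have := dst_suffix b (rcons Z i) v; rewrite -YE.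
    have : beta * dst b v <= beta * dst b Y.
      by rewrite ler_pM2l; [rewrite YE; exact: dst_suffix | lrab].
    by move=> h1 h2 h3; lrab.
  have s : sz (rcons v j) = sz (rcons Y j).
    rewrite !(szE b) (dst_cut cv) (dst_cut cY) e dst_rcons /dst (fol_dfrom fz) max_r //.
    by rewrite -e ltW.
  exists b, j; split; rewrite ?s // /ok ?s //.
  rewrite /term /pure fz /= -e (ltW dlt) /=; exact: cv.
have [zs2 z2E z2A] := decomp_term c t1 o1 s1.
exists U, (zs1 ++ zs2); split=> //; last exact: atoms_cat.
by rewrite flat_cat catA -z1E -z2E YE rcons_cat.
Qed.

Lemma decomp w : ok w ->
  exists U zs y, [/\ w = U ++ flat zs ++ y, head_good U, atoms zs &
    y = [::] \/ exists2 b', pure b' y & eta <= sz y].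
Proof.
move=> okw; have [h|h] := leP eta (sz w).
  exists w, [::], [::]; split; [by rewrite /flat /= cats0| |by move=> z|by left].
  rewrite /head_good; case/lastP: w h {okw} => [|Y c] h; first by left.
  by right; exists Y, c, c.
case/andP: (heta) => eta0 eta1.
have [b1 [Y [i [v [wE cY fv]]]]] := peel okw (lt_le_trans h eta1).
have okY : ok (rcons Y i) by move: okw; rewrite wE => /ok_prefix.
have sY : sz (rcons Y i) < eta.
  by apply: le_lt_trans h; rewrite wE; exact: sz_uncut_le.
have [U [zs1 [z1E hU z1A]]] := decomp_cut i cY okY sY.
have pv : pure b1 v by move: (fv b1); rewrite dst_cut.
have okv : ok v by move: okw; rewrite wE => /ok_suffix.
have [zs2 [y [vE z2A hy]]] := decomp_pure pv okv.
exists U, (zs1 ++ zs2), y; split=> //; last exact: atoms_cat.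
by rewrite flat_cat -catA -vE catA -z1E wE.
Qed.

End Decomposition.

End Words.

(** * Counting occurrences of subwords in rearranged words *)

Section Occurrences.

(** An occurrence is counted at its first letter, so the empty word occurs [size s] times. *)
Fixpoint cnt (v s : seq nat) : nat :=
  if s is _ :: s' then (prefix v s + cnt v s')%N else 0%N.

Lemma prefix_cat_le (v s t : seq nat) : (size v <= size s)%N ->
  prefix v (s ++ t) = prefix v s.
Proof. by move=> h; rewrite !prefixE takel_cat. Qed.

Lemma cnt_cons v x s : cnt v (x :: s) = (prefix v (x :: s) + cnt v s)%N.
Proof. by []. Qed.

Lemma cnt_cat_ge v s t : (cnt v s + cnt v t <= cnt v (s ++ t))%N.
Proof.
elim: s => [//|x s IH]; rewrite cat_cons !cnt_cons -addnA; apply: leq_add => //.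
by case h : (prefix v (x :: s)) => //; rewrite -cat_cons prefix_catl.
Qed.

Lemma cnt_cat_le v s t :
  (cnt v (s ++ t) <= cnt v s + cnt v t + minn (size s) (size v))%N.
Proof.
elim: s => [|x s IH]; first by rewrite /= leq_addr.
rewrite cat_cons !cnt_cons.
have [h|h] := leqP (size v) (size (x :: s)).
  rewrite -cat_cons prefix_cat_le //.
  by rewrite -!addnA leq_add2l; move: IH h => /=; lia.
have h1 : (prefix v (x :: s ++ t) <= 1)%N by case: (prefix v _).
by move: IH h h1 => /=; lia.
Qed.

Lemma cnt_size v s : (cnt v s <= size s)%N.
Proof.
elim: s => [//|x s IH]; rewrite cnt_cons -[size _]add1n leq_add //.
by case: (prefix v _).
Qed.

Lemma cnt_flatten v ss :
  (\sum_(s <- ss) cnt v s <= cnt v (flatten ss) <=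
   \sum_(s <- ss) cnt v s + size ss * size v)%N.
Proof.
elim: ss => [|s ss /andP[IH1 IH2]]; first by rewrite big_nil.
rewrite big_cons /=; have := cnt_cat_ge v s (flatten ss).
have := cnt_cat_le v s (flatten ss); rewrite mulSn; lia.
Qed.

Lemma cnt_rcons v s c : (cnt v s <= cnt v (rcons s c) <= cnt v s + (size v).+1)%N.
Proof.
rewrite -cats1; have := cnt_cat_ge v s [:: c]; have := cnt_cat_le v s [:: c].
have h : (cnt v [:: c] <= 1)%N by exact: cnt_size.
by move: h; lia.
Qed.

Lemma cnt_last v s c d : (cnt v (rcons s c) <= cnt v (rcons s d) + (size v).+1)%N.
Proof. by have := cnt_rcons v s c; have := cnt_rcons v s d; lia. Qed.

(* s is a concatenation of the pieces ts up to order, joints and E additional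
   letters. *)
Definition rearr (ts : seq (seq nat)) (s : seq nat) (E J : nat) :=
  (\sum_(t <- ts) size t <= size s <= \sum_(t <- ts) size t + E)%N /\
  forall v, (\sum_(t <- ts) cnt v t <= cnt v s <=
             \sum_(t <- ts) cnt v t + E + J * size v)%N.

Lemma rearr_nil : rearr [::] [::] 0 0.
Proof. by split=> [|v]; rewrite !big_nil. Qed.

Lemma rearr_cat ts1 ts2 s1 s2 E1 E2 J1 J2 : rearr ts1 s1 E1 J1 ->
  rearr ts2 s2 E2 J2 -> rearr (ts1 ++ ts2) (s1 ++ s2) (E1 + E2) (J1 + J2).+1.
Proof.
move=> [a1 b1] [a2 b2]; split; first by rewrite big_cat size_cat /=; lia.
move=> v; rewrite big_cat /=; have := b1 v; have := b2 v.
have := cnt_cat_ge v s1 s2; have := cnt_cat_le v s1 s2; rewrite mulSn mulnDl; lia.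
Qed.

Lemma rearr_extra g : rearr [::] g (size g) 0.
Proof. by split=> [|v]; rewrite !big_nil ?add0n ?leqnn //= addn0 cnt_size. Qed.

Lemma rearr_flatten ts : rearr ts (flatten ts) 0 (size ts).
Proof.
split; last by move=> v; rewrite addn0; exact: cnt_flatten.
by rewrite size_flatten /shape sumnE big_map addn0 leqnn.
Qed.

Lemma rearr_perm ts1 ts2 s E J : perm_eq ts1 ts2 -> rearr ts1 s E J -> rearr ts2 s E J.
Proof.
by move=> p [a b]; split=> [|v]; rewrite -!(perm_big _ p) //=; exact: b.
Qed.

Lemma rearr_weak ts s E E' J J' : (E <= E')%N -> (J <= J')%N ->
  rearr ts s E J -> rearr ts s E' J'.
Proof.
move=> hE hJ [a b]; split=> [|v]; first by lia.
by have := b v; have := leq_mul hJ (leqnn (size v)); lia.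
Qed.

End Occurrences.

(** * Full words, bounded completions and enumeration of extremal words *)

Section Blocks.
Context {R : realType}.
Variables alpha beta : R.
Hypothesis halpha : 0 <= alpha < 1.
Hypothesis hbeta : 2 < beta.
Ltac lrab := have ? := hbeta; have [? ?] := andP halpha; lra.

Local Notation off := (off alpha beta).
Local Notation dst := (dst alpha beta).
Local Notation dfrom := (dfrom alpha beta).
Local Notation aff := (aff alpha beta).
Local Notation sz := (sz alpha beta).
Local Notation ok := (ok alpha beta).
Local Notation pure := (pure alpha beta).
Local Notation K := (nsymb alpha beta).

Definition full w := forall b, dst b w = 0.

Lemma full_nil : full [::]. Proof. by []. Qed.

Lemma sz1_full w : 1 <= sz w -> full w.
Proof.
by move=> h b; have := dst_ge0 alpha beta b w; have := dst_ge0 alpha beta (~~ b) w;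
  move: h; rewrite (szE _ _ b); lra.
Qed.

Lemma full_cat u v : full u -> full v -> full (u ++ v).
Proof. move=> hu hv b; rewrite dst_cat hu; exact: hv. Qed.

(** The second branch is onto since [alpha < 1] and [2 < beta]; this letter will serve for
    padding. *)
Lemma full_two : full [:: 2%N].
Proof. by move=> b; rewrite /dst /dfrom /=; apply: max_l; case: b; rewrite /off; lrab. Qed.

(* Of the pieces into which the letters cut the image of [w], the longest is all of
   (0,1) or at least beta / 2 > 1 times as long as that image. *)
Lemma gap (N : nat) w : ok w -> 1 <= (beta / 2) ^+ N * sz w ->
  exists2 g, (size g <= N)%N & full (w ++ g).
Proof.
elim: N w => [|N IH] w okw.
  by rewrite expr0 mul1r => /sz1_full h; exists [::]; rewrite ?cats0.
move=> hN.
suff [j [okj hj]] : exists j, ok (rcons w j) /\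
    (sz (rcons w j) = 1 \/ beta / 2 * sz w <= sz (rcons w j)).
  case: hj => [s1|hj].
    by exists [:: j] => //; rewrite cats1; apply: sz1_full; rewrite s1.
  have [|g hg fg] := IH (rcons w j) okj.
    apply: le_trans hN _; rewrite exprSr -mulrA ler_wpM2l //.
    by apply: exprn_ge0; lrab.
  by exists (j :: g) => //; rewrite -cat_rcons.
set a := beta * dst false w + alpha.
have a0 : 0 <= a.
  by rewrite addr_ge0 ?mulr_ge0 ?dst_ge0 //; lrab.
(* [j] is the letter at the left end of the image. If it is cut on the right, the next letter either
   covers everything or takes the rest of the image, and one of the two pieces has at least half of
   the total length. *)
pose j := (Num.truncn a).+1.
have /andP[ja1 ja2] := truncn_itv a0.
have e0 : beta * dst false w - off false j = a - (Num.truncn a)%:R.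
  by rewrite /off /j -natr1 /a; ring.
have s0 : 0 < sz w := okw.
have offE : off false j + off true j = beta - 1 by rewrite /off; ring.
have sumE : (beta * dst false w - off false j) + (beta * dst true w - off true j) =
  1 - beta * sz w.
  have -> : beta * dst false w - off false j + (beta * dst true w - off true j) =
     beta * (dst false w + dst true w) - (off false j + off true j) by ring.
  by rewrite offE /sz; ring.
set d0 := beta * dst false w - off false j in e0 sumE.
set d1 := beta * dst true w - off true j in sumE.
have d0ge : 0 <= d0 by rewrite e0; lra.
have d0lt : d0 < 1 by rewrite e0 ltrBlDl natr1.
have D0 : dst false (rcons w j) = d0 by rewrite dst_rcons -/d0 max_r.
have D1 : dst true (rcons w j) = Num.max 0 d1 by rewrite dst_rcons.
have bs : 0 < beta * sz w by rewrite mulr_gt0 //; lrab.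
have bs2 : beta / 2 * sz w = beta * sz w / 2 by ring.
have [d1ge|d1lt] := leP 0 d1.
  exists j; have sE : sz (rcons w j) = beta * sz w.
    transitivity (1 - d0 - d1); last by move: sumE; lra.
    by rewrite /sz D0 D1 max_r.
  by split; [rewrite /ok sE | right; rewrite sE bs2; lra].
have s1 : sz (rcons w j) = 1 - d0 by rewrite /sz D0 D1 max_l ?subr0 // ltW.
have D0' : dst false (rcons w j.+1) = 0.
  rewrite dst_rcons max_l //; move: d0lt; rewrite /d0 /off -[X in _ <= X]/0.
  by rewrite -(natr1 j); lra.
have D1' : dst true (rcons w j.+1) = Num.max 0 (d1 + 1).
  by rewrite dst_rcons /d1 /off -(natr1 j); congr Num.max; ring.
have [d1ge'|d1lt'] := leP (d1 + 1) 0.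
  have sE : sz (rcons w j.+1) = 1 by rewrite /sz D0' D1' max_l // !subr0.
  by exists j.+1; rewrite /ok sE; split => //; left.
have s2 : sz (rcons w j.+1) = - d1.
  by rewrite /sz D0' D1' max_r ?ltW //; ring.
have [le1|le1] := leP (- d1) (1 - d0).
  by exists j; rewrite /ok s1; split; [lra|right; rewrite bs2; lra].
by exists j.+1; rewrite /ok s2; split; [lra|right; rewrite bs2; lra].
Qed.

Lemma gap_unif eta : 0 < eta -> exists N : nat, forall w, eta <= sz w ->
  exists2 g, (size g <= N)%N & full (w ++ g).
Proof.
move=> eta0; have b1 : 1 < beta / 2 by lrab.
have [N hN] : exists N : nat, eta^-1 <= (beta / 2) ^+ N.
  have bp : 0 < beta / 2 - 1 by lrab.
  have [N hN] : exists N : nat, eta^-1 / (beta / 2 - 1) < N%:R.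
    exists (Num.truncn (eta^-1 / (beta / 2 - 1))).+1.
    by apply: Num.Theory.truncnS_gt.
  exists N; rewrite ltr_pdivrMr // in hN.
  apply: (le_trans (ltW hN)).
  elim: N {hN} => [|N IH]; first by rewrite mul0r expr0.
  rewrite exprS -natr1 mulrDl mul1r.
  have : 1 <= (beta / 2) ^+ N by apply: exprn_ege1; exact: ltW.
  move: IH; set x := _ ^+ N; move=> h1 h2.
  have -> : beta / 2 * x = x + (beta / 2 - 1) * x by ring.
  by apply: lerD => //; rewrite ler_peMr // ltW.
exists N => w hw; have okw : ok w by exact: lt_le_trans hw.
apply: gap => //; rewrite -(ler_pdivrMr); last exact: okw.
apply: le_trans hN; rewrite div1r lef_pV2 // posrE //; exact: okw.
Qed.

Lemma letter_le w j : ok w -> j \in w -> (j <= K)%N.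
Proof.
move=> okw jw; case/splitPr: jw okw => u v.
rewrite -cat_rcons => /(ok_prefix hbeta) h; have [_ h2] := ok_letter halpha hbeta h.
rewrite /nsymb; set x := alpha + beta in h2 *.
have x0 : 0 <= x by rewrite /x; lrab.
have : (j%:Z < Num.ceil x + 1)%R.
  rewrite -(ltr_int R) intrD; apply: lt_le_trans h2 _.
  by rewrite lerD2r; exact: Num.Theory.ceil_ge.
have : 0 <= Num.ceil x by rewrite Num.Theory.ceil_ge0; lra.
by case: (Num.ceil x) => n //=; lia.
Qed.

Definition lts := locked (iota 0 K.+1).

Lemma mem_lts c : (c \in lts) = (c <= K)%N.
Proof. by rewrite /lts -lock mem_iota. Qed.

Lemma size_lts : size lts = K.+1.
Proof. by rewrite /lts -lock size_iota. Qed.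

Definition sides := locked [:: false; true].

Lemma mem_sides b : b \in sides.
Proof. by rewrite /sides -lock !inE; case: b. Qed.

Lemma size_sides : size sides = 2%N.
Proof. by rewrite /sides -lock. Qed.

Fixpoint words (m : nat) : seq (seq nat) :=
  if m is m'.+1 then [seq x :: w | x <- lts, w <- words m'] else [:: [::]].

Definition words_upto M := flatten [seq words m | m <- iota 0 M.+1].

Lemma mem_words_upto M w : ok w -> (size w <= M)%N -> w \in words_upto M.
Proof.
move=> okw hM; apply/flatten_mapP; exists (size w); first by rewrite mem_iota.
have : all (fun j => j <= K)%N w by apply/allP => j; exact: letter_le.
elim: w {okw hM} => [|x w IH] //= /andP[hx hw].
by apply/allpairsP; exists (x, w); rewrite mem_lts IH.
Qed.

(** Only finitely many [ok] words have length at most [M]. *)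
Lemma min_sz M : exists2 eta, 0 < eta <= 1 & forall w, ok w -> (size w <= M)%N -> eta <= sz w.
Proof.
suff [eta eta0 h] : exists2 eta, 0 < eta <= 1 & forall w, w \in words_upto M -> ok w -> eta <= sz w.
  by exists eta => // w okw hw; apply: h => //; exact: mem_words_upto.
elim: (words_upto M) => [|u s [eta eta0 IH]]; first by exists 1; rewrite ?ltr01 ?lexx.
have [oku|nu] := boolP (ok u).
  exists (Num.min eta (sz u)).
    by move: oku; rewrite /ok lt_min ge_min => ->; case/andP: eta0 => -> ->.
  move=> w; rewrite inE => /orP[/eqP -> _|/IH h /h h']; first by rewrite ge_min lexx orbT.
  by rewrite ge_min h'.
exists eta => // w; rewrite inE => /orP[/eqP -> h|/IH//].
by rewrite h in nu.
Qed.

(** The next distance has to lie in [0,1), while two different letters give values at least 1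
    apart. *)
Lemma pure_inj b w w' : pure b w -> pure b w' -> ok w -> ok w' ->
  size w = size w' -> w = w'.
Proof.
elim/last_ind: w w' => [|w i IH] w'; first by case: w'.
case/lastP: w' => [|w' j]; first by rewrite size_rcons.
rewrite /pure => p p' o o'; rewrite !size_rcons => -[] e.
have pw := p; rewrite fol_rcons in pw; have pw' := p'; rewrite fol_rcons in pw'.
case/andP: pw => pw pi; case/andP: pw' => pw' pj.
have ww : w = w' by apply: IH => //; apply: (ok_rcons hbeta); eassumption.
rewrite -ww in p' o' pj *; congr rcons.
have := dst_lt1 hbeta b o; have := dst_lt1 hbeta b o'.
rewrite /dst !fol_dfrom // !aff_rcons.
set x := beta * _ in pi pj *; move=> lj li.
have : `|i%:R - j%:R : R| < 1.
  move: pi pj li lj; rewrite /off ltr_norml; case: (b) => h1 h2 h3 h4; apply/andP; split; lra.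
move=> h; have {h} : (`|i%:Z - j%:Z| < 1)%R.
  by rewrite -(ltr_int R) intr_norm intrB.
by clear; lia.
Qed.

Definition extr b m : seq nat := xget [::] [set y | [/\ pure b y, ok y & size y = m]].

Lemma extrE b y : pure b y -> ok y -> extr b (size y) = y.
Proof.
move=> py oky; apply: xget_unique => //= z [pz okz sz]; exact: (@pure_inj b).
Qed.

(* All concatenations of words of length at least P with total length at most n
   which are extremal up to their last letter. *)
Fixpoint gen (P f n : nat) : seq (seq nat) :=
  if f is f'.+1 then
    [::] :: flatten [seq [seq rcons (extr bc.1 m) bc.2 ++ l
                         | bc <- [seq (b, c) | b <- sides, c <- lts],
                           l <- gen P f' (n - m.+1)]
                    | m <- iota P (n - P)]
  else [:: [::]].

(** Removing the first piece, the sizes satisfy S(n) <= 1 + 2 (K + 1) sum of S(n - m - 1) over m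
    from P to n - 1; the condition on [lam] is what keeps the resulting geometric sum below
    lam^n. *)
Lemma gen_size (lam : R) (P f n : nat) : 1 < lam ->
  (4 * K.+1)%:R <= lam ^+ P * (lam - 1) ->
  (size (gen P f n))%:R <= 2 * lam ^+ n.
Proof.
move=> lam1 hP; elim: f n => [|f IH] n.
  by have : 1 <= lam ^+ n by [apply: exprn_ege1; exact: ltW]; rewrite /=; lra.
have ln : 1 <= lam ^+ n by apply: exprn_ege1; exact: ltW.
rewrite /= -natr1 size_flatten /shape -map_comp sumnE big_map.
rewrite (eq_bigr (fun m => (2 * K.+1 * size (gen P f (n - m.+1)))%N)); last first.
  by move=> m _; rewrite /= !size_allpairs size_lts size_sides.
suff : (\sum_(j <- iota P (n - P)) (2 * K.+1 * size (gen P f (n - j.+1))))%N%:R <= lam ^+ n by lra.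
have [le|lt] := leqP n P.
  by move: le; rewrite -subn_eq0 => /eqP ->; rewrite big_nil; lra.
rewrite natr_sum.
have step j : (2 * K.+1 * size (gen P f (n - j.+1)))%N%:R <= (4 * K.+1)%:R * lam ^+ (n - j.+1).
  rewrite natrM; have := IH (n - j.+1)%N; set z := (size _)%:R.
  move=> h; have -> : (4 * K.+1)%:R * lam ^+ (n - j.+1) = (2 * K.+1)%:R * (2 * lam ^+ (n - j.+1)).
    by rewrite !natrM; ring.
  by rewrite ler_wpM2l.
apply: le_trans; first by apply: ler_sum => j _; exact: step.
rewrite -mulr_sumr.
have geo : (\sum_(i <- iota P (n - P)) lam ^+ (n - i.+1)) * (lam - 1) = lam ^+ (n - P) - 1.
  have -> : iota P (n - P) = index_iota P n by [].
  rewrite big_nat_rev /= (_ : P + n = n + P)%N; last by rewrite addnC.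
  rewrite (big_addn 0 n P) /= .
  rewrite (eq_big_nat _ _ (F2 := fun i => lam ^+ i)); last first.
    by move=> i /andP[_ hi]; congr (_ ^+ _); lia.
  rewrite big_mkord mulrC -subrX1 //.
have nE : lam ^+ n = lam ^+ P * lam ^+ (n - P) by rewrite -exprD subnKC // ltnW.
set S := \sum_(i <- _) _ in geo *.
have lp : 0 < lam - 1 by lra.
have S0 : 0 <= S.
  by apply: sumr_ge0 => i _; apply: exprn_ge0; lra.
apply: (@le_trans _ _ (lam ^+ P * (lam - 1) * S)); first by rewrite ler_wpM2r.
have -> : lam ^+ P * (lam - 1) * S = lam ^+ P * (lam ^+ (n - P) - 1) by rewrite -geo; ring.
rewrite nE ler_pM2l; first by lra.
by apply: exprn_gt0; lra.
Qed.

End Blocks.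

(** * Words with almost the same subword counts *)

Section Near.

(** [X] stands for inserted letters and [Y] for joints and changed letters, each of which affects at
    most [size v + 1] occurrences. Apart from the joints, insertions only create occurrences, so [X]
    enters one inequality. *)
Definition near_word (w t : seq nat) (X Y : nat) :=
  (size w <= size t <= size w + X)%N /\
  forall v, (cnt v t <= cnt v w + X + Y * (size v).+1)%N /\
            (cnt v w <= cnt v t + Y * (size v).+1)%N.

Lemma near_cat w1 w2 t1 t2 X1 X2 Y1 Y2 : near_word w1 t1 X1 Y1 ->
  near_word w2 t2 X2 Y2 ->
  near_word (w1 ++ w2) (t1 ++ t2) (X1 + X2) (Y1 + Y2).+1.
Proof.
move=> [a1 b1] [a2 b2]; split; first by rewrite !size_cat; lia.
move=> v; have [c1 d1] := b1 v; have [c2 d2] := b2 v.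
have := cnt_cat_ge v w1 w2; have := cnt_cat_le v w1 w2.
have := cnt_cat_ge v t1 t2; have := cnt_cat_le v t1 t2.
rewrite mulSn mulnDl; lia.
Qed.

Lemma near_extra g : near_word [::] g (size g) 0.
Proof. by split=> [|v] /=; [lia|have := cnt_size v g; lia]. Qed.

Lemma near_refl w : near_word w w 0 0.
Proof. by split=> [|v]; [lia|lia]. Qed.

Lemma near_last s c d : near_word (rcons s c) (rcons s d) 0 1.
Proof.
split=> [|v]; first by rewrite !size_rcons; lia.
by have := cnt_last v s c d; have := cnt_last v s d c; lia.
Qed.

Lemma near_weak w t X X' Y Y' : (X <= X')%N -> (Y <= Y')%N ->
  near_word w t X Y -> near_word w t X' Y'.
Proof.
move=> hX hY [a b]; split; first by lia.
by move=> v; have [c d] := b v; have := leq_mul hY (leqnn (size v).+1); lia.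
Qed.

Lemma near_trans w t s X X' Y Y' : near_word w t X Y -> near_word t s X' Y' ->
  near_word w s (X + X') (Y + Y').
Proof.
move=> [a b] [a' b']; split; first by lia.
by move=> v; have [c d] := b v; have [c' d'] := b' v; rewrite mulnDl; lia.
Qed.

Lemma rearr_near ts s E J : rearr ts s E J ->
  near_word (flatten ts) s E (J + size ts).
Proof.
move=> [a b]; split.
  by rewrite size_flatten /shape sumnE big_map.
move=> v; have := b v; have := cnt_flatten v ts; rewrite mulnDl !mulnS; lia.
Qed.

Lemma near_flatten (T : eqType) (zs : seq T) (f g : T -> seq nat) :
  (forall z, z \in zs -> near_word (f z) (g z) 0 1) ->
  near_word (flatten (map f zs)) (flatten (map g zs)) 0 (2 * size zs).
Proof.
elim: zs => [|z zs IH] h; first by exact: near_refl.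
have := near_cat (h z (mem_head _ _)) (IH _).
move=> /(_ _)/near_weak; rewrite /=; apply; rewrite ?mulnS; [by []|lia|].
by move=> y hy; apply: h; rewrite inE hy orbT.
Qed.

End Near.

(** * Recoding words as full words of one length *)

Section Coding.
Context {R : realType}.
Variables alpha beta : R.
Hypothesis halpha : 0 <= alpha < 1.
Hypothesis hbeta : 2 < beta.
Ltac lrab := have ? := hbeta; have [? ?] := andP halpha; lra.

Local Notation dst := (dst alpha beta).
Local Notation sz := (sz alpha beta).
Local Notation ok := (ok alpha beta).
Local Notation pure := (pure alpha beta).
Local Notation full := (full alpha beta).
Local Notation K := (nsymb alpha beta).

(* The word t may be repeated and can be completed to a full word by at most G
   letters. *)
Definition loopable (t : seq nat) (G : nat) :=
  (forall W, (forall b, dst b W = dst b t) -> forall b, dst b (W ++ t) = dst b t) /\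
  exists2 g, (size g <= G)%N & full (t ++ g).

Lemma flatten_nseqSr (t : seq nat) A :
  flatten (nseq A.+1 t) = flatten (nseq A t) ++ t.
Proof.
elim: A => [|A IH]; first by rewrite /= cats0.
by rewrite -[LHS]/(t ++ flatten (nseq A.+1 t)) {1}IH catA.
Qed.

Lemma build_rep t G A : loopable t G ->
  exists2 s, full s & rearr (nseq A t) s G A.+1.
Proof.
move=> [l [g hg fg]]; case: A => [|A].
  exists [::]; first exact: full_nil.
  exact: rearr_weak rearr_nil.
exists (flatten (nseq A.+1 t) ++ g).
  move=> b; have h : forall b, dst b (flatten (nseq A.+1 t)) = dst b t.
    elim: A => [|A IH]; first by rewrite /= cats0.
    by move=> b'; rewrite flatten_nseqSr l.
  by rewrite dst_cat h -dst_cat.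
have := rearr_cat (rearr_flatten (nseq A.+1 t)) (rearr_extra g).
by rewrite cats0 size_nseq; apply: rearr_weak => //; rewrite ?addn0.
Qed.

(** Equal pieces are grouped into powers, and a power needs only the completion of a single copy;
    the added length thus depends on the number of types and not on the number of pieces. *)
Lemma build_short tys G ts : (forall t, t \in ts -> t \in tys /\ loopable t G) ->
  exists2 s, full s & rearr ts s (size tys * G) (size ts + 2 * size tys).
Proof.
elim: tys ts => [|t tys IH] ts h.
  case: ts h => [|t ts] h; last by have [] := h t (mem_head _ _).
  by exists [::]; [exact: full_nil|exact: rearr_nil].
have [|s2 f2 c2] := IH [seq u <- ts | predC1 t u].
  move=> u; rewrite mem_filter /= => /andP[ut /h[]].
  by rewrite inE (negbTE ut).
have p : perm_eq ([seq u <- ts | pred1 t u] ++ [seq u <- ts | predC1 t u]) ts.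
  by rewrite perm_sym; apply/permPl => x; rewrite -(perm_filterC (pred1 t) ts).
have szp := perm_size p; rewrite size_cat in szp.
have [tin|tnin] := boolP (t \in ts); last first.
  have e : [seq u <- ts | predC1 t u] = ts.
    by apply/all_filterP/allP => u uts /=; apply: contraNneq tnin => <-.
  rewrite e in c2; exists s2 => //; apply: rearr_weak c2 => /=; first by rewrite mulSn leq_addl.
  by rewrite leq_add2l leq_mul.
have [_ lt] := h t tin.
have e : [seq u <- ts | pred1 t u] = nseq (size [seq u <- ts | pred1 t u]) t.
  by apply/all_pred1P; exact: filter_all.
have [s1 f1 c1] := build_rep (size [seq u <- ts | pred1 t u]) lt.
rewrite -e in c1.
exists (s1 ++ s2); first exact: full_cat.
apply: (rearr_perm p); apply: rearr_weak (rearr_cat c1 c2); first by rewrite mulSn.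
rewrite -szp; set a := size _; set b := size [seq u <- ts | predC1 t u].
by rewrite -[size (t :: tys)]/(size tys).+1; set c := size tys; clear; lia.
Qed.

Lemma build_long G ts : (forall t, t \in ts -> loopable t G) ->
  exists2 s, full s & rearr ts s (size ts * G) (3 * size ts).
Proof.
elim: ts => [|t ts IH] h.
  by exists [::]; [exact: full_nil|exact: rearr_nil].
have [|s fs cs] := IH; first by move=> u hu; apply: h; rewrite inE hu orbT.
have [_ [g hg fg]] := h t (mem_head _ _).
exists ((t ++ g) ++ s); first exact: full_cat.
have := rearr_cat (rearr_cat (rearr_flatten [:: t]) (rearr_extra g)) cs.
rewrite /= !cats0; apply: rearr_weak; first by rewrite add0n mulSn leq_add2r.
by lia.
Qed.

(** Pieces of length at most [M] are grouped by type; the others are completed one by one, and their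
    number [nl] is bounded through the total length. *)
Lemma build tys N N' M ts :
  (forall t, t \in ts -> if (size t <= M)%N then t \in tys /\ loopable t N' else loopable t N) ->
  exists2 s, full s &
   exists2 nl, (nl * M <= \sum_(t <- ts) size t)%N &
   rearr ts s (size tys * N' + nl * N) (3 * size ts + 2 * size tys).+1.
Proof.
move=> h; pose p := fun t : seq nat => (size t <= M)%N.
have [|s1 f1 c1] := @build_short tys N' [seq u <- ts | p u].
  by move=> t; rewrite mem_filter => /andP[pt /h]; rewrite -/(p t) pt.
have [|s2 f2 c2] := @build_long N [seq u <- ts | ~~ p u].
  by move=> t; rewrite mem_filter => /andP[pt /h]; rewrite -/(p t) (negbTE pt).
have pe : perm_eq ([seq u <- ts | p u] ++ [seq u <- ts | ~~ p u]) ts.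
  by rewrite perm_sym; apply/permPl => x; rewrite -(perm_filterC p ts).
have szp := perm_size pe; rewrite size_cat in szp.
exists (s1 ++ s2); first exact: full_cat.
exists (size [seq u <- ts | ~~ p u]).
  rewrite -(perm_big _ pe) big_cat /=; apply: leq_trans (leq_addl _ _).
  rewrite -sum1_size big_distrl /= big_seq [leqRHS]big_seq.
  apply: leq_sum => t; rewrite mem_filter mul1n => /andP[/=].
  by rewrite /p -ltnNge => /ltnW.
apply: (rearr_perm pe); apply: rearr_weak (rearr_cat c1 c2) => //.
by rewrite -szp; lia.
Qed.

Definition base (z : bool * seq nat * nat) (j : nat) := rcons z.1.2 j.

Lemma mem_gen P zs f n : (size zs <= f)%N -> (size (flat zs) <= n)%N ->
  (forall z, z \in zs -> [/\ pure (~~ z.1.1) z.1.2, ok z.1.2, (P <= size z.1.2)%N & (z.2 <= K)%N]) ->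
  flat zs \in gen alpha beta P f n.
Proof.
elim: zs f n => [|z zs IH] f n.
  by case: f => [|f] _ _ _; rewrite /flat /= inE.
case: f => [//|f] /=; rewrite ltnS => hf.
rewrite /flat /= size_cat size_rcons -/(flat zs) => hn h.
have [pz oz hP zK] := h z (mem_head _ _).
rewrite inE; apply/orP; right; apply/flatten_mapP; exists (size z.1.2).
  by rewrite mem_iota hP; lia.
apply/allpairsP; exists ((~~ z.1.1, z.2), flat zs); split.
- apply: (@allpairs_f _ _ _ pair); last by rewrite mem_lts.
  exact: mem_sides.
- apply: IH => //; first by lia.
  by move=> u hu; apply: h; rewrite inE hu orbT.
- by rewrite (extrE hbeta).
Qed.

(** Bernoulli's inequality: lam^n >= n (lam - 1). *)
Lemma exp_unbounded (lam c : R) : 1 < lam -> exists n : nat, c <= lam ^+ n * (lam - 1).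
Proof.
move=> l1; have lp : 0 < lam - 1 by lra.
pose d := (lam - 1) * (lam - 1); have dp : 0 < d by rewrite mulr_gt0.
exists (Num.truncn (c / d)).+1; set n := _.+1.
have hn : c / d < n%:R by apply: Num.Theory.truncnS_gt.
rewrite ltr_pdivrMr // in hn; apply: (le_trans (ltW hn)).
rewrite /d mulrA ler_pM2r //.
elim: (n) => [|m IH]; first by rewrite mul0r expr0.
rewrite exprS -natr1 mulrDl mul1r.
have : 1 <= lam ^+ m by apply: exprn_ege1; exact: ltW.
move: IH; set x := _ ^+ m; move=> h1 h2.
have -> : lam * x = x + (lam - 1) * x by ring.
by apply: lerD => //; rewrite ler_peMr // ltW.
Qed.

(** A code begins with all letters of the head but the last, so the position and the value of that
    letter determine the head. *)
Definition heads n t : seq (seq nat) :=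
  [::] :: [seq rcons (take i t) c | i <- iota 0 n, c <- lts alpha beta].

Definition tails n : seq (seq nat) :=
  [::] :: [seq extr alpha beta b m | b <- sides, m <- iota 0 n.+1].

Definition decoder P n t : seq (seq nat) :=
  [seq u ++ z | u <- heads n t, z <- [seq z ++ y | z <- gen alpha beta P n n, y <- tails n]].

(** There are at most (K + 1)(n + 1) heads, 3 (n + 1) tails and 2 lam^n middle parts. *)
Lemma decoder_size P n t (lam : R) : 1 < lam ->
  (4 * K.+1)%:R <= lam ^+ P * (lam - 1) ->
  (size (decoder P n t))%:R <= (6 * K.+1 * n.+1 ^ 2)%:R * lam ^+ n.
Proof.
move=> l1 hP; rewrite /decoder !size_allpairs.
have := gen_size halpha hbeta n n l1 hP; set G := size _ => hG.
have h1 : (size (heads n t) <= K.+1 * n.+1)%N.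
  by rewrite /heads [size (_ :: _)]/= size_allpairs size_iota size_lts; nia.
have h2 : (size (tails n) <= 3 * n.+1)%N.
  have -> : size (tails n) = (size sides * size (iota 0 n.+1)).+1.
    by rewrite -(size_allpairs (fun b m => extr alpha beta b m)).
  by rewrite size_sides size_iota; clear; lia.
apply: (@le_trans _ _ (K.+1 * n.+1 * (G * (3 * n.+1)))%N%:R).
  by rewrite ler_nat leq_mul // leq_mul.
have -> : (K.+1 * n.+1 * (G * (3 * n.+1)))%N%:R = (3 * K.+1 * n.+1 ^ 2)%:R * G%:R :> R.
  by rewrite -natrM; congr (_%:R); rewrite expnS expn1; nia.
have -> : (6 * K.+1 * n.+1 ^ 2)%:R * lam ^+ n = (3 * K.+1 * n.+1 ^ 2)%:R * (2 * lam ^+ n).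
  by rewrite mulrA -natrM; congr (_%:R * _); lia.
by rewrite ler_wpM2l.
Qed.

(* In the decomposition w = U ++ flat zs ++ y, the word U is a prefix of t up to its
   last letter, while extremal words are determined by their side and length;
   hence w is one of few candidates once t is known. *)
Lemma coding (D : nat) : (0 < D)%N ->
  exists C (dec : nat -> seq nat -> seq (seq nat)),
   (forall n t, (size (dec n t))%:R <= (C * n.+1 ^ 2)%:R * (1 + D%:R^-1) ^+ n :> R) /\
   forall n w, ok w -> size w = n ->
   exists t, [/\ full t, size t = (n + n %/ D + C)%N, w \in dec n t &
     near_word w t (2 * (n %/ D) + 2 * C) (10 * (n %/ D) + C)].
Proof.
move=> D0; have lam1 : 1 < 1 + D%:R^-1 :> R by rewrite ltrDl invr_gt0 ltr0n.
set lam := 1 + D%:R^-1 in lam1 *.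
have [P0 hP0] := exp_unbounded (4 * K.+1)%:R lam1.
(* [P0] controls the number of middle parts; [P >= D] bounds the number of pieces by [n / D]. *)
pose P := maxn P0 D.
have hP : (4 * K.+1)%:R <= lam ^+ P * (lam - 1).
  apply: (le_trans hP0); rewrite ler_pM2r; last by lra.
  by rewrite ler_weXn2l ?leq_maxl //; exact: ltW.
(* Words of length at most [P] have images of length at least [eta], so every piece, being terminal
   with a shorter image, has more than [P] letters. *)
have [eta eta01 heta] := min_sz halpha hbeta P.
have [eta0 eta1] := andP eta01.
have [N hN] := gap_unif halpha hbeta eta0.
(* A piece with more than [D * N] letters receives at most [N] new ones, which adds at most [n / D]
   letters over the whole word. *)
pose M := (D * N)%N.
have [eta' /andP[eta0' _] heta'] := min_sz halpha hbeta M.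
have [N' hN'] := gap_unif halpha hbeta eta0'.
pose tys := words_upto alpha beta M.
pose C := (2 * N + size tys * N' + 2 * size tys + 10 + 6 * K.+1)%N.
exists C, (decoder P); split.
  move=> n t; apply: le_trans (decoder_size _ _ lam1 hP) _.
  by rewrite ler_wpM2r ?exprn_ge0 //; [lra|rewrite ler_nat leq_mul2r /C; lia].
move=> n w okw sw.
have [U [zs [y [wE hU hzs hy]]]] := decomp halpha hbeta M eta01 okw.
have okfz : forall z, z \in zs -> exists j, [/\
   loopable (base z j) (if (size (base z j) <= M)%N then N' else N),
   ok (base z j) & (P <= size z.1.2)%N].
  move=> z /hzs [j [tz oz szz le or_]].
  have [_ _ okt _] := sz_toggle halpha hbeta (proj2 (andP tz)) oz.
  exists (nb z.1.1 j); rewrite /base; split=> //.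
    split; first by move=> W; apply: (loop halpha hbeta tz oz le).
    case: ifP => hM; first by apply: hN'; apply: heta'.
    apply: hN; case: or_ => // h; move: hM; rewrite size_rcons.
    by rewrite h.
  rewrite leqNgt; apply/negP => h; move: szz; rewrite ltNge => /negP; apply.
  by apply: heta => //; rewrite size_rcons.
have [jf hjf] : exists jf : bool * seq nat * nat -> nat, forall z, z \in zs -> [/\
   loopable (base z (jf z)) (if (size (base z (jf z)) <= M)%N then N' else N),
   ok (base z (jf z)) & (P <= size z.1.2)%N].
  have /choice[jf h] : forall z, exists j, z \in zs -> [/\
   loopable (base z j) (if (size (base z j) <= M)%N then N' else N),
   ok (base z j) & (P <= size z.1.2)%N].
    move=> z; have [zin|] := boolP (z \in zs); last by exists 0%N.
    by have [j hj] := okfz z zin; exists j.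
  by exists jf.
pose ts := [seq base z (jf z) | z <- zs].
have [|s fs [nl hnl cs]] := @build tys N N' M ts.
  move=> t /mapP[z /hjf[lz oz _] ->]; case: ifP lz => // hM lz; split=> //.
  exact: mem_words_upto.
have sumts : (\sum_(t <- ts) size t)%N = size (flat zs).
  rewrite /ts big_map /flat size_flatten /shape -map_comp sumnE big_map.
  by apply: eq_bigr => z _; rewrite /= !size_rcons.
have nzs : near_word (flat zs) s (size tys * N' + nl * N) (6 * size zs + 2 * size tys).+1.
  have := near_flatten (zs := zs) (f := fun z => rcons z.1.2 z.2) (g := fun z => base z (jf z)).
  move=> /(_ (fun z _ => near_last _ _ _)) h1.
  apply: near_weak (near_trans h1 (rearr_near cs)) => //.
  have -> : size ts = size zs by rewrite size_map.
  by set a := size zs; set b := size tys; clearbody a b; clear; lia.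
have [Ut [fUt nU hUt]] : exists Ut, [/\ full Ut, near_word U Ut N 2 &
    U = [::] \/ exists Y c r, U = rcons Y c /\ Ut = Y ++ r].
  case: hU => [->|[Y [c [c' [-> hc]]]]].
    by exists [::]; split; [exact: full_nil|apply: near_weak (near_refl _)|left].
  have [g hg fg] := hN _ hc.
  exists (rcons Y c' ++ g); split => //; last first.
    by right; exists Y, c, (c' :: g); rewrite cat_rcons.
  have := near_cat (near_last Y c c') (near_extra g).
  by rewrite cats0; apply: near_weak.
have [yt [fyt ny]] : exists yt, [/\ full yt & near_word y yt N 1].
  case: hy => [->|[b py hy]].
    by exists [::]; split; [exact: full_nil|apply: near_weak (near_refl _)].
  have [g hg fg] := hN _ hy.
  exists (y ++ g); split => //.
  have := near_cat (near_refl y) (near_extra g).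
  by rewrite cats0; apply: near_weak.
have ncore := near_cat nU (near_cat nzs ny).
rewrite -wE in ncore.
set X := (N + _)%N in ncore; set Y := (_.+1) in ncore.
have sflat : (size (flat zs) <= n)%N by rewrite -sw wE !size_cat; clear; lia.
have hnl' : (nl * N <= n %/ D)%N.
  rewrite leq_divRL // -mulnA (mulnC N); apply: leq_trans sflat.
  by rewrite -sumts.
have hz : (size zs <= n %/ D)%N.
  rewrite leq_divRL //; apply: leq_trans sflat.
  rewrite -sumts /ts big_map -sum1_size big_distrl /= big_seq [leqRHS]big_seq.
  apply: leq_sum => z /hjf[_ _ hPz]; rewrite mul1n size_rcons.
  by apply: leqW; apply: leq_trans hPz; rewrite leq_maxr.
have hX : (X <= n %/ D + (2 * N + size tys * N'))%N by move: hnl'; rewrite /X; clear; lia.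
set core := Ut ++ _ in ncore.
have [/andP[sc1 sc2] _] := ncore; rewrite sw in sc1 sc2.
(* Padding by [p] letters 2 brings all codes to the same length and keeps them full. *)
pose p := (n + n %/ D + C - size core)%N.
have hp : (size core + p = n + n %/ D + C)%N by move: sc2 hX; rewrite /p /C; clear; lia.
exists (core ++ nseq p 2); split.
- apply: full_cat; last first.
    elim: (p) => [|q IH]; first exact: full_nil.
    exact: (full_cat (full_two halpha hbeta) IH).
  by rewrite /core; apply: full_cat => //; exact: full_cat.
- by rewrite size_cat size_nseq.
- rewrite wE; apply: allpairs_f; last apply: allpairs_f.
  + case: hUt => [->|[Y' [c [r [UE UtE]]]]]; first by rewrite /heads inE eqxx.
    rewrite /heads inE; apply/orP; right; apply/allpairsP; exists (size Y', c); split => /=.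
    * by rewrite mem_iota /= add0n -sw wE UE !size_cat size_rcons; clear; lia.
    * rewrite mem_lts; apply: (letter_le halpha hbeta okw).
      by rewrite wE UE mem_cat mem_rcons inE eqxx.
    * by rewrite /core UtE -!catA take_size_cat.
  + apply: mem_gen => //; first by apply: leq_trans hz (leq_div _ _).
    move=> z zin; have [j [tz oz _ _ _]] := hzs z zin; have [_ _ hPz] := hjf z zin.
    split => //.
    * by move: tz; rewrite termE => /andP[]; rewrite -cats1 => /pure_prefix.
    * exact: (ok_rcons hbeta oz).
    * apply: (letter_le halpha hbeta okw); rewrite wE !mem_cat; apply/orP; right.
      apply/orP; left; apply/flatten_mapP; exists z => //.
      by rewrite mem_rcons inE eqxx.
  + case: hy => [->|[b py hy]]; first by rewrite /tails inE eqxx.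
    rewrite /tails inE; apply/orP; right; apply/allpairsP; exists (b, size y); split.
    * exact: mem_sides.
    * by rewrite mem_iota add0n -sw wE !size_cat /=; clear; lia.
    * by rewrite (extrE hbeta) //; exact: lt_le_trans hy.
- have := near_cat ncore (near_extra (nseq p 2)); rewrite cats0 size_nseq.
  apply: near_weak; first by move: hX sc1; rewrite /p /C; clear; lia.
  by move: hz; rewrite /Y /C; clear; lia.
Qed.

End Coding.

(** * Neighbourhoods and compactness in the space of sequences *)

Section SequenceTopology.

Definition agree (n : nat) (x : oneseq) : set oneseq :=
  [set y | forall i, (i < n)%N -> y i = x i].

Lemma agree_nbhs n (x : oneseq) : nbhs x (agree n x).
Proof.
elim: n => [|n IH]; first by apply: filterS filterT => y _ i.
have h : nbhs x [set y : oneseq | y n = x n].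
  have := @proj_continuous nat (fun _ => nat) n x [set x n].
  by apply; apply/principal_filterP.
apply: filterS2 IH h => y hy hn i; rewrite ltnS leq_eqVlt => /orP[/eqP -> //|].
exact: hy.
Qed.

Lemma nbhs_agree (x : oneseq) (A : set oneseq) : nbhs x A ->
  exists n, agree n x `<=` A.
Proof.
pose F := filter_from [set: nat] (fun n => agree n x).
have FF : Filter F.
  apply: filter_from_filter; first by exists 0%N.
  move=> i j _ _; exists (maxn i j) => // y hy; split=> k hk; apply: hy.
    by rewrite (leq_trans hk) // leq_maxl.
  by rewrite (leq_trans hk) // leq_maxr.
have Fx : F --> (x : prod_topology (fun _ : nat => nat)).
  apply/cvg_sup => N U [V] [[W] oW <-] WfN WU.
  by apply: (filterS WU); exists N.+1 => // y /= -> .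
by move=> /Fx [n _ h]; exists n.
Qed.

Lemma closure_agree (A : set oneseq) y :
  closure A y <-> forall n, exists2 x, A x & agree n y x.
Proof.
split=> [cA n|h B /nbhs_agree[n hn]].
  by have [x [Ax hx]] := cA _ (agree_nbhs n y); exists x.
by have [x Ax hx] := h n; exists x; split=> //; exact: hn.
Qed.

Lemma continuous_agree (g : oneseq -> oneseq) :
  (forall n, exists m, forall x y, agree m x y -> agree n (g x) (g y)) ->
  continuous g.
Proof.
move=> h x B /nbhs_agree[n hn]; have [m hm] := h n.
by apply: filterS (agree_nbhs m x) => y /hm /hn.
Qed.

Lemma compact_letters_le (k : nat) : compact [set x : oneseq | forall i, (x i <= k)%N].
Proof.
apply: (@tychonoff nat (fun _ => nat) (fun _ => [set j | (j <= k)%N])) => _.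
apply: finite_compact; exact: (finite_II k.+1).
Qed.

Definition catw (w : seq nat) (y : oneseq) : oneseq :=
  fun n => if (n < size w)%N then nth 0%N w n else y (n - size w)%N.

Lemma catw_nil y : catw [::] y = y.
Proof. by apply/funext => n; rewrite /catw /= subn0. Qed.

Lemma catw_cat u v y : catw (u ++ v) y = catw u (catw v y).
Proof.
apply/funext => n; rewrite /catw size_cat nth_cat.
have [h|h] := ltnP n (size u); first by rewrite ltn_addr.
by rewrite subnDA -[in LHS](subnKC h) ltn_add2l; case: ifP => // _; rewrite subnKC.
Qed.

Lemma agree_catw w x y n : agree n x y -> agree (size w + n) (catw w x) (catw w y).
Proof.
move=> h i hi; rewrite /catw; case: ltnP => // hs; apply: h; lia.
Qed.

Lemma shift_catw w y n : (iter (size w) seq_shift (catw w y)) n = y n.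
Proof.
have h m (x : oneseq) : iter m seq_shift x n = x (n + m)%N.
  elim: m x => [|m IH] x; first by rewrite addn0.
  by rewrite iterSr IH /seq_shift addnS.
by rewrite h /catw ltnNge leq_addl /= addnK.
Qed.

End SequenceTopology.

(** * Words and points of the shift *)

Section Symbolic.
Context {R : realType}.
Variables alpha beta : R.
Hypothesis halpha : 0 <= alpha < 1.
Hypothesis hbeta : 2 < beta.
Ltac lrab := have ? := hbeta; have [? ?] := andP halpha; lra.

Local Notation K := (nsymb alpha beta).
Local Notation T := (Tab alpha beta).
Local Notation I := (Iab alpha beta).
Local Notation dst := (dst alpha beta).
Local Notation off := (off alpha beta).
Local Notation ok := (ok alpha beta).
Local Notation sz := (sz alpha beta).
Local Notation full := (full alpha beta).
Local Notation Sg := (Sigma_plus alpha beta).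

Lemma nsymb_bounds : K%:R - 1 < alpha + beta <= K%:R.
Proof.
have h0 : 0 <= Num.ceil (alpha + beta) by rewrite Num.Theory.ceil_ge0; lrab.
have e : K%:R = (Num.ceil (alpha + beta))%:~R :> R.
  by rewrite /nsymb -[in RHS](gez0_abs h0).
rewrite e Num.Theory.ceil_ge andbT.
by have := Num.Theory.ceil_itv (alpha + beta) => /andP[]; rewrite intrB.
Qed.

Lemma nsymb_ge3 : (2 < K)%N.
Proof.
have /andP[_ h] := nsymb_bounds; rewrite -(ltr_nat R); lrab.
Qed.

(** The three shapes of intervals have this one description, thanks to K - 1 < alpha + beta <= K at
    the right end and 0 <= alpha < 1 at the left one. *)
Lemma IabE j x : (1 <= j <= K)%N ->
  I j x <-> [/\ 0 < x, x < 1, j%:R - 1 < beta * x + alpha & beta * x + alpha < j%:R].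
Proof.
move=> /andP[j1 jK]; have /andP[k1 k2] := nsymb_bounds.
have b0 : 0 < beta by lrab.
have k3 : 3 <= K%:R :> R by rewrite (ler_nat R 3 K) nsymb_ge3.
have [a0 a1] := andP halpha.
have mE : x * beta = beta * x by rewrite mulrC.
have hx1 : x < 1 -> beta * x < beta by move=> h; rewrite gtr_pMr.
have hx0 : 0 < x -> 0 < beta * x by move=> h; rewrite mulr_gt0.
have hx1' : beta * x < beta -> x < 1 by rewrite gtr_pMr.
have hx0' : 0 < beta * x -> 0 < x by rewrite pmulr_rgt0.
rewrite /Iab; case: eqP => [->|/eqP jn1].
  rewrite /= in_itv /= ltr_pdivlMr // mE; split.
    by move=> /andP[h1 h2]; have := hx0 h1; split => //; [apply: hx1'|..]; lra.
  by move=> [h1 h2 h3 h4]; apply/andP; split; lra.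
have j2 : 2 <= j%:R :> R by rewrite (ler_nat R 2 j); move: jn1 j1; clear; lia.
have jK' : j%:R <= K%:R :> R by rewrite ler_nat.
case: eqP => [->|/eqP jnK].
  rewrite /= in_itv /= ltr_pdivrMr // mE; split.
    by move=> /andP[h1 h2]; have := hx1 h2; split => //; [apply: hx0'|..]; lra.
  by move=> [h1 h2 h3 h4]; apply/andP; split; lra.
have jK1 : j%:R <= K%:R - 1 :> R by rewrite lerBrDr natr1 ler_nat; move: jnK jK; clear; lia.
rewrite /= in_itv /= ltr_pdivrMr // ltr_pdivlMr // mE; split.
  by move=> /andP[h1 h2]; split => //; [apply: hx0'|apply: hx1'|..]; lra.
by move=> [h1 h2 h3 h4]; apply/andP; split; lra.
Qed.

Lemma TabE j x : (1 <= j <= K)%N -> I j x -> T x = beta * x - off false j.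
Proof.
move=> hj /(IabE _ hj)[h1 h2 h3 h4]; rewrite /Tab.
have -> : Num.floor (beta * x + alpha) = j%:Z - 1.
  apply: Num.Theory.floor_def; rewrite !intrD !intrN /=.
  by rewrite -[j%:~R]/(j%:R) subrK; apply/andP; split; [exact: ltW|].
by rewrite intrB /off; ring.
Qed.

Lemma It_eq x n j : (1 <= j <= K)%N -> I j (iter n T x) -> It alpha beta x n = j.
Proof.
move=> hj hI; apply: xget_unique => //= i [hi hIi].
move: hI hIi => /(IabE _ hj)[_ _ h3 h4] /(IabE _ hi)[_ _ h5 h6].
have h7 : j%:R < i%:R + 1 :> R by lra.
have h8 : i%:R < j%:R + 1 :> R by lra.
by move: h7 h8; rewrite !natr1 !ltr_nat; clear; lia.
Qed.

Lemma It_spec x n : Xab alpha beta x ->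
  (1 <= It alpha beta x n <= K)%N /\ I (It alpha beta x n) (iter n T x).
Proof.
move=> [_ /(_ n)[j hj hI]]; have -> := It_eq hj hI; split=> //.
Qed.

(** This links [dst] to the dynamics: an iterate lies strictly inside the image of its cylinder,
    which therefore has positive length. *)
Lemma trace_bounds x n : Xab alpha beta x ->
  dst false (mkseq (It alpha beta x) n) < iter n T x < 1 - dst true (mkseq (It alpha beta x) n).
Proof.
move=> Xx; have b0 : 0 < beta by lrab.
elim: n => [|n /andP[IH1 IH2]].
  have [h1 h2] := It_spec 0 Xx.
  have /(IabE _ h1)[? ? _ _] := h2.
  by rewrite /dst /dfrom /= subr0; apply/andP.
rewrite mkseqS !dst_rcons.
have [h1 h2] := It_spec n Xx.
set j := It _ _ _ _ in h1 h2 *.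
have /(IabE _ h1)[g1 g2 g3 g4] := h2.
rewrite iterS (TabE h1 h2); set t := iter n T x in IH1 IH2 g1 g2 g3 g4 *.
have off01 : off true j = beta - 1 - off false j by rewrite /off; ring.
have offE : off false j = j%:R - 1 - alpha by [].
apply/andP; split.
  by rewrite gt_max ltrD2r ltr_pM2l // IH1 andbT offE; lra.
rewrite ltrBrDl -ltrBrDr gt_max; apply/andP; split; first by rewrite offE; lra.
have : beta * dst true (mkseq (It alpha beta x) n) < beta * (1 - t) by rewrite ltr_pM2l //; lra.
by rewrite off01; lra.
Qed.

Lemma Sigma_ok y n : Sg y -> ok (mkseq y n).
Proof.
move=> /closure_agree /(_ n)[_ [x Xx <-] hx].
have -> : mkseq y n = mkseq (It alpha beta x) n.
  apply: (@eq_from_nth _ 0%N); rewrite ?size_mkseq // => i hi.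
  by rewrite !nth_mkseq // hx.
by have /andP[h1 h2] := trace_bounds n Xx; rewrite /ok /sz; lra.
Qed.

Lemma Sigma_letter y n : Sg y -> (1 <= y n <= K)%N.
Proof.
move=> Sy; have okw := Sigma_ok n.+1 Sy; apply/andP; split.
  by move: okw; rewrite mkseqS => /(ok_letter halpha hbeta)[].
by apply: (letter_le halpha hbeta okw); rewrite mkseqS mem_rcons inE eqxx.
Qed.

Lemma Xab_T x : Xab alpha beta x -> Xab alpha beta (T x).
Proof.
move=> Xx; split; last by move=> n; rewrite -iterSr; exact: (proj2 Xx).
have [h1 h2] := It_spec 1 Xx.
by have /(IabE _ h1)[g1 g2 _ _] := h2; rewrite ltW.
Qed.

Lemma Sigma_shift y : Sg y -> Sg (seq_shift y).
Proof.
move=> /closure_agree h; apply/closure_agree => n.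
have [_ [x Xx <-] hx] := h n.+1.
exists (It alpha beta (T x)); first by exists (T x) => //; exact: Xab_T.
move=> i hi; rewrite /seq_shift -hx //.
have [h1 h2] := It_spec i.+1 Xx.
by apply: It_eq => //; rewrite -iterSr.
Qed.

Lemma Sigma_iter_shift y n : Sg y -> Sg (iter n seq_shift y).
Proof. by move=> h; elim: n => [//|n IH] /=; exact: Sigma_shift. Qed.

(** Converse of [trace_bounds]: the point is pulled back through the inverse branches, beginning
    with the last letter of [w]. *)
Lemma preimage_word w x : Xab alpha beta x ->
  dst false w < x < 1 - dst true w ->
  exists2 u, Xab alpha beta u & It alpha beta u = catw w (It alpha beta x).
Proof.
have b0 : 0 < beta by lrab.
elim/last_ind: w x => [|w j IH] x Xx; first by exists x => //; rewrite catw_nil.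
rewrite !dst_rcons => /andP[]; rewrite gt_max => /andP[x0 hl].
rewrite ltrBrDr -ltrBrDl gt_max => /andP[x1 hr].
have off01 : off true j = beta - 1 - off false j by rewrite /off; ring.
have offE : off false j = j%:R - 1 - alpha by [].
pose x' := (x + off false j) / beta.
have xE : beta * x' = x + off false j by rewrite /x' mulrC divfK // gt_eqF.
have h1 : dst false w < x' by rewrite /x' ltr_pdivlMr // mulrC; lra.
have h2 : x' < 1 - dst true w.
  rewrite /x' ltr_pdivrMr // mulrBl mul1r [_ * beta]mulrC; lra.
have x'0 : 0 < x' by apply: le_lt_trans h1; exact: dst_ge0.
have x'1 : x' < 1 by have := dst_ge0 alpha beta true w; lra.
have bx0 : 0 < beta * x' by rewrite mulr_gt0.
have bx1 : beta * x' < beta by rewrite gtr_pMr.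
have hj : (1 <= j <= K)%N.
  have /andP[k1 k2] := nsymb_bounds; have [a0 a1] := andP halpha.
  apply/andP; split.
    by rewrite -(ltr_nat R); lra.
  by rewrite -ltnS -(ltr_nat R) -natr1; lra.
have hI : I j x' by apply/(IabE _ hj); split=> //; lra.
have Tx : T x' = x by rewrite (TabE hj hI) xE; ring.
have Xx' : Xab alpha beta x'.
  split; first by rewrite (ltW x'0).
  case=> [|n]; first by exists j.
  by rewrite iterSr Tx; exact: (proj2 Xx).
have It' : It alpha beta x' = catw [:: j] (It alpha beta x).
  apply/funext => -[|n]; first exact: It_eq.
  rewrite /catw /= subn1 /=.
  have [g1 g2] := It_spec n Xx.
  by apply: It_eq => //; rewrite iterSr Tx.
have [u Xu hu] := IH x' Xx' (introT andP (conj h1 h2)).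
by exists u => //; rewrite hu It' -catw_cat cats1.
Qed.

(** The image of a full word is all of (0,1), so [w] may precede any itinerary; closure points are
    reached through their finite prefixes. *)
Lemma full_Sigma w y : full w -> Sg y -> Sg (catw w y).
Proof.
move=> fw /closure_agree h; apply/closure_agree => n.
have [_ [x Xx <-] hx] := h n.
have [h1 h2] := It_spec 0 Xx; have /(IabE _ h1)[g1 g2 _ _] := h2.
have [|u Xu hu] := preimage_word (w := w) Xx.
  by rewrite !fw subr0 g1.
exists (It alpha beta u); first by exists u.
move=> i hi; rewrite hu /catw; case: ltnP => // hs; apply: hx; lia.
Qed.

Lemma Sigma_closed : closed Sg.
Proof. exact: closed_closure. Qed.

Lemma Sigma_compact : compact Sg.
Proof.
have sub : Sg `<=` [set x : oneseq | forall i, (x i <= K)%N].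
  by move=> y Sy i /=; have /andP[] := Sigma_letter i Sy.
exact: (subclosed_compact Sigma_closed (@compact_letters_le K) sub).
Qed.

End Symbolic.

(** * Cylinders generate the Borel sets *)

Section Cylinders.

Definition cyl (i : nat) (v : seq nat) : set borel_oneseq :=
  [set x | forall t, (t < size v)%N -> x (i + t)%N = nth 0%N v t].

Lemma cyl_nil i : cyl i [::] = setT.
Proof. by apply/seteqP; split => // x _ t. Qed.

Lemma open_cyl i v : open (cyl i v : set oneseq).
Proof.
rewrite openE => x hx; apply: filterS (agree_nbhs (i + size v) x) => y hy t ht.
by rewrite hy ?hx // ltn_add2l.
Qed.

Lemma measurable_open (O : set oneseq) : open O -> measurable (O : set borel_oneseq).
Proof. by move=> oO; apply: sub_sigma_algebra. Qed.

Lemma measurable_closed (O : set oneseq) : closed O -> measurable (O : set borel_oneseq).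
Proof.
move=> cO; rewrite -(setCK O); apply: measurableC; apply: measurable_open.
exact: closed_openC.
Qed.

Lemma measurable_cyl i v : measurable (cyl i v).
Proof. by apply: measurable_open; exact: open_cyl. Qed.

Lemma cyl_cat i u v : cyl i (u ++ v) = cyl i u `&` cyl (i + size u) v.
Proof.
apply/seteqP; split=> [x h|x [h1 h2] t].
  split=> t ht; first by rewrite h ?nth_cat ?size_cat ?ht // ltn_addr.
  rewrite -addnA h ?size_cat ?ltn_add2l // nth_cat ltnNge leq_addr /=.
  by rewrite addKn.
rewrite size_cat nth_cat => ht; case: (ltnP t (size u)) => hs; first exact: (h1 t hs).
by rewrite -[in LHS](subnKC hs) addnA h2 // ltn_subLR.
Qed.

Lemma iter_shiftE m (x : oneseq) n : iter m seq_shift x n = x (m + n)%N.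
Proof. by elim: m n => [//|m IH] n; rewrite iterS /seq_shift IH addnS addSn. Qed.

Lemma cyl_shift i v m : (iter m seq_shift) @^-1` (cyl i v) = cyl (m + i) v.
Proof.
by apply/seteqP; split=> x h t ht; move: (h t ht); rewrite iter_shiftE addnA.
Qed.

Lemma cyl_agree x v : cyl 0 v x -> cyl 0 v = agree (size v) x.
Proof.
move=> hx; apply/seteqP; split=> y hy t ht; first by rewrite (hy t ht) (hx t ht).
by rewrite add0n hy //; exact: hx.
Qed.

Lemma cyl_mkseq (x : oneseq) n : cyl 0 (mkseq x n) x.
Proof. by move=> t; rewrite size_mkseq => ht; rewrite nth_mkseq. Qed.

Lemma cylP x v : cyl 0 v x <-> mkseq x (size v) = v.
Proof.
split=> [h|<-]; last exact: cyl_mkseq.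
apply: (@eq_from_nth _ 0%N); rewrite size_mkseq // => i hi.
by rewrite nth_mkseq // -(h i hi).
Qed.

(** The empty set is included to make the family stable under intersection. *)
Definition cyls : set (set oneseq) := [set A | A = set0 \/ exists v, A = cyl 0 v].

Lemma cyls_setI : setI_closed cyls.
Proof.
move=> A B [->|[u ->]]; first by left; rewrite set0I.
move=> [->|[v ->]]; first by left; rewrite setI0.
have [-> |/set0P[x [hu hv]]] := eqVneq (cyl 0 u `&` cyl 0 v) set0; first by left.
right; have [le|le] := leqP (size u) (size v).
  exists v; rewrite (cyl_agree hu) (cyl_agree hv); apply/seteqP; split=> [y [] //|y hy].
  by split=> // i hi; apply: hy; apply: leq_trans le.
exists u; rewrite (cyl_agree hu) (cyl_agree hv); apply/seteqP; split=> [y [] //|y hy].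
by split=> // i hi; apply: hy; apply: ltn_trans le.
Qed.

(** An open set is a union of cylinders, and there are only countably many of them. *)
Lemma measurable_gen_cyls : @measurable _ borel_oneseq = <<s cyls >>.
Proof.
apply/seteqP; split; apply: smallest_sub; try exact: smallest_sigma_algebra.
  move=> O oO.
  have -> : O = \bigcup_(v in [set: seq nat])
     (if `[< cyl 0 v `<=` O >] then cyl 0 v else set0).
    apply/seteqP; split=> [x Ox|x [v _]]; last by case: asboolP => // h /h.
    have [n hn] := nbhs_agree (open_nbhs_nbhs (conj oO Ox)).
    exists (mkseq x n) => //; case: asboolP; first by move=> _; exact: cyl_mkseq.
    move=> []; rewrite (cyl_agree (@cyl_mkseq x n)) size_mkseq; exact: hn.
  apply: (@countable_bigcupT_measurable _ (g_sigma_algebraType cyls)).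
    exact: countableP.
  by move=> v; apply: sub_sigma_algebra; case: asboolP => _; [right; exists v|left].
move=> _ [->|[v ->]]; [exact: measurable0|exact: measurable_cyl].
Qed.

Lemma measurable_fun_cyl d (T : measurableType d) (f : T -> borel_oneseq) :
  (forall v, measurable (f @^-1` cyl 0 v)) -> measurable_fun setT f.
Proof.
move=> h; apply: (@measurability _ _ T borel_oneseq setT f cyls measurable_gen_cyls) => _ [_ [->|[v ->]] <-].
  by rewrite preimage_set0 setI0.
by rewrite setTI; exact: h.
Qed.

Lemma measurable_continuous (f : borel_oneseq -> borel_oneseq) :
  continuous (f : oneseq -> oneseq) -> measurable_fun setT f.
Proof.
move=> cf; apply: measurable_fun_cyl => v; apply: measurable_open.
by apply: (proj1 (continuousP (f : oneseq -> oneseq))) => //; exact: open_cyl.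
Qed.

Lemma measurable_iter_shift m : measurable_fun setT (iter m seq_shift : borel_oneseq -> borel_oneseq).
Proof.
by apply: measurable_fun_cyl => v; rewrite cyl_shift; exact: measurable_cyl.
Qed.

Lemma measurable_shift : measurable_fun setT (seq_shift : borel_oneseq -> borel_oneseq).
Proof. exact: (measurable_iter_shift 1). Qed.

Lemma cyl_unique (R : realType) (m1 m2 : {measure set borel_oneseq -> \bar R}) :
  (m1 setT < +oo)%E -> (forall v, m1 (cyl 0 v) = m2 (cyl 0 v)) ->
  forall A, measurable A -> m1 A = m2 A.
Proof.
move=> f1 h A mA.
apply: (@measure_unique _ R borel_oneseq cyls (fun _ => setT) measurable_gen_cyls cyls_setI) => //.
- by move=> _; right; exists [::]; rewrite cyl_nil.
- by rewrite bigcup_const //; exists 0%N.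
- by move=> _ [->|[v ->]]; rewrite ?measure0.
Qed.

End Cylinders.

(** * Probabilities from measures of mass one, and partitions by a letter *)

Section Promote.
Context d (T : measurableType d) (R : realType) (m : {measure set T -> \bar R}).

(* The phantom argument carries the proof from which the probability instance is
   inferred. *)
Definition promote (_ : m setT = 1%E) : set T -> \bar R := m.

HB.instance Definition _ (m1 : m setT = 1%E) := Measure.copy (promote m1) m.

HB.instance Definition _ (m1 : m setT = 1%E) :=
  Measure_isProbability.Build _ _ _ (promote m1) m1.

Lemma prob_of_measure : m setT = 1%E ->
  exists P : probability T R, forall A, P A = m A.
Proof. by move=> m1; exists (promote m1). Qed.

End Promote.

Section ProbabilityTools.
Context {R : realType}.
Local Open Scope ereal_scope.

Lemma measure_letters (m : {measure set borel_oneseq -> \bar R}) (k i : nat) A :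
  measurable A -> m [set x | (k <= x i)%N] = 0 ->
  m A = \sum_(a < k) m (A `&` [set x : borel_oneseq | x i = a :> nat]).
Proof.
move=> mA m0.
have mc (a : nat) : measurable ([set x | x i = a :> nat] : set borel_oneseq).
  have -> : [set x : borel_oneseq | x i = a :> nat] = cyl i [:: a].
    apply/seteqP; split=> [x /= h [|//] _|x /(_ 0%N isT)]; first by rewrite addn0.
    by rewrite addn0.
  exact: measurable_cyl.
have ml (j : nat) : measurable ([set x | (x i < j)%N] : set borel_oneseq).
  elim: j => [|j IH]; first by have -> : [set x : borel_oneseq | (x i < 0)%N] = set0 by apply/seteqP; split.
  have -> : [set x : borel_oneseq | (x i < j.+1)%N] = [set x | (x i < j)%N] `|` [set x | x i = j].
    apply/seteqP; split=> x /=; first by rewrite ltnS leq_eqVlt => /orP[/eqP ->|]; [right|left].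
    by case=> [h|->//]; exact: ltn_trans h _.
  exact: measurableU.
have step (j : nat) : m (A `&` [set x | (x i < j)%N]) = \sum_(a < j) m (A `&` [set x : borel_oneseq | x i = a :> nat]).
  elim: j => [|j IH].
    rewrite big_ord0; have -> : A `&` [set x | (x i < 0)%N] = set0 by apply/seteqP; split => x // [].
    exact: measure0.
  rewrite big_ord_recr /= -IH -measureU; [|exact: measurableI|exact: measurableI|].
    congr (m _); apply/seteqP; split=> x /=.
      by move=> [Ax]; rewrite ltnS leq_eqVlt => /orP[/eqP ->|]; [right|left].
    by case=> -[Ax h]; split => //; [exact: ltn_trans h _|rewrite h].
  by apply/seteqP; split => // x [[_ /= h1] [_ /= h2]]; rewrite h2 ltnn in h1.
rewrite -step -[in LHS](setIT A).
have -> : [set: borel_oneseq] = [set x | (x i < k)%N] `|` [set x | (k <= x i)%N].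
  by apply/seteqP; split => // x _ /=; case: ltnP => h; [left|right].
have mk : measurable ([set x | (k <= x i)%N] : set borel_oneseq).
  have -> : [set x : borel_oneseq | (k <= x i)%N] = ~` [set x | (x i < k)%N].
    by apply/funext => x; apply/propext; rewrite /= leqNgt; split=> /negP.
  exact: measurableC.
rewrite setIUr measureU; [|exact: measurableI|exact: measurableI|].
  rewrite -[RHS]adde0; congr (_ + _).
  apply/eqP; rewrite eq_le measure_ge0 andbT -m0; apply: le_measure; rewrite ?inE //.
  exact: measurableI.
by apply/seteqP; split => // x [[_ /= h1] [_ /= h2]]; rewrite ltnNge h2 in h1.
Qed.

End ProbabilityTools.

(** * Measures on sequences with prescribed cylinder weights *)

Section Kolmogorov.
Context {R : realType}.
Variables (k : nat) (p : seq nat -> R).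
Hypothesis k0 : (0 < k)%N.
Hypothesis p0 : forall v, 0 <= p v.
Hypothesis p1 : p [::] = 1.
Hypothesis pS : forall v, p v = \sum_(a < k) p (rcons v (a : nat)).

(* Kolmogorov extension: [expansion] maps x in [0,1[ to the address of x in the
   nested partitions of [0,1[ into intervals of lengths [p v]; the wanted measure
   is the image of Lebesgue measure. *)
Definition below (v : seq nat) (a : nat) : R := \sum_(b < a) p (rcons v (b : nat)).

Definition lo (v : seq nat) : R := \sum_(i < size v) below (take i v) (nth 0%N v i).

(** The cap [k.-1] keeps the digit below [k] at points beyond the interval of [v]. *)
Definition digit v (x : R) : nat :=
  minn (find (fun a => x < lo v + below v a.+1) (iota 0 k)) k.-1.

Fixpoint digits n x : seq nat :=
  if n is n'.+1 then rcons (digits n' x) (digit (digits n' x) x) else [::].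

Definition expansion (x : R) : borel_oneseq := fun n => digit (digits n x) x.

Lemma lo_rcons v a : lo (rcons v a) = lo v + below v a.
Proof.
rewrite /lo size_rcons big_ord_recr /= nth_rcons ltnn eqxx -cats1 take_size_cat //.
congr (_ + _); apply: eq_bigr => i _; rewrite takel_cat; last exact: ltnW.
by rewrite nth_cat ltn_ord.
Qed.

Lemma le_below v a b : (a <= b)%N -> below v a <= below v b.
Proof.
move=> /subnKC <-; elim: (b - a)%N => [|n IH]; first by rewrite addn0.
by rewrite addnS; apply: (le_trans IH); rewrite /below big_ord_recr /= lerDl.
Qed.

Lemma digit_lt v x : (digit v x < k)%N.
Proof. by rewrite /digit (leq_ltn_trans (geq_minr _ _)) // prednK. Qed.

Lemma digit_le v x a : (a < k.-1)%N -> (digit v x <= a)%N = (x < lo v + below v a.+1).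
Proof.
move=> ak; rewrite /digit geq_min [(k.-1 <= a)%N]leqNgt ak orbF.
have ak' : (a < k)%N by apply: leq_trans ak (leq_pred _).
set P := fun _ => _; apply/idP/idP => h.
  have hf : has P (iota 0 k) by rewrite has_find size_iota (leq_ltn_trans h).
  have := nth_find 0%N hf; rewrite nth_iota; last by rewrite (leq_ltn_trans h).
  rewrite add0n {1}/P => /lt_le_trans; apply; rewrite lerD2l.
  exact: le_below.
rewrite leqNgt; apply/negP => /(before_find 0%N).
by rewrite nth_iota // add0n /P h.
Qed.

Lemma digits_mkseq n x : mkseq (expansion x) n = digits n x.
Proof. by elim: n => [//|n IH]; rewrite mkseqS IH. Qed.

Lemma measurable_digit v a : measurable ([set x | digit v x = a] : set (measurableTypeR R)).
Proof.
have mle b : measurable ([set x | (digit v x <= b)%N] : set (measurableTypeR R)).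
  have [h|h] := ltnP b k.-1; last first.
    have -> : [set x | (digit v x <= b)%N] = setT.
      apply/seteqP; split => // x _ /=; apply: leq_trans h.
      by rewrite -ltnS prednK // digit_lt.
    exact: measurableT.
  have -> : [set x | (digit v x <= b)%N] = [set` `]-oo, lo v + below v b.+1[ ].
    by apply/seteqP; split => x /=; rewrite in_itv /= digit_le.
  exact: measurable_itv.
case: a => [|a].
  have -> : [set x | digit v x = 0%N] = [set x | (digit v x <= 0)%N].
    by apply/seteqP; split => x /=; rewrite leqn0 => /eqP.
  exact: mle.
have -> : [set x | digit v x = a.+1] = [set x | (digit v x <= a.+1)%N] `\` [set x | (digit v x <= a)%N].
  apply/seteqP; split => x /=; first by move=> ->; rewrite ltnn.
  by rewrite leq_eqVlt => -[/orP[/eqP|]] //.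
exact: measurableD.
Qed.

Lemma measurable_digits v :
  measurable ([set x | digits (size v) x = v] : set (measurableTypeR R)).
Proof.
elim/last_ind: v => [|v a IH].
  have -> : [set x | digits 0 x = [::]] = setT by apply/seteqP; split.
  exact: measurableT.
have -> : [set x | digits (size (rcons v a)) x = rcons v a] =
    [set x | digits (size v) x = v] `&` [set x | digit v x = a].
  apply/seteqP; split => x /=; rewrite size_rcons /=.
    by move=> /rcons_inj[-> ->].
  by move=> [-> ->].
by apply: measurableI => //; exact: measurable_digit.
Qed.

Lemma expansion_cyl v : expansion @^-1` cyl 0 v = [set x | digits (size v) x = v].
Proof.
by apply/seteqP; split=> x /=; rewrite -digits_mkseq; [move/cylP|move=> h; apply/cylP].
Qed.

Lemma measurable_expansion :
  @measurable_fun _ _ (measurableTypeR R) borel_oneseq setT expansion.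
Proof.
by apply: measurable_fun_cyl => v; rewrite expansion_cyl; exact: measurable_digits.
Qed.

Lemma below_top v : below v k = p v.
Proof. by rewrite [RHS]pS. Qed.

(** By consistency of [p], the intervals of the extensions of [v] tile the interval of [v], and
    [digit] picks the tile containing [x]. *)
Lemma digits_itv v : all (fun a => (a < k)%N) v ->
  [set x | digits (size v) x = v] `&` [set` `[0, 1[] = [set` `[lo v, lo v + p v[].
Proof.
elim/last_ind: v => [_|v a IH].
  rewrite /lo big_ord0 p1 add0r.
  by apply/seteqP; split => x //= [].
rewrite all_rcons => /andP[ak /IH {}IH].
have -> : [set x | digits (size (rcons v a)) x = rcons v a] `&` [set` `[0, 1[] =
    [set` `[lo v, lo v + p v[] `&` [set x | digit v x = a].
  rewrite -IH; apply/seteqP; split => x /=; rewrite size_rcons /=.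
    by move=> [/rcons_inj[-> ->]].
  by move=> [[-> ?] ->].
have bS : below v a.+1 = below v a + p (rcons v a) by rewrite /below big_ord_recr.
rewrite lo_rcons -addrA -bS -below_top.
have b0 : below v 0 = 0 by rewrite /below big_ord0.
have dE x : lo v <= x < lo v + below v k ->
    (digit v x == a) = (lo v + below v a <= x < lo v + below v a.+1).
  move=> /andP[x0 x1].
  have h1 : (digit v x <= a)%N = (x < lo v + below v a.+1).
    have [h|h] := ltnP a k.-1; first exact: digit_le.
    have -> : a.+1 = k by apply/eqP; rewrite eqn_leq ak /= -(prednK k0) ltnS.
    by rewrite x1; apply: leq_trans h; rewrite -ltnS prednK // digit_lt.
  have h2 : (a <= digit v x)%N = (lo v + below v a <= x).
    case: a ak {bS h1} => [|a] ak; first by rewrite b0 addr0 x0.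
    rewrite ltnNge digit_le ?leNgt //.
    by rewrite -ltnS prednK.
  by rewrite eqn_leq h1 h2 andbC.
apply/seteqP; split => x /=; rewrite !in_itv /=.
  by move=> [h /eqP]; rewrite dE.
move=> h; have h' : lo v <= x < lo v + below v k.
  move: h => /andP[h1 h2]; rewrite (le_trans _ h1) ?(lt_le_trans h2) ?lerD2l ?le_below //.
  by rewrite lerDl -b0 le_below.
by split => //; apply/eqP; rewrite dE.
Qed.

Lemma kolmogorov : exists nu : probability borel_oneseq R,
  (forall v, all (fun a => (a < k)%N) v -> nu (cyl 0 v) = (p v)%:E) /\
  (forall i, nu [set x | (k <= x i)%N] = 0%E).
Proof.
have mI : measurable ([set` `[0%R, 1%R[ ] : set (measurableTypeR R)) by exact: measurable_itv.
pose m : {measure set (measurableTypeR R) -> \bar R} := mrestr (@lebesgue_measure R) mI.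
pose X : {mfun measurableTypeR R >-> borel_oneseq} :=
  HB.pack expansion (@isMeasurableFun.Build _ _ (measurableTypeR R) borel_oneseq expansion measurable_expansion).
have mE A : m A = lebesgue_measure (A `&` [set` `[0%R, 1%R[ ]) by [].
have m1 : m setT = 1%E.
  rewrite mE setTI lebesgue_measure_itv /= lte_fin ltr01.
  by rewrite sube0.
have [P hP] := prob_of_measure m1.
exists (distribution P X); split=> [v hv|i].
  transitivity (P (expansion @^-1` cyl 0 v)); first by [].
  rewrite hP mE expansion_cyl digits_itv //.
  rewrite lebesgue_measure_itv /= lte_fin ltrDl.
  have := p0 v; rewrite le_eqVlt => /orP[/eqP <-|pv]; first by rewrite ltxx.
  by rewrite pv -EFinB addrC addKr.
transitivity (P (expansion @^-1` [set x | (k <= x i)%N])); first by [].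
suff -> : expansion @^-1` [set x | (k <= x i)%N] = set0 by rewrite measure0.
by apply/seteqP; split => // x /=; rewrite leqNgt digit_lt.
Qed.

End Kolmogorov.

(** * Words over a finite alphabet and partitions into their cylinders *)

Section FiniteWords.

Fixpoint kwords (k m : nat) : seq (seq nat) :=
  if m is m'.+1 then [seq a :: w | a <- index_iota 0 k, w <- kwords k m']
  else [:: [::]].

Lemma big_kwordsS (T : Type) (idx : T) (op : Monoid.com_law idx) k m (f : seq nat -> T) :
  \big[op/idx]_(w <- kwords k m.+1) f w =
  \big[op/idx]_(a < k) \big[op/idx]_(w <- kwords k m) f ((a : nat) :: w).
Proof. by rewrite [kwords k m.+1]/= big_allpairs_dep big_mkord. Qed.

Lemma mem_kwords k m w :
  (w \in kwords k m) = (size w == m) && all (fun a => (a < k)%N) w.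
Proof.
elim: m w => [|m IH] w; first by rewrite inE; case: w.
apply/allpairsP/idP => [[[a v] /= [ha]]|].
  by rewrite IH => /andP[/eqP sv hv] -> /=; rewrite sv eqxx hv andbT; move: ha; rewrite mem_index_iota.
case: w => [//|a v] /= /andP[sv /andP[ha hv]]; exists (a, v); split => //=.
  by rewrite mem_index_iota.
by rewrite IH hv andbT.
Qed.

Lemma kwords_uniq k m : uniq (kwords k m).
Proof.
elim: m => [//|m IH]; apply: allpairs_uniq => //; first exact: iota_uniq.
by move=> [a v] [b w] _ _ /= [-> ->].
Qed.

Lemma big_kwordsD (T : Type) (idx : T) (op : Monoid.com_law idx) k m n (f : seq nat -> T) :
  \big[op/idx]_(w <- kwords k (m + n)) f w =
  \big[op/idx]_(u <- kwords k m) \big[op/idx]_(v <- kwords k n) f (u ++ v).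
Proof.
elim: m f => [|m IH] f; first by rewrite big_seq1.
rewrite addSn !big_kwordsS; apply: eq_bigr => a _; exact: IH.
Qed.

End FiniteWords.

Section MeasureWords.
Context {R : realType}.
Local Open Scope ereal_scope.

Definition pushm d d' (T1 : measurableType d) (T2 : measurableType d')
    (m : {measure set T1 -> \bar R}) (f : T1 -> T2) (mf : measurable_fun setT f) :
    {measure set T2 -> \bar R} :=
  measure_function_pushforward__canonical__measure_function_Measure m mf.

Lemma pushmE d d' (T1 : measurableType d) (T2 : measurableType d')
    (m : {measure set T1 -> \bar R}) (f : T1 -> T2) (mf : measurable_fun setT f) A :
  pushm m mf A = m (f @^-1` A).
Proof. by []. Qed.

Lemma cyl1E i a : cyl i [:: a] = [set x : borel_oneseq | x i = a :> nat].
Proof.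
apply/seteqP; split=> [x /(_ 0%N isT)|x /= h [|//] _]; first by rewrite addn0.
by rewrite addn0.
Qed.

Lemma measure_words (m : {measure set borel_oneseq -> \bar R}) (k r i : nat) A :
  measurable A -> (forall j, m [set x | (k <= x j)%N] = 0) ->
  m A = \sum_(w <- kwords k r) m (A `&` cyl i w).
Proof.
move=> mA m0; elim: r i A mA => [|r IH] i A mA; first by rewrite big_seq1 cyl_nil setIT.
rewrite big_kwordsS (measure_letters mA (m0 i)); apply: eq_bigr => a _.
rewrite (IH i.+1); last first.
  by apply: measurableI => //; rewrite -cyl1E; exact: measurable_cyl.
apply: eq_bigr => w _; congr (m _).
by rewrite -cat1s cyl_cat cyl1E addn1 setIA.
Qed.

End MeasureWords.

(** * Bernoulli measures *)

Section Bernoulli.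
Context {R : realType}.
Variables (k : nat) (q : nat -> R).
Hypothesis q0 : forall a, 0 <= q a.
Hypothesis qk : forall a, (k <= a)%N -> q a = 0.
Hypothesis q1 : \sum_(a < k) q a = 1.

Definition bern (v : seq nat) : R := \prod_(a <- v) q a.

Lemma bern_cat u v : bern (u ++ v) = bern u * bern v.
Proof. by rewrite /bern big_cat. Qed.

Lemma bern_ge0 v : 0 <= bern v.
Proof. by apply: prodr_ge0 => a _; exact: q0. Qed.

Lemma bern_out v : ~~ all (fun a => (a < k)%N) v -> bern v = 0.
Proof.
elim: v => [//|a v IH] /=; rewrite /bern big_cons -/(bern v) negb_and -leqNgt.
by case/orP => [/qk -> | /IH ->]; rewrite ?mul0r ?mulr0.
Qed.

Lemma cyl_out (nu : {measure set borel_oneseq -> \bar R}) i v :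
  (forall j, nu [set x | (k <= x j)%N] = 0%E) ->
  ~~ all (fun a => (a < k)%N) v -> nu (cyl i v) = 0%E.
Proof.
move=> n0 /allPn[a av]; rewrite -leqNgt => ka.
have [j jlt ja] : exists2 j, (j < size v)%N & nth 0%N v j = a.
  by exists (index a v); [rewrite index_mem|exact: nth_index].
have mc (c : nat) : measurable ([set x | (k <= x c)%N] : set borel_oneseq).
  apply: measurable_open; rewrite openE => x /= hx.
  by apply: filterS (agree_nbhs c.+1 x) => y hy /=; rewrite hy.
apply/eqP; rewrite eq_le measure_ge0 andbT -(n0 (i + j)%N).
apply: le_measure; rewrite ?inE //; first exact: measurable_cyl.
by move=> x hx /=; rewrite (hx j jlt) ja.
Qed.

Lemma bernoulli : exists nu : probability borel_oneseq R,
  (forall v, nu (cyl 0 v) = (bern v)%:E) /\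
  (forall j, nu [set x | (k <= x j)%N] = 0%E).
Proof.
have k0 : (0 < k)%N.
  case: k q1 => [|//]; rewrite big_ord0 => /eqP.
  by rewrite eq_sym oner_eq0.
have [||nu [h1 h2]] := kolmogorov k0 bern_ge0.
- by rewrite /bern big_nil.
- move=> v; rewrite -[LHS]mulr1 -q1 mulr_sumr; apply: eq_bigr => a _.
  by rewrite -cats1 bern_cat /bern big_seq1.
exists nu; split=> // v.
have [hv|hv] := boolP (all (fun a => (a < k)%N) v); first exact: h1.
by rewrite bern_out // cyl_out.
Qed.

Variable nu : probability borel_oneseq R.
Hypothesis nuE : forall v, nu (cyl 0 v) = (bern v)%:E.
Hypothesis nu0 : forall j, nu [set x | (k <= x j)%N] = 0%E.

Local Open Scope ereal_scope.

Lemma nu_fin A : measurable A -> nu A \is a fin_num.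
Proof. exact: fin_num_measure. Qed.

(** Both sides are finite measures in [B], and they agree on cylinders because [bern] is
    multiplicative. *)
Lemma bern_indep u (B : set borel_oneseq) : measurable B ->
  nu (cyl 0 u `&` (iter (size u) seq_shift @^-1` B)) = nu (cyl 0 u) * nu B.
Proof.
move=> mB; have mi := @measurable_iter_shift (size u).
pose m1 := pushm (mrestr nu (@measurable_cyl 0 u)) mi.
have m1E A : m1 A = nu (iter (size u) seq_shift @^-1` A `&` cyl 0 u) by [].
pose m2 : {measure set borel_oneseq -> \bar R} := mscale (NngNum (bern_ge0 u)) nu.
have m2E A : m2 A = (bern u)%:E * nu A by [].
have e A : measurable A -> m1 A = m2 A.
  apply: cyl_unique => [|v].
    have -> : m1 setT = nu (cyl 0 u).
      by rewrite m1E; congr (nu _); apply/seteqP; split => x // [].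
    by rewrite nuE ltry.
  rewrite m1E cyl_shift addn0 setIC -(cyl_cat 0 u v) nuE.
  by rewrite m2E nuE bern_cat EFinM.
rewrite setIC -m1E (e B mB).
by rewrite m2E nuE.
Qed.

Lemma bern_shift (B : set borel_oneseq) : measurable B -> nu (seq_shift @^-1` B) = nu B.
Proof.
move=> mB.
have e A : measurable A -> pushm nu measurable_shift A = nu A.
  apply: cyl_unique => [|v].
    have -> : pushm nu measurable_shift setT = 1 := probability_setT nu.
    exact: ltry.
  rewrite pushmE (cyl_shift 0 v 1) addn0.
  rewrite (measure_letters (@measurable_cyl 1 v) (nu0 0)).
  rewrite (eq_bigr (fun a : 'I_k => (q a * bern v)%:E)); last first.
    move=> a _; transitivity (nu (cyl 0 ((a : nat) :: v))).
      by rewrite -cat1s cyl_cat cyl1E setIC.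
    by rewrite nuE /bern big_cons.
  by rewrite sumEFin -mulr_suml q1 mul1r; symmetry; exact: nuE.
exact: e.
Qed.

(** Being its own preimage under every power of the shift, [B] is independent of all cylinders,
    hence of itself: nu(B) = nu(B)^2. *)
Lemma bern_ergodic (B : set borel_oneseq) : measurable B -> seq_shift @^-1` B = B -> nu B = 0 \/ nu B = 1.
Proof.
move=> mB invB.
have inv r : iter r seq_shift @^-1` B = B.
  elim: r => [//|r IH].
  have -> : iter r.+1 seq_shift @^-1` B = seq_shift @^-1` (iter r seq_shift @^-1` B).
    by apply/seteqP; split => x /=; rewrite -iterS iterSr.
  by rewrite IH invB.
have fB := nu_fin mB; have B0 : (0 <= fine (nu B))%R by apply: fine_ge0.
pose m2 : {measure set borel_oneseq -> \bar R} := mscale (NngNum B0) nu.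
pose m1 : {measure set borel_oneseq -> \bar R} := mrestr nu mB.
have m1E A : m1 A = nu (A `&` B) by [].
have m2E A : m2 A = (fine (nu B))%:E * nu A by [].
have e A : measurable A -> m1 A = m2 A.
  apply: cyl_unique => [|v]; first by rewrite m1E setTI ltey_eq fB.
  by rewrite m1E -{1}(inv (size v)) bern_indep // m2E fineK // muleC.
have := e B mB; rewrite m1E m2E setIid.
rewrite -(fineK fB); set b := fine (nu B); rewrite -EFinM => -[] /eqP.
rewrite -subr_eq0 -[X in (X - _)%R]mulr1 -mulrBr mulf_eq0 subr_eq0 => /orP[/eqP ->|/eqP <-].
  by left.
by right.
Qed.

(** Up to a null set, an event determined by the first [r] letters is a finite union of cylinders of
    length [r]. *)
Lemma bern_block r (E B : set borel_oneseq) : measurable E -> measurable B ->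
  (forall x y, agree r x y -> E x -> E y) ->
  nu (E `&` (iter r seq_shift @^-1` B)) = nu E * nu B.
Proof.
move=> mE mB hE.
have mi : measurable (iter r seq_shift @^-1` B : set borel_oneseq).
  by rewrite -[X in measurable X]setTI; apply: measurable_iter_shift.
rewrite (measure_words r 0 (measurableI _ _ mE mi) nu0) (measure_words r 0 mE nu0).
rewrite ge0_sume_distrl; last by move=> w _; exact: measure_ge0.
rewrite big_seq [RHS]big_seq; apply: eq_bigr => w; rewrite mem_kwords => /andP[/eqP sw _].
have [h|h] := pselect (E `&` cyl 0 w !=set0); last first.
  have e0 : E `&` cyl 0 w = set0 by apply/seteqP; split => // x hx; apply: h; exists x.
  by rewrite e0 setIAC e0 set0I !measure0 mul0e.
have [x [Ex wx]] := h.
have sub : cyl 0 w `<=` E.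
  move=> y hy; apply: (hE x) => //.
  by rewrite -sw -(cyl_agree wx).
have e1 : E `&` cyl 0 w = cyl 0 w by rewrite setIidr.
rewrite setIAC e1 -sw; exact: bern_indep.
Qed.

End Bernoulli.

(** * Random concatenations of blocks *)

Section BlockProcess.
Context {R : realType}.
Variables (k : nat) (q : nat -> R).
Hypothesis q0 : forall a, 0 <= q a.
Hypothesis qk : forall a, (k <= a)%N -> q a = 0.
Hypothesis q1 : \sum_(a < k) q a = 1.
Variable nu : probability borel_oneseq R.
Hypothesis nuE : forall v, nu (cyl 0 v) = (bern q v)%:E.
Hypothesis nu0 : forall j, nu [set x | (k <= x j)%N] = 0%E.
Variables (L : nat) (blk : nat -> seq nat).
Hypothesis L0 : (0 < L)%N.

(** The concatenation of the blocks named by the letters of [x], read from position [i] on. *)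
Definition blockmap (i : nat) (x : borel_oneseq) : borel_oneseq :=
  fun m => nth 0%N (blk (x ((m + i) %/ L)%N)) ((m + i) %% L).

Lemma blockmap_shift i x : seq_shift (blockmap i x) = blockmap i.+1 x.
Proof. by apply/funext => m; rewrite /seq_shift /blockmap addSnnS. Qed.

Lemma blockmap_L i x : blockmap (L + i) x = blockmap i (seq_shift x).
Proof.
apply/funext => m; rewrite /blockmap /seq_shift addnCA divnDl // divnn L0 add1n.
by rewrite modnDl.
Qed.

Lemma blockmap_preL i (A : set borel_oneseq) :
  blockmap (L + i) @^-1` A = seq_shift @^-1` (blockmap i @^-1` A).
Proof. by apply/seteqP; split => x /=; rewrite blockmap_L. Qed.

Lemma blockmap_preS i (A : set borel_oneseq) :
  blockmap i @^-1` (seq_shift @^-1` A) = blockmap i.+1 @^-1` A.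
Proof. by apply/seteqP; split => x /=; rewrite blockmap_shift. Qed.

Lemma continuous_blockmap i : continuous (blockmap i : oneseq -> oneseq).
Proof.
apply: continuous_agree => n; exists (n + i)%N => x y h j hj.
by rewrite /blockmap h // (leq_ltn_trans (leq_div _ _)) // ltn_add2r.
Qed.

Lemma measurable_blockmap i : measurable_fun setT (blockmap i).
Proof. by apply: measurable_continuous; exact: continuous_blockmap. Qed.

Lemma measurable_pre i (A : set borel_oneseq) :
  measurable A -> measurable (blockmap i @^-1` A : set borel_oneseq).
Proof.
by move=> mA; rewrite -[X in measurable X]setTI; apply: measurable_blockmap.
Qed.

Lemma blockmap_cyl i j v : blockmap i @^-1` cyl j v = blockmap 0 @^-1` cyl (i + j) v.
Proof.
apply/seteqP; split => x h t ht; move: (h t ht); rewrite /blockmap addn0.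
  by rewrite [(j + t + i)%N]addnC !addnA.
by rewrite [(j + t + i)%N]addnC !addnA.
Qed.

Local Open Scope ereal_scope.

(** The concatenation at a fixed offset has a law with period [L]; the mean over the offsets is what
    the shift preserves. *)
Lemma block_measure : exists rho : probability borel_oneseq R,
  forall A, rho A = (L%:R^-1)%:E * \sum_(i < L) nu (blockmap i @^-1` A).
Proof.
have l0 : (0 <= L%:R^-1 :> R)%R by rewrite invr_ge0.
pose m : {measure set borel_oneseq -> \bar R} :=
  mscale (NngNum l0) (msum (fun i => pushm nu (measurable_blockmap i)) L).
have mE A : m A = (L%:R^-1)%:E * \sum_(i < L) nu (blockmap i @^-1` A) by [].
have m1 : m setT = 1.
  rewrite mE (eq_bigr (fun=> 1%:E)) => [|i _]; last exact: (probability_setT nu).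
  rewrite sumEFin big_const_ord iter_addr_0 -EFinM mulVf //.
  by rewrite pnatr_eq0 -lt0n.
have [P hP] := prob_of_measure m1.
by exists P => A; rewrite hP mE.
Qed.

Variable rho : probability borel_oneseq R.
Hypothesis rhoE : forall A, rho A = (L%:R^-1)%:E * \sum_(i < L) nu (blockmap i @^-1` A).

Lemma sum_cyclic (g : nat -> \bar R) n : g n = g 0%N ->
  \sum_(i < n) g i.+1 = \sum_(i < n) g i.
Proof.
case: n => [|n] h; first by rewrite !big_ord0.
by rewrite big_ord_recr [RHS]big_ord_recl /= h addeC.
Qed.

(** The shift turns offset [i] into [i.+1], and offset [L] is offset 0 after a shift of the sequence
    of block names, which preserves [nu]. *)
Lemma rho_invariant : shift_invariant rho.
Proof.
move=> A mA; rewrite !rhoE; congr (_ * _).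
under eq_bigr do rewrite blockmap_preS.
apply: (@sum_cyclic (fun i => nu (blockmap i @^-1` A))).
have := blockmap_preL 0 A; rewrite addn0 => ->.
by apply: (bern_shift (k := k) (q := q)) => //; exact: measurable_pre.
Qed.

(** An invariant set has the same preimage at all offsets, and this preimage is invariant under the
    shift of the block names, for which [nu] is ergodic. *)
Lemma rho_ergodic : ergodic rho.
Proof.
split; first exact: rho_invariant.
move=> A mA invA.
have pre i : blockmap i @^-1` A = blockmap 0 @^-1` A.
  by elim: i => [//|i IH]; rewrite -blockmap_preS invA IH.
have inv : seq_shift @^-1` (blockmap 0 @^-1` A) = blockmap 0 @^-1` A.
  by rewrite -blockmap_preL addn0 pre.
have rE : rho A = nu (blockmap 0 @^-1` A).
  rewrite rhoE (eq_bigr (fun=> nu (blockmap 0 @^-1` A))); last by move=> i _; rewrite pre.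
  have mp := measurable_pre 0 mA.
  rewrite -(fineK (fin_num_measure nu _ mp)) sumEFin big_const_ord iter_addr_0 -EFinM.
  by rewrite -[X in (_ * X)%R]mulr_natl mulKf // pnatr_eq0 -lt0n.
rewrite rE; apply: (bern_ergodic q0 nuE) => //; exact: measurable_pre.
Qed.

Lemma rho_carried (C : set oneseq) : measurable (C : set borel_oneseq) ->
  (forall i x, (i < L)%N -> C (blockmap i x)) -> rho.-negligible (~` C).
Proof.
move=> mC hC; apply/negligibleP; first exact: measurableC.
etransitivity; first exact: rhoE.
rewrite big1 ?mule0 // => i _.
have -> : blockmap i @^-1` (~` C) = set0 by apply/seteqP; split => // x /(_ (hC i x (ltn_ord i))).
exact: measure0.
Qed.

End BlockProcess.

(** * Entropy of finite distributions and of their codes *)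

Section FiniteEntropy.
Context {R : realType}.

Definition ent (t : R) : R := - (t * ln t).

Lemma ent_ge0 t : 0 <= t <= 1 -> 0 <= ent t.
Proof.
by move=> /andP[t0 t1]; rewrite /ent -mulrN mulr_ge0 // oppr_ge0 ln_le0.
Qed.

(** This is ln x <= x - 1 at x = q / p; the corrections [q - p] have a nonpositive sum in
    [gibbs]. *)
Lemma ent_pointwise (p q : R) : 0 <= p -> 0 <= q -> (0 < p -> 0 < q) ->
  ent p <= - (p * ln q) + (q - p).
Proof.
rewrite le_eqVlt => /orP[/eqP <- q0 _|p0 q0 /(_ p0) q1].
  by rewrite /ent !mul0r; lra.
have : ln (q / p) <= q / p - 1.
  have := @le_ln1Dx R (q / p - 1); rewrite addrCA subrr addr0; apply.
  by rewrite ltrBrDl subrr divr_gt0.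
rewrite ln_div ?posrE // => h.
have : p * (ln q - ln p) <= p * (q / p - 1) by rewrite ler_wpM2l // ltW.
have -> : p * (q / p - 1) = q - p by field; rewrite gt_eqF.
by rewrite /ent mulrBr; lra.
Qed.

Lemma gibbs (T : eqType) (s : seq T) (p q : T -> R) :
  (forall x, x \in s -> 0 <= p x) -> (forall x, x \in s -> 0 <= q x) ->
  (forall x, x \in s -> 0 < p x -> 0 < q x) ->
  \sum_(x <- s) q x <= \sum_(x <- s) p x ->
  \sum_(x <- s) ent (p x) <= \sum_(x <- s) - (p x * ln (q x)).
Proof.
move=> p0 q0 pq le.
apply: (@le_trans _ _ (\sum_(x <- s) (- (p x * ln (q x)) + (q x - p x)))).
  by rewrite big_seq [leRHS]big_seq; apply: ler_sum => x xs; apply: ent_pointwise; auto.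
by rewrite big_split /= sumrB; lra.
Qed.

Section Coding.
Variables (I T : eqType) (s : seq I) (ts : seq T) (f : I -> T) (q : I -> R).
Hypothesis uts : uniq ts.
Hypothesis fts : forall i, i \in s -> f i \in ts.
Hypothesis q0 : forall i, 0 <= q i.

(** The image of the weights [q] under the code [f]. *)
Definition mass (t : T) : R := \sum_(i <- s | f i == t) q i.

Lemma mass_ge0 t : 0 <= mass t.
Proof. by apply: sumr_ge0. Qed.

Lemma le_mass i : i \in s -> q i <= mass (f i).
Proof.
by move=> si; rewrite /mass (big_rem i) //= eqxx lerDl; apply: sumr_ge0.
Qed.

Lemma sum_mass (g : T -> R) :
  \sum_(t <- ts) mass t * g t = \sum_(i <- s) q i * g (f i).
Proof.
under eq_bigr do rewrite /mass mulr_suml big_mkcond.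
rewrite exchange_big /= [LHS]big_seq [RHS]big_seq; apply: eq_bigr => i si.
rewrite -big_mkcond /= (eq_bigr (fun=> q i * g (f i))); last by move=> t /eqP <-.
by rewrite (big_rem (f i)) ?fts //= eqxx big1_seq ?addr0 // => t /andP[/eqP <-]; rewrite mem_rem_uniqF.
Qed.

Lemma entropy_code_le : \sum_(t <- ts) ent (mass t) <= \sum_(i <- s) ent (q i).
Proof.
have := sum_mass (fun t => - ln (mass t)).
rewrite (eq_bigr (fun t => ent (mass t))); last by move=> t _; rewrite mulrN.
move=> ->; rewrite big_seq [leRHS]big_seq; apply: ler_sum => i si.
rewrite /ent mulrN lerN2; have := q0 i; rewrite le_eqVlt => /orP[/eqP <-|qi].
  by rewrite !mul0r.
have h := le_mass si; rewrite ler_pM2l // ler_ln // posrE; exact: lt_le_trans h.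
Qed.

(** Gibbs' inequality against the weights [mass (f i) / F]. As at most [F] indices of positive
    weight share a code, these weights have at most the total mass of [q]; the sums are first
    restricted to such indices. *)
Lemma entropy_code_ge (F : nat) : (0 < F)%N ->
  (forall t, (count (fun i => (f i == t) && (0 < q i)%R) s <= F)%N) ->
  \sum_(i <- s) ent (q i) <= \sum_(t <- ts) ent (mass t) + (\sum_(i <- s) q i) * ln F%:R.
Proof.
move=> F0 hF; have F0' : 0 < F%:R :> R by rewrite ltr0n.
have filt (g : I -> R) : (forall i, q i = 0 -> g i = 0) ->
    \sum_(i <- s) g i = \sum_(i <- [seq i <- s | 0 < q i]) g i.
  move=> hg; rewrite big_filter [RHS]big_mkcond /=; apply: eq_bigr => i _.
  by case: ltP => // h; apply: hg; apply/eqP; rewrite eq_le h q0.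
set s' := [seq i <- s | 0 < q i].
have s's i : i \in s' -> i \in s /\ 0 < q i by rewrite mem_filter => /andP[].
have e1 : \sum_(t <- ts) ent (mass t) = \sum_(i <- s') - (q i * ln (mass (f i))).
  transitivity (\sum_(i <- s) - (q i * ln (mass (f i)))).
    have := sum_mass (fun t => - ln (mass t)).
    rewrite (eq_bigr (fun t => ent (mass t))); last by move=> t _; rewrite mulrN.
    by move=> ->; apply: eq_bigr => i _; rewrite mulrN.
  by apply: filt => i ->; rewrite mul0r oppr0.
have e2 : \sum_(i <- s) ent (q i) = \sum_(i <- s') ent (q i).
  by apply: filt => i qi; rewrite /ent qi mul0r oppr0.
have e3 : \sum_(i <- s) q i = \sum_(i <- s') q i by exact: filt.
rewrite e1 e2 e3 mulr_suml -big_split /=.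
have mpos i : i \in s' -> 0 < mass (f i).
  by move=> /s's[si qi]; exact: lt_le_trans (le_mass si).
apply: le_trans (gibbs (q := fun i => mass (f i) / F%:R) _ _ _ _) _.
- by move=> i /s's[_ /ltW].
- by move=> i /mpos h; rewrite divr_ge0 // ltW.
- by move=> i /mpos h _; rewrite divr_gt0.
- rewrite -mulr_suml ler_pdivrMr //.
  have -> : \sum_(i <- s') mass (f i) = \sum_(t <- ts) mass t * (count (fun i => (f i == t) && (0 < q i)%R) s)%:R.
    transitivity (\sum_(t <- ts) \sum_(i <- s' | f i == t) mass t).
      under [RHS]eq_bigr do rewrite big_mkcond /=.
      rewrite exchange_big /= [LHS]big_seq [RHS]big_seq; apply: eq_bigr => i /s's[si _].
      rewrite -big_mkcond /= (big_rem (f i)) ?fts //= eqxx big1_seq ?addr0 //.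
      by move=> t /andP[/eqP <-]; rewrite mem_rem_uniqF.
    apply: eq_bigr => t _; rewrite big_const_seq iter_addr_0 /s' count_filter mulr_natr.
    by congr (_ *+ _); apply: eq_count => i.
  apply: (@le_trans _ _ (\sum_(t <- ts) mass t * F%:R)).
    apply: ler_sum => t _; rewrite ler_wpM2l ?mass_ge0 // ler_nat; exact: hF.
  rewrite -mulr_suml ler_pM2r // -e3.
  have -> : \sum_(t <- ts) mass t = \sum_(t <- ts) mass t * 1 by apply: eq_bigr => t _; rewrite mulr1.
  by rewrite sum_mass; apply: ler_sum => i _; rewrite mulr1.
- rewrite [leLHS]big_seq [leRHS]big_seq; apply: ler_sum => i si'.
  rewrite ln_div ?posrE //; last exact: mpos.
  by rewrite mulrBr opprB addrC.
Qed.

End Coding.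

(** The limit is the infimum of the quotients: [n] is divided by a nearly optimal [N], and [B]
    absorbs all possible remainders. *)
Lemma fekete (a : nat -> R) : (forall n, 0 <= a n) ->
  (forall m n, a (m + n)%N <= a m + a n) ->
  exists h, (fun n => n%:R^-1 * a n) @ \oo --> h /\
    forall n, (0 < n)%N -> h <= n%:R^-1 * a n.
Proof.
move=> a0 asub.
pose E := [set n%:R^-1 * a n | n in [set n | (0 < n)%N]].
have E0 : E !=set0 by exists (1%:R^-1 * a 1%N); exists 1%N.
have El : has_lbound E.
  by exists 0 => _ [n /= _ <-]; rewrite mulr_ge0 // invr_ge0.
have hE n : (0 < n)%N -> inf E <= n%:R^-1 * a n.
  by move=> n0; apply: ge_inf => //; exists n.
exists (inf E); split => //.
apply/cvgrPdist_lt => e e0.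
have [_ [N /= N0 <-] hN] : exists2 x, E x & x < inf E + e / 2.
  by apply: inf_adherent; rewrite ?divr_gt0.
have N0' : 0 < N%:R :> R by rewrite ltr0n.
pose B := \sum_(r < N) a r.
have B0 : 0 <= B by apply: sumr_ge0.
have hB r : (r < N)%N -> a r <= B.
  move=> hr; rewrite /B (bigD1 (Ordinal hr)) //= lerDl.
  by apply: sumr_ge0.
have hq qq r : (r < N)%N -> a (qq * N + r)%N <= qq%:R * a N + B.
  move=> hr; elim: qq => [|qq IH]; first by rewrite mul0n mul0r !add0r hB.
  rewrite mulSn -addnA; apply: le_trans (asub _ _) _.
  by rewrite -natr1 mulrDl mul1r; lra.
near=> n.
have n0 : (0 < n)%N by near: n; exists 1%N.
have n0' : 0 < n%:R :> R by rewrite ltr0n.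
have up : n%:R^-1 * a n < inf E + e.
  have h1 := hq (n %/ N)%N (n %% N)%N (ltn_pmod n N0).
  rewrite -divn_eq in h1.
  have h2 : (n %/ N)%:R * a N <= n%:R * (N%:R^-1 * a N).
    rewrite mulrA ler_wpM2r // -ler_pdivrMr ?invr_gt0 // invrK -natrM ler_nat.
    exact: leq_trunc_div.
  have h3 : B < n%:R * (e / 2).
    rewrite -ltr_pdivrMr ?divr_gt0 //; near: n; exact: nbhs_infty_gtr.
  rewrite ltr_pdivrMl //.
  have : n%:R * (N%:R^-1 * a N) < n%:R * (inf E + e / 2) by rewrite ltr_pM2l.
  by rewrite !mulrDr; lra.
rewrite distrC ger0_norm; first by lra.
by rewrite subr_ge0 hE.
Unshelve. all: by end_near.
Qed.

End FiniteEntropy.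

(** * Block entropies at arbitrary positions *)

Section Marginals.
Context {R : realType}.
Variables (k : nat) (la : probability borel_oneseq R).
Hypothesis la0 : forall j, la [set x | (k <= x j)%N] = 0%E.

Definition marg (i : nat) (v : seq nat) : R := fine (la (cyl i v)).

Lemma la_margE i v : la (cyl i v) = (marg i v)%:E.
Proof. by rewrite /marg fineK // fin_num_measure //; exact: measurable_cyl. Qed.

Lemma marg_ge0 i v : 0 <= marg i v.
Proof. by apply: fine_ge0; exact: measure_ge0. Qed.

Lemma marg_nil i : marg i [::] = 1.
Proof. by rewrite /marg cyl_nil probability_setT. Qed.

Lemma marg_le1 i v : marg i v <= 1.
Proof.
by rewrite -lee_fin -la_margE; apply: probability_le1; exact: measurable_cyl.
Qed.

Lemma marg_sumr i u n : \sum_(v <- kwords k n) marg i (u ++ v) = marg i u.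
Proof.
apply: EFin_inj; rewrite -la_margE -sumEFin.
rewrite (measure_words n (i + size u) (@measurable_cyl i u) la0).
by apply: eq_bigr => v _; rewrite -la_margE cyl_cat.
Qed.

Lemma marg_suml i v m : \sum_(u <- kwords k m) marg i (u ++ v) = marg (i + m) v.
Proof.
apply: EFin_inj; rewrite -la_margE -sumEFin.
rewrite (measure_words m i (@measurable_cyl (i + m) v) la0).
rewrite big_seq [RHS]big_seq; apply: eq_bigr => u; rewrite mem_kwords => /andP[/eqP su _].
by rewrite -la_margE cyl_cat su setIC.
Qed.

Lemma marg_sum i n : \sum_(v <- kwords k n) marg i v = 1.
Proof. by rewrite -(marg_nil i) -(marg_sumr i [::] n). Qed.

Lemma marg_catl i u v : marg i (u ++ v) <= marg i u.
Proof.
rewrite -lee_fin -!la_margE cyl_cat; apply: le_measure; rewrite ?inE //.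
- by apply: measurableI; exact: measurable_cyl.
- exact: measurable_cyl.
Qed.

Lemma marg_catr i u v : marg i (u ++ v) <= marg (i + size u) v.
Proof.
rewrite -lee_fin -!la_margE cyl_cat; apply: le_measure; rewrite ?inE //.
- by apply: measurableI; exact: measurable_cyl.
- exact: measurable_cyl.
Qed.

(** The starting position is kept because these bounds are also applied to the law of concatenated
    blocks at offset 0, which is only periodic. *)
Definition bent i n : R := \sum_(w <- kwords k n) ent (marg i w).

Lemma bent_ge0 i n : 0 <= bent i n.
Proof.
by apply: sumr_ge0 => w _; apply: ent_ge0; rewrite marg_ge0 marg_le1.
Qed.

Lemma bent_cat i m n : bent i (m + n) =
  \sum_(u <- kwords k m) \sum_(v <- kwords k n) ent (marg i (u ++ v)).
Proof. exact: big_kwordsD. Qed.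

Lemma bent_left i m n (g : seq nat -> R) :
  \sum_(u <- kwords k m) \sum_(v <- kwords k n) marg i (u ++ v) * g u =
  \sum_(u <- kwords k m) marg i u * g u.
Proof. by apply: eq_bigr => u _; rewrite -mulr_suml marg_sumr. Qed.

Lemma bent_right i m n (g : seq nat -> R) :
  \sum_(u <- kwords k m) \sum_(v <- kwords k n) marg i (u ++ v) * g v =
  \sum_(v <- kwords k n) marg (i + m) v * g v.
Proof. by rewrite exchange_big; apply: eq_bigr => v _; rewrite -mulr_suml marg_suml. Qed.

(** Gibbs' inequality, comparing the joint law of the two blocks with the product of their laws. *)
Lemma bent_add i m n : bent i (m + n) <= bent i m + bent (i + m) n.
Proof.
pose s := [seq (u, v) | u <- kwords k m, v <- kwords k n].
pose p := fun uv : seq nat * seq nat => marg i (uv.1 ++ uv.2).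
pose q := fun uv : seq nat * seq nat => marg i uv.1 * marg (i + m) uv.2.
have sz_s uv : uv \in s -> size uv.1 = m.
  by move=> /allpairsP[[u v] /= [hu _ ->]]; move: hu; rewrite mem_kwords => /andP[/eqP].
have sE (f : seq nat * seq nat -> R) : \sum_(x <- s) f x =
    \sum_(u <- kwords k m) \sum_(v <- kwords k n) f (u, v).
  by rewrite /s big_allpairs_dep.
have le : \sum_(x <- s) ent (p x) <= \sum_(x <- s) - (p x * ln (q x)).
  apply: gibbs.
  - by move=> x _; exact: marg_ge0.
  - by move=> x _; rewrite mulr_ge0 ?marg_ge0.
  - move=> x /sz_s sx px; rewrite mulr_gt0 //.
      exact: lt_le_trans px (marg_catl _ _ _).
    by rewrite -sx; exact: lt_le_trans px (marg_catr _ _ _).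
  - rewrite !sE /p /q /=; under eq_bigr do rewrite -mulr_sumr marg_sum mulr1.
    by under [leRHS]eq_bigr do rewrite marg_sumr.
rewrite bent_cat -(sE (fun x => ent (p x))); apply: (le_trans le).
rewrite sE /p /q /=.
have -> : bent i m = \sum_(u <- kwords k m) \sum_(v <- kwords k n) marg i (u ++ v) * - ln (marg i u).
  by rewrite bent_left; apply: eq_bigr => u _; rewrite mulrN.
have -> : bent (i + m) n = \sum_(u <- kwords k m) \sum_(v <- kwords k n) marg i (u ++ v) * - ln (marg (i + m) v).
  by rewrite bent_right; apply: eq_bigr => u _; rewrite mulrN.
rewrite -big_split /= big_seq [leRHS]big_seq; apply: ler_sum => u hu.
rewrite -big_split /=; apply: ler_sum => v _.
have := marg_ge0 i (u ++ v); rewrite le_eqVlt => /orP[/eqP <-|pos].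
  by rewrite !mul0r oppr0 addr0.
have hu' : size u = m by move: hu; rewrite mem_kwords => /andP[/eqP].
rewrite lnM ?posrE.
- by rewrite -mulrDr -opprD mulrN.
- exact: lt_le_trans pos (marg_catl _ _ _).
- by rewrite -hu'; exact: lt_le_trans pos (marg_catr _ _ _).
Qed.

Lemma ent_le_split (p P : R) : 0 <= p -> p <= P -> p * - ln P <= ent p.
Proof.
rewrite le_eqVlt => /orP[/eqP <- _|p0 pP]; first by rewrite /ent !mul0r oppr0.
by rewrite /ent mulrN lerN2 ler_pM2l // ler_ln // posrE; exact: lt_le_trans pP.
Qed.

Lemma bent_monor i m n : bent i m <= bent i (m + n).
Proof.
have -> : bent i m = \sum_(u <- kwords k m) \sum_(v <- kwords k n) marg i (u ++ v) * - ln (marg i u).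
  by rewrite bent_left; apply: eq_bigr => u _; rewrite mulrN.
rewrite bent_cat; apply: ler_sum => u _; apply: ler_sum => v _.
by apply: ent_le_split; rewrite ?marg_ge0 ?marg_catl.
Qed.

Lemma bent_monol i m n : bent (i + m) n <= bent i (m + n).
Proof.
have -> : bent (i + m) n = \sum_(u <- kwords k m) \sum_(v <- kwords k n) marg i (u ++ v) * - ln (marg (i + m) v).
  by rewrite bent_right; apply: eq_bigr => u _; rewrite mulrN.
rewrite bent_cat big_seq [leRHS]big_seq; apply: ler_sum => u.
rewrite mem_kwords => /andP[/eqP <- _]; apply: ler_sum => v _.
by apply: ent_le_split; rewrite ?marg_ge0 ?marg_catr.
Qed.

Lemma bent_indep i m n :
  (forall u v, u \in kwords k m -> v \in kwords k n ->
     marg i (u ++ v) = marg i u * marg (i + m) v) ->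
  bent i (m + n) = bent i m + bent (i + m) n.
Proof.
move=> h; apply/eqP; rewrite eq_le bent_add /=.
have -> : bent i m = \sum_(u <- kwords k m) \sum_(v <- kwords k n) marg i (u ++ v) * - ln (marg i u).
  by rewrite bent_left; apply: eq_bigr => u _; rewrite mulrN.
have -> : bent (i + m) n = \sum_(u <- kwords k m) \sum_(v <- kwords k n) marg i (u ++ v) * - ln (marg (i + m) v).
  by rewrite bent_right; apply: eq_bigr => u _; rewrite mulrN.
rewrite bent_cat -big_split /= big_seq [leRHS]big_seq; apply: ler_sum => u hu.
rewrite -big_split /= big_seq [leRHS]big_seq; apply: ler_sum => v hv.
have := marg_ge0 i (u ++ v); rewrite le_eqVlt => /orP[/eqP <-|pos].
  by rewrite /ent !mul0r oppr0 addr0.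
rewrite /ent (h u v hu hv) lnM ?posrE.
- by rewrite -mulrDr -opprD mulrN.
- exact: lt_le_trans pos (marg_catl _ _ _).
- have hu' : size u = m by move: hu; rewrite mem_kwords => /andP[/eqP].
  by rewrite -hu'; exact: lt_le_trans pos (marg_catr _ _ _).
Qed.

Hypothesis la_inv : shift_invariant la.

Lemma marg_stationary i v : marg i v = marg 0 v.
Proof.
elim: i => [//|i IH]; rewrite -IH /marg -(la_inv (@measurable_cyl i v)).
by rewrite (cyl_shift i v 1) add1n.
Qed.

Lemma bent_stationary i n : bent i n = bent 0 n.
Proof. by apply: eq_bigr => w _; rewrite marg_stationary. Qed.

Lemma bent_cvg : exists h, (fun n => n%:R^-1 * bent 0 n) @ \oo --> h /\
    forall n, (0 < n)%N -> h <= n%:R^-1 * bent 0 n.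
Proof.
apply: fekete => [n|m n]; first exact: bent_ge0.
by have := bent_add 0 m n; rewrite bent_stationary.
Qed.

End Marginals.

(** * The entropy of a measure carried by a subshift *)

Section BlockEntropy.
Context {R : realType}.
Variables (k : nat) (S : set oneseq) (mu : probability borel_oneseq R).
Hypothesis Sk : forall x, S x -> forall i, (x i < k)%N.
Hypothesis mS : measurable (S : set borel_oneseq).
Hypothesis muS : carried mu S.

Lemma carriedI (A : set borel_oneseq) : measurable A -> mu (S `&` A) = mu A.
Proof.
move=> mA; have mCS : measurable (~` S : set borel_oneseq) by exact: measurableC.
have z : mu (A `\` S) = 0%E.
  apply/eqP; rewrite eq_le measure_ge0 andbT.
  have <- : mu (~` S : set borel_oneseq) = 0%E by apply/(negligibleP mu).
  by apply: le_measure; rewrite ?inE //; exact: measurableD.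
rewrite setIC; apply/esym; etransitivity; first exact: (measureDI mu mA mS).
transitivity (0 + mu (A `&` S))%E; last by rewrite add0e.
by congr (_ + _)%E.
Qed.

Lemma carried_bounded j : mu [set x | (k <= x j)%N] = 0%E.
Proof.
have mc : measurable ([set x | (k <= x j)%N] : set borel_oneseq).
  apply: measurable_open; rewrite openE => x /= hx.
  by apply: filterS (agree_nbhs j.+1 x) => y hy /=; rewrite hy.
rewrite -carriedI //.
have -> : S `&` [set x : borel_oneseq | (k <= x j)%N] = set0; last exact: measure0.
by apply/seteqP; split => // x [/Sk /(_ j)] /=; rewrite ltnNge => /negbTE ->.
Qed.

(** Words without a point in [S] have measure zero and contribute 0, so the sum extends to all words
    over the alphabet. *)
Lemma block_entropyE n : block_entropy S mu n = bent k mu 0 n.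
Proof.
pose tup (w : seq nat) : n.-tuple nat := [tuple nth 0%N w i | i < n].
have tupE w : size w = n -> tval (tup w) = w.
  move=> sw; apply: (@eq_from_nth _ 0%N) => [|i]; first by rewrite size_tuple.
  by rewrite size_tuple => hi; rewrite (nth_mktuple (fun i : 'I_n => nth 0%N w i) 0%N (Ordinal hi)).
have cE (w : n.-tuple nat) : cylinder S w = S `&` cyl 0 w.
  apply/seteqP; split => [x [Sx h]|x [Sx h]]; split => //.
    by move=> i; rewrite size_tuple => hi /=; rewrite (h (Ordinal hi)) (tnth_nth 0%N).
  by move=> i; rewrite (tnth_nth 0%N) -h ?size_tuple.
rewrite /block_entropy.
transitivity (\sum_(w \in [set w : n.-tuple nat | cylinder S w !=set0]) ent (marg mu 0 w)).
  apply: eq_fsbigr => w _; rewrite cE.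
  by have -> : mu (S `&` cyl 0 w) = mu (cyl 0 w) by apply: carriedI; exact: measurable_cyl.
pose s := [seq tup w | w <- kwords k n].
rewrite (@fsbig_widen _ _ _ _ _ [set` s]).
- rewrite -fsbig_seq; last first.
    rewrite map_inj_in_uniq ?kwords_uniq // => u v.
    rewrite !mem_kwords => /andP[/eqP su _] /andP[/eqP sv _] /(congr1 (@tval _ _)).
    by rewrite !tupE.
  rewrite big_map big_seq [RHS]big_seq; apply: eq_bigr => w.
  by rewrite mem_kwords => /andP[/eqP sw _]; rewrite tupE.
- move=> w [x]; rewrite cE => -[Sx /cylP hx] /=; apply/mapP; exists (tval w).
    rewrite mem_kwords size_tuple eqxx /= -hx; apply/allP => a /mapP[i _ ->]; exact: Sk.
  by apply: val_inj; rewrite /= tupE // size_tuple.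
- move=> w [_ h]; rewrite /=.
  have -> : marg mu 0 w = 0; last by rewrite /ent mul0r oppr0.
  rewrite /marg -carriedI ?cE; last exact: measurable_cyl.
  have -> : S `&` cyl 0 w = set0; last by rewrite measure0.
  by rewrite -cE; apply/seteqP; split => // x hx; apply: h; exists x.
Qed.

Lemma entropy_spec : shift_invariant mu ->
  (fun n => n%:R^-1 * bent k mu 0 n) @ \oo --> entropy S mu /\
  forall n, (0 < n)%N -> n%:R * entropy S mu <= bent k mu 0 n.
Proof.
move=> inv; have [h [hc hl]] := bent_cvg carried_bounded inv.
have -> : entropy S mu = h.
  rewrite /entropy; under eq_fun do rewrite block_entropyE.
  exact: cvg_lim.
by split=> // n n0; rewrite -ler_pdivlMl ?ltr0n // hl.
Qed.

End BlockEntropy.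

(** * Cylinder probabilities as mean numbers of occurrences *)

Section SliceCount.
Context {R : realType}.
Variables (k : nat) (la : probability borel_oneseq R).
Hypothesis la0 : forall j, la [set x | (k <= x j)%N] = 0%E.

Lemma marg_words m i (v : seq nat) : (i + size v <= m)%N ->
  marg la i v = \sum_(w <- kwords k m) marg la 0 w * (prefix v (drop i w))%:R.
Proof.
move=> him; apply: EFin_inj; rewrite -la_margE -sumEFin.
rewrite (measure_words m 0 (@measurable_cyl i v) la0).
rewrite big_seq [RHS]big_seq; apply: eq_bigr => w; rewrite mem_kwords => /andP[/eqP sw _].
have hE x : cyl 0 w x -> cyl i v x <-> prefix v (drop i w).
  move=> hx; rewrite prefixE; split => [h|/eqP h].
    have sd : size (take (size v) (drop i w)) = size v.
      by rewrite size_takel // size_drop sw; move: him; clear; lia.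
    apply/eqP; apply: (@eq_from_nth _ 0%N); rewrite sd // => j hj'.
    rewrite nth_take // nth_drop -h // -(hx (i + j)%N) ?sw //.
    by move: hj' him; clear; lia.
  move=> j hj; rewrite -h nth_take // nth_drop -(hx (i + j)%N) //.
  by rewrite sw; move: hj him; clear; lia.
case: (boolP (prefix v (drop i w))) => [hp|hp].
  rewrite mulr1 -la_margE; congr (la _); apply/seteqP; split => [x []//|x hx].
  by split => //; apply/hE.
rewrite mulr0.
have -> : cyl i v `&` cyl 0 w = set0; last exact: measure0.
by apply/seteqP; split => // x [h1 h2]; move: hp; rewrite ((hE x h2).1 h1).
Qed.

Lemma cnt_slices v w : cnt v w = (\sum_(i < size w) prefix v (drop i w))%N.
Proof.
elim: w => [|x w IH]; first by rewrite big_ord0.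
by rewrite cnt_cons IH big_ord_recl drop0.
Qed.

Lemma sum_tail m c : (\sum_(i < m) (c <= i) <= m - c)%N.
Proof.
elim: m => [|m IH]; first by rewrite big_ord0.
rewrite big_ord_recr /=; move: IH; set s := (\sum_(_ < m) _)%N; clearbody s.
by case: (leqP c m); clear; lia.
Qed.

(** The mean number of occurrences among the first [m] letters accounts for the positions where [v]
    fits; fewer than [size v] positions near the end remain, or none if [v] is empty. *)
Lemma sum_marg m (v : seq nat) :
  `|\sum_(i < m) marg la i v - \sum_(w <- kwords k m) marg la 0 w * (cnt v w)%:R|
    <= (size v)%:R.
Proof.
pose g i := \sum_(w <- kwords k m) marg la 0 w * (prefix v (drop i w))%:R.
have -> : \sum_(w <- kwords k m) marg la 0 w * (cnt v w)%:R = \sum_(i < m) g i.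
  rewrite exchange_big /= big_seq [RHS]big_seq; apply: eq_bigr => w.
  rewrite mem_kwords => /andP[/eqP sw _].
  by rewrite cnt_slices sw natr_sum mulr_sumr.
have g01 i : 0 <= g i <= 1.
  rewrite sumr_ge0 /=; last by move=> w _; rewrite mulr_ge0 ?marg_ge0.
  rewrite -(marg_sum la0 0 m); apply: ler_sum => w _.
  by rewrite ler_piMr ?marg_ge0 // lern1; case: (prefix _ _).
rewrite -sumrB; apply: le_trans (ler_norm_sum _ _ _) _.
apply: (@le_trans _ _ (\sum_(i < m) (m.+1 - size v <= i)%:R)).
  apply: ler_sum => i _; have [h|h] := leqP (i + size v) m.
    by rewrite (marg_words h) subrr normr0.
  have -> : (m.+1 - size v <= i)%N by move: h; clear; lia.
  have := g01 i; have := marg_ge0 la i v; have := marg_le1 la i v.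
  by rewrite mulr1n ler_norml => h1 h2 /andP[h3 h4]; apply/andP; split; lra.
rewrite -natr_sum ler_nat; apply: leq_trans (sum_tail _ _) _.
by clear; lia.
Qed.

End SliceCount.

(** * Entropy of the random concatenation *)

Section BlockCode.
Context {R : realType}.
Variables (kq k L : nat) (q : nat -> R) (blk : nat -> seq nat).
Hypothesis q0 : forall a, 0 <= q a.
Hypothesis qk : forall a, (kq <= a)%N -> q a = 0.
Hypothesis q1 : \sum_(a < kq) q a = 1.
Variable nu : probability borel_oneseq R.
Hypothesis nuE : forall v, nu (cyl 0 v) = (bern q v)%:E.
Hypothesis nu0 : forall j, nu [set x | (kq <= x j)%N] = 0%E.
Hypothesis L0 : (0 < L)%N.
Hypothesis blkL : forall j, size (blk j) = L.
Hypothesis blkk : forall j, all (fun a => (a < k)%N) (blk j).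

Local Notation bm := (blockmap L blk).

Lemma block_law : exists la : probability borel_oneseq R,
  forall A, la A = nu (bm 0 @^-1` A).
Proof.
have e : pushm nu (measurable_blockmap L blk 0) setT = 1%E := probability_setT nu.
by have [P hP] := prob_of_measure e; exists P.
Qed.

Variable la : probability borel_oneseq R.
Hypothesis laE : forall A, la A = nu (bm 0 @^-1` A).

Lemma blockmap_lt i x m : (bm i x m < k)%N.
Proof.
rewrite /blockmap; apply: (allP (blkk _)); apply: mem_nth.
by rewrite blkL ltn_mod.
Qed.

Lemma block_bounded j : la [set x | (k <= x j)%N] = 0%E.
Proof.
rewrite laE; have -> : bm 0 @^-1` [set x | (k <= x j)%N] = set0; last exact: measure0.
by apply/seteqP; split => // x /=; rewrite leqNgt blockmap_lt.
Qed.

Lemma marg_period i v : marg la (L + i) v = marg la i v.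
Proof.
rewrite /marg; congr fine.
have e j : la (cyl j v) = nu (bm j @^-1` cyl 0 v).
  by rewrite laE [in RHS]blockmap_cyl addn0.
rewrite !e blockmap_preL //; apply: (bern_shift q1 nuE nu0).
by apply: measurable_pre; exact: measurable_cyl.
Qed.

Lemma marg_mul r i v : marg la (r * L + i) v = marg la i v.
Proof. by elim: r => [//|r IH]; rewrite mulSn -addnA marg_period. Qed.

Lemma bent_mul r i n : bent k la (r * L + i) n = bent k la i n.
Proof. by apply: eq_bigr => w _; rewrite marg_mul. Qed.

Lemma iter_shift_blockmap r x : bm 0 (iter r seq_shift x) = iter (r * L) seq_shift (bm 0 x).
Proof.
apply/funext => m; rewrite iter_shiftE /blockmap !iter_shiftE !addn0.
by rewrite divnMDl // modnMDl.
Qed.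

Lemma marg_indep r u v : size u = (r * L)%N ->
  marg la 0 (u ++ v) = marg la 0 u * marg la (r * L) v.
Proof.
move=> su; apply: EFin_inj; rewrite EFinM -!la_margE cyl_cat !laE add0n.
have pre (A : set borel_oneseq) : measurable A -> measurable (bm 0 @^-1` A : set borel_oneseq).
  exact: measurable_pre.
have -> : bm 0 @^-1` (cyl 0 u `&` cyl (size u) v) =
    (bm 0 @^-1` cyl 0 u) `&` (iter r seq_shift @^-1` (bm 0 @^-1` cyl 0 v)).
  have e : cyl (size u) v = iter (size u) seq_shift @^-1` cyl 0 v by rewrite cyl_shift addn0.
  by apply/seteqP; split => x; rewrite e /= iter_shift_blockmap su.
have -> : nu (bm 0 @^-1` cyl (r * L) v) = nu (bm 0 @^-1` cyl 0 v).
  by rewrite -!laE !la_margE -[X in marg la X v]addn0 marg_mul.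
apply: (bern_block q0 nuE nu0); try by apply: pre; exact: measurable_cyl.
move=> x y h; rewrite /= => hx j hj; rewrite -hx //.
rewrite /blockmap !add0n addn0 h //.
by rewrite ltn_divLR // -su.
Qed.

Lemma bent_blocks r : bent k la 0 (r * L) = r%:R * bent k la 0 L.
Proof.
elim: r => [|r IH].
  rewrite mul0n mul0r /bent big_seq1 marg_nil /ent ln1; lra.
rewrite mulSn addnC (bent_indep block_bounded) => [|u v]; last first.
  by rewrite mem_kwords => /andP[/eqP su _] _; rewrite add0n; exact: marg_indep.
have -> : bent k la (0 + r * L) L = bent k la 0 L by rewrite add0n -[(r * L)%N]addn0 bent_mul.
by rewrite IH -natr1 mulrDl mul1r.
Qed.

(** The window lies inside [r + 1] whole blocks; conversely, together with the first [i < L] letters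
    it covers [r] whole blocks. *)
Lemma bent_offset i r : (i < L)%N ->
  (r%:R - 1) * bent k la 0 L <= bent k la i (r * L) <= (r%:R + 1) * bent k la 0 L.
Proof.
move=> iL; apply/andP; split.
  have h1 : bent k la 0 (r * L) <= bent k la 0 (i + r * L).
    by rewrite addnC; exact: bent_monor block_bounded _ _ _.
  have h2 := bent_add block_bounded 0 i (r * L).
  have h3 := bent_monor block_bounded 0 i (L - i).
  rewrite subnKC in h3; last exact: ltnW.
  rewrite bent_blocks in h1; rewrite add0n in h2; lra.
have h1 := bent_monol block_bounded 0 i (r * L).
have h2 := bent_monor block_bounded 0 (i + r * L) (L - i).
have e : (i + r * L + (L - i) = r.+1 * L)%N by rewrite mulSn; move: iL; clear; lia.
by move: h1 h2; rewrite e bent_blocks add0n -natr1; lra.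
Qed.

Lemma marg_block t : size t = L -> marg la 0 t = \sum_(a < kq | blk a == t) q a.
Proof.
move=> sL; apply: EFin_inj; rewrite -la_margE laE -sumEFin.
have pre : bm 0 @^-1` cyl 0 t = [set x | blk (x 0%N) = t].
  apply/seteqP; split => x.
    move=> /= hx; apply: (@eq_from_nth _ 0%N); rewrite blkL // => i hi.
    rewrite -(hx i) ?sL //.
    by rewrite /blockmap add0n addn0 divn_small // modn_small.
  move=> /= hx i; rewrite sL => hi.
  by rewrite /blockmap add0n addn0 divn_small // modn_small // hx.
have mt : measurable (bm 0 @^-1` cyl 0 t : set borel_oneseq).
  by apply: measurable_pre; exact: measurable_cyl.
rewrite (measure_letters mt (nu0 0)) [RHS]big_mkcond; apply: eq_bigr => a _.
have nuq : nu (cyl 0 [:: a : nat]) = (q a)%:E by rewrite nuE /bern big_seq1.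
case: eqP => h.
  rewrite -nuq cyl1E; congr (nu _); rewrite pre.
  by apply: setIidr => x /= ->.
have -> : bm 0 @^-1` cyl 0 t `&` [set x : borel_oneseq | x 0%N = a :> nat] = set0.
  by rewrite pre; apply/seteqP; split => // x [/= h1 h2]; apply: h; rewrite -h1 h2.
exact: measure0.
Qed.

Variable rho : probability borel_oneseq R.
Hypothesis rhoE : forall A, rho A = ((L%:R^-1)%:E * \sum_(i < L) nu (bm i @^-1` A))%E.

Lemma marg_rho v : marg rho 0 v = L%:R^-1 * \sum_(i < L) marg la i v.
Proof.
apply: EFin_inj; rewrite -la_margE rhoE EFinM -sumEFin; congr (_ * _)%E.
by apply: eq_bigr => i _; rewrite -la_margE laE [in LHS]blockmap_cyl addn0.
Qed.

Lemma rho_bounded j : rho [set x | (k <= x j)%N] = 0%E.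
Proof.
rewrite rhoE big1 ?mule0 // => i _.
have -> : bm i @^-1` [set x | (k <= x j)%N] = set0; last exact: measure0.
by apply/seteqP; split => // x /=; rewrite leqNgt blockmap_lt.
Qed.

Let LR : 0 < L%:R :> R. Proof. by rewrite ltr0n. Qed.

(** Concavity of entropy. *)
Lemma bent_rho_ge m : L%:R^-1 * (\sum_(i < L) bent k la i m) <= bent k rho 0 m.
Proof.
rewrite exchange_big /= mulr_sumr; apply: ler_sum => w _.
have p0 (i : 'I_L) : 0 <= marg la i w by exact: marg_ge0.
rewrite ler_pdivrMl //.
have h (i : 'I_L) : ent (marg la i w) <=
    - (marg la i w * ln (marg rho 0 w)) + (marg rho 0 w - marg la i w).
  apply: ent_pointwise => //; first exact: marg_ge0.
  move=> pi; rewrite marg_rho mulr_gt0 ?invr_gt0 // (bigD1 i) //=.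
  by rewrite ltr_pwDl // sumr_ge0.
apply: le_trans (ler_sum _ (fun i _ => h i)) _.
rewrite big_split /= sumrN -mulr_suml sumrB big_const_ord iter_addr_0.
have e : \sum_(i < L) marg la i w = L%:R * marg rho 0 w by rewrite marg_rho mulVKf ?gt_eqF.
by rewrite e /ent -[X in X - _]mulr_natl mulrN mulrA; lra.
Qed.

(** Each of the [L] laws is at most [L] times their mean, so passing from their logarithms to that
    of the mean costs at most [ln L]. *)
Lemma bent_rho_le m :
  bent k rho 0 m <= ln L%:R + L%:R^-1 * (\sum_(i < L) bent k la i m).
Proof.
have p0 w (i : 'I_L) : 0 <= marg la i w by exact: marg_ge0.
have one : \sum_(w <- kwords k m) marg rho 0 w = 1 := marg_sum rho_bounded 0 m.
have lnE : ln L%:R = \sum_(w <- kwords k m) marg rho 0 w * ln L%:R.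
  by rewrite -mulr_suml one mul1r.
rewrite lnE exchange_big /= mulr_sumr -big_split /=.
apply: ler_sum => w _.
have e : \sum_(i < L) marg la i w = L%:R * marg rho 0 w by rewrite marg_rho mulVKf ?gt_eqF.
have L1 := lt0r_neq0 LR.
rewrite -[leLHS](mulKf L1) -[X in X + _](mulKf L1) -mulrDr.
rewrite ler_pM2l ?invr_gt0 // mulrA -e mulr_suml -big_split /=.
rewrite /ent mulrN mulrA -e mulr_suml -sumrN; apply: ler_sum => i _.
have := p0 w i; rewrite le_eqVlt => /orP[/eqP <-|pi]; first by rewrite !mul0r; lra.
rewrite -mulrN -mulrN -mulrDr ler_pM2l //.
have h : marg la i w <= L%:R * marg rho 0 w.
  by rewrite -e (bigD1 i) //= lerDl sumr_ge0.
have rp : 0 < marg rho 0 w.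
  by rewrite -(pmulr_rgt0 _ LR); exact: lt_le_trans h.
have : ln (marg la i w) <= ln (L%:R * marg rho 0 w).
  by rewrite ler_ln // posrE mulr_gt0.
by rewrite lnM ?posrE //; lra.
Qed.

(** Over [r * L] letters the entropy of [rho] is [r] times that of one block, up to an error
    independent of [r]: one block for the offset and [ln L] for the averaging. *)
Lemma rho_entropy (h : R) : (fun n => n%:R^-1 * bent k rho 0 n) @ \oo --> h ->
  (forall n, (0 < n)%N -> n%:R * h <= bent k rho 0 n) ->
  L%:R * h = bent k la 0 L.
Proof.
move=> hc hl; set H := bent k la 0 L.
have H0 : 0 <= H by exact: bent_ge0.
have avg (c : R) : L%:R^-1 * (\sum_(i < L) c) = c.
  by rewrite big_const_ord iter_addr_0 -[X in _ * X]mulr_natl mulKf // gt_eqF.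
have lnL : 0 <= ln L%:R :> R by rewrite ln_ge0 // ler1n.
have up r : bent k rho 0 (r * L) <= ln L%:R + (r%:R + 1) * H.
  apply: le_trans (bent_rho_le _) _; rewrite lerD2l -[leRHS]avg ler_pM2l ?invr_gt0 //.
  by apply: ler_sum => i _; have /andP[] := bent_offset r (ltn_ord i).
have lo r : (r%:R - 1) * H <= bent k rho 0 (r * L).
  apply: le_trans (bent_rho_ge _); rewrite -[leLHS]avg ler_pM2l ?invr_gt0 //.
  by apply: ler_sum => i _; have /andP[] := bent_offset r (ltn_ord i).
apply/eqP; rewrite eq_le; apply/andP; split; apply/ler_addgt0Pr => e e0.
  pose r := (Num.truncn ((ln L%:R + H) / e)).+1.
  have r0 : 0 < r%:R :> R by rewrite ltr0n.
  have hr : ln L%:R + H < r%:R * e by rewrite -ltr_pdivrMr //; exact: Num.Theory.truncnS_gt.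
  have := hl (r * L)%N; rewrite muln_gt0 L0 => /(_ isT) h1.
  have h2 := up r; rewrite natrM -mulrA in h1.
  rewrite -(ler_pM2l r0); apply: le_trans h1 _; apply: le_trans h2 _.
  rewrite mulrDl mul1r mulrDr; lra.
have e1 : 0 < e / (2 * L%:R) by rewrite divr_gt0 // mulr_gt0.
move/cvgrPdist_lt: hc => /(_ _ e1)[N _ hN].
pose r := (maxn N (Num.truncn (H / (e / 2)))).+1.
have r0 : 0 < r%:R :> R by rewrite ltr0n.
have hr : H < r%:R * (e / 2).
  rewrite -ltr_pdivrMr ?divr_gt0 //; apply: lt_le_trans (Num.Theory.truncnS_gt _) _.
  by rewrite ler_nat ltnS leq_maxr.
have rN : (N <= r * L)%N.
  by apply: leq_trans (leq_pmulr _ L0); rewrite ltnW // ltnS leq_maxl.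
have := hN _ rN; rewrite /= distrC ltr_norml => /andP[_].
have rL0 : 0 < (r * L)%:R :> R by rewrite ltr0n muln_gt0 L0.
rewrite ltrBlDr ltr_pdivrMl // => h1.
have h2 := lo r.
have e3 : (r * L)%:R * (e / (2 * L%:R) + h) = r%:R * (e / 2) + r%:R * (L%:R * h).
  by rewrite natrM; field; rewrite gt_eqF.
rewrite e3 in h1.
by rewrite -(ler_pM2l r0) mulrDr; move: h1 h2 hr; rewrite mulrBl mul1r; lra.
Qed.

End BlockCode.

(** * Concatenations of full words as paths in the Markov diagram *)

Lemma oneseq_hausdorff : hausdorff_space oneseq.
Proof.
move=> p q h; apply/funext => i.
have [z [h1 h2]] := h _ _ (agree_nbhs i.+1 p) (agree_nbhs i.+1 q).
by rewrite -(h1 i) // -(h2 i).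
Qed.

Lemma closed_image (g : oneseq -> oneseq) (A : set oneseq) :
  continuous g -> compact A -> closed (g @` A).
Proof.
move=> cg cA; apply: compact_closed; first exact: oneseq_hausdorff.
by apply: continuous_compact => //; exact: continuous_subspaceT.
Qed.

Section BlockPaths.
Context {R : realType}.
Variables alpha beta : R.
Hypothesis halpha : 0 <= alpha < 1.
Hypothesis hbeta : 2 < beta.

Local Notation K := (nsymb alpha beta).
Local Notation full := (full alpha beta).
Local Notation Sg := (Sigma_plus alpha beta).
Local Notation letter := (letter alpha beta).
Local Notation successor := (successor alpha beta).

Variable y0 : oneseq.
Hypothesis Sy0 : Sg y0.

(** The vertex reached after reading the first [t + 1] letters of [w] from the initial vertex of its
    first letter. *)
Definition vtx (w : seq nat) (t : nat) : set oneseq :=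
  iter t seq_shift @` (Sg `&` cyl 0 (take t.+1 w)).

Lemma vtx_sub w t y : (t < size w)%N -> vtx w t y -> letter (nth 0%N w t) y.
Proof.
move=> tw [z [Sz hz] <-]; split; first exact: Sigma_iter_shift.
rewrite iter_shiftE addn0.
have := hz t; rewrite size_takel // => /(_ (ltnSn t)) /=.
by rewrite add0n nth_take.
Qed.

Lemma vtx0 w : (0 < size w)%N -> vtx w 0 = letter (nth 0%N w 0).
Proof.
move=> w0; apply/seteqP; split => [y|y [Sy hy]]; first exact: vtx_sub.
exists y => //; split => //; case=> [_|t]; last by rewrite size_takel.
by rewrite nth_take.
Qed.

Lemma vtxS w t : (t.+1 < size w)%N ->
  vtx w t.+1 = letter (nth 0%N w t.+1) `&` seq_shift @` vtx w t.
Proof.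
move=> tw; apply/seteqP; split => [y hy|y [[Sy hy] [_ [z [Sz hz] <-] e]]].
  split; first exact: vtx_sub.
  case: hy => z [Sz hz] <-; exists (iter t seq_shift z) => //.
  exists z => //; split => // i; rewrite size_takel; last exact: ltnW.
  move=> hi; have := hz i; rewrite size_takel // => /(_ (ltnW hi)).
  by rewrite !nth_take // ltnW.
exists z; last by [].
split => // i; rewrite size_takel // ltnS leq_eqVlt => /orP[/eqP ->|hi].
  by rewrite nth_take // -hy -e /seq_shift iter_shiftE addn1.
have := hz i; rewrite size_takel; last exact: ltnW.
by rewrite !nth_take // ?ltnS ?(ltnW hi) //; apply.
Qed.

Lemma vtx_closed w t : closed (vtx w t).
Proof.
apply: closed_image.
  apply: continuous_agree => n; exists (t + n)%N => x y h i hi.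
  by rewrite !iter_shiftE h // ltn_add2l.
apply: (subclosed_compact _ (Sigma_compact halpha hbeta)); last by move=> x [].
apply: closedI; first exact: Sigma_closed.
rewrite -(setCK (cyl _ _)); apply: open_closedC; rewrite openE => x hx.
apply: filterS (agree_nbhs (size (take t.+1 w)) x) => y hy hc.
by apply: hx => i hi; rewrite -hc // hy.
Qed.

Lemma vtx_nonempty w t : full w -> (t < size w)%N -> vtx w t !=set0.
Proof.
move=> fw tw; exists (iter t seq_shift (catw w y0)), (catw w y0) => //.
split; first exact: full_Sigma.
move=> i; rewrite size_takel // => hi; rewrite nth_take // /catw add0n.
by rewrite (leq_ltn_trans _ tw).
Qed.

Lemma full_letter w t : full w -> (t < size w)%N -> symbols alpha beta (nth 0%N w t).
Proof.
move=> fw tw; have := Sigma_letter halpha hbeta t (full_Sigma halpha hbeta fw Sy0).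
by rewrite /catw tw.
Qed.

Lemma vtx_succ w t : full w -> (t.+1 < size w)%N -> successor (vtx w t) (vtx w t.+1).
Proof.
move=> fw tw; have tw' : (t < size w)%N by exact: ltnW.
split; [exact: vtx_closed| |exact: vtx_closed|exact: vtx_nonempty|].
  by exists (nth 0%N w t); [exact: full_letter|move=> y; exact: vtx_sub].
by exists (nth 0%N w t.+1); [exact: full_letter|exact: vtxS].
Qed.

(** Since [w] is full, the shift of its last vertex is all of [Sg], so the initial vertex of any
    other full word follows it. *)
Lemma vtx_next w w' : full w -> full w' -> (0 < size w)%N -> (0 < size w')%N ->
  successor (vtx w (size w).-1) (vtx w' 0).
Proof.
move=> fw fw' w0 w0'; have tw : ((size w).-1 < size w)%N by rewrite prednK.
split; [exact: vtx_closed| |exact: vtx_closed|exact: vtx_nonempty|].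
  by exists (nth 0%N w (size w).-1); [exact: full_letter|move=> y; exact: vtx_sub].
exists (nth 0%N w' 0); first exact: full_letter.
rewrite vtx0 // setIidl // => y [Sy _].
exists (iter (size w).-1 seq_shift (catw w y)); last first.
  by rewrite -iterS prednK //; apply/funext => n; rewrite shift_catw.
exists (catw w y) => //; split; first exact: full_Sigma.
by move=> i; rewrite prednK // take_size => hi; rewrite add0n /catw hi.
Qed.

Lemma vtx_vertex w t : full w -> (t < size w)%N -> vertices alpha beta (vtx w t).
Proof.
move=> fw tw; exists t => //; elim: t tw => [|t IH] tw.
  by exists (nth 0%N w 0); [exact: full_letter|rewrite vtx0].
by right; exists (vtx w t); [apply: IH; exact: ltnW|exact: vtx_succ].
Qed.

Lemma psi_vtx w t : full w -> (t < size w)%N -> psi alpha beta (vtx w t) = nth 0%N w t.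
Proof.
move=> fw tw; apply: xget_unique => [|j [_ hj]].
  by split; [exact: full_letter|move=> y; exact: vtx_sub].
have [y hy] := vtx_nonempty fw tw.
by have [_ <-] := hj _ hy; have [_ <-] := vtx_sub tw hy.
Qed.

Variables (L kq : nat) (blk : nat -> seq nat).
Hypothesis L0 : (0 < L)%N.
Hypothesis blkL : forall j, size (blk j) = L.
Hypothesis blkF : forall j, full (blk j).
Hypothesis blkq : forall j, blk (minn j kq) = blk j.

Definition block_vertices : set (set oneseq) :=
  [set vtx (blk j) t | j in `I_kq.+1 & t in `I_L].

Lemma block_vertices_finite : finite_set block_vertices.
Proof. by apply: finite_image2; exact: finite_II. Qed.

Lemma block_vertices_sub : block_vertices `<=` vertices alpha beta.
Proof. by move=> _ [j _ [t /= tL <-]]; apply: vtx_vertex; rewrite ?blkL. Qed.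

(* The block filling the positions [a * L .. a * L + L - 1] is [blk (G a)]. *)
Definition block_path (G : int -> nat) (z : int) : set oneseq :=
  vtx (blk (G (divz z L))) `|modz z L|.

Lemma block_pathE G a b : (b < L)%N -> block_path G (a * L%:Z + b%:Z) = vtx (blk (G a)) b.
Proof.
move=> bL; have L1 : L%:Z != 0 by rewrite gt_eqF.
by rewrite /block_path divzMDl // modzMDl divz_nat modz_nat divn_small // modn_small // addr0.
Qed.

Lemma block_path_paths G c : paths alpha beta block_vertices (fun z => block_path G (z + c)).
Proof.
have L1 : L%:Z != 0 by rewrite gt_eqF.
have dec z : exists a b, (b < L)%N /\ z = a * L%:Z + b%:Z.
  exists (divz z L), `|modz z L|%N; split.
    by rewrite -ltz_nat gez0_abs ?modz_ge0 // ltz_mod.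
  by rewrite gez0_abs ?modz_ge0 // -divz_eq.
split=> z.
  have [a [b [bL ->]]] := dec (z + c); rewrite block_pathE //.
  exists (minn (G a) kq); first by rewrite /= ltnS geq_minr.
  by exists b => //; rewrite blkq.
rewrite addrAC; have [a [b [bL ->]]] := dec (z + c); rewrite block_pathE //.
have [h|h] := ltnP b.+1 L.
  rewrite -addrA -PoszD addn1 block_pathE //.
  by apply: vtx_succ; rewrite ?blkL.
have e : b.+1 = L by apply/eqP; rewrite eqn_leq bL.
have -> : a * L%:Z + b%:Z + 1 = (a + 1) * L%:Z + 0%N%:Z.
  by rewrite -e -addn1 PoszD; ring.
rewrite block_pathE // -[b]/(b.+1.-1) e -{1}(blkL (G a)).
by apply: vtx_next; rewrite ?blkL.
Qed.

Lemma blockmap_path i x :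
  (proj_pos @` (Psi alpha beta @` paths alpha beta block_vertices)) (blockmap L blk i x).
Proof.
(* Any past will do, since full blocks follow each other freely; block 0 is taken. *)
pose G (a : int) : nat := if a is Posz n then x n else 0%N.
(* [proj_pos] reads from coordinate 1 on, hence [i - 1] instead of [i]. *)
have P := block_path_paths G (i%:Z - 1).
pose p z := block_path G (z + (i%:Z - 1)).
exists (Psi alpha beta p); first by exists p.
apply/funext => n; rewrite /proj_pos /Psi /blockmap /p.
have -> : n.+1%:Z + (i%:Z - 1) = ((n + i) %/ L)%N%:Z * L%:Z + ((n + i) %% L)%N%:Z.
  by rewrite -PoszM -PoszD -divn_eq -addn1 !PoszD; ring.
by rewrite block_pathE ?ltn_mod // psi_vtx ?blkL ?ltn_mod.
Qed.

Lemma blockmap_catw x :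
  blockmap L blk 0 x = catw (blk (x 0%N)) (blockmap L blk 0 (seq_shift x)).
Proof.
apply/funext => n; rewrite /blockmap /catw blkL !addn0 /seq_shift.
case: ltnP => h; first by rewrite divn_small // modn_small.
have -> : (n = 1 * L + (n - L))%N by move: h; clear; lia.
by rewrite divnMDl // modnMDl mul1n addKn add1n.
Qed.

(** Putting full blocks in front of [y0] gives points of the closed set [Sg] that agree with the
    concatenation on [r * L] letters. *)
Lemma blockmap_Sigma i x : Sg (blockmap L blk i x).
Proof.
have -> : blockmap L blk i x = iter i seq_shift (blockmap L blk 0 x).
  by elim: i => [//|i IH]; rewrite iterS -IH blockmap_shift.
apply: Sigma_iter_shift => //; apply: Sigma_closed; apply/closure_agree => r.
have [y Sy hy] : exists2 y, Sg y & agree (r * L) (blockmap L blk 0 x) y.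
  elim: r x => [|r IH] x; first by exists y0.
  have [y Sy hy] := IH (seq_shift x); exists (catw (blk (x 0%N)) y).
    exact: full_Sigma.
  by rewrite blockmap_catw mulSn -{1}(blkL (x 0%N)); exact: agree_catw.
exists y => // j hj; apply: hy.
by apply: leq_trans hj _; exact: leq_pmulr.
Qed.

(** A closed, hence Borel, subset of the projected paths that carries [rho]. Bounding the block
    names by [kq] makes it a finite union of compact images. *)
Definition block_range : set oneseq :=
  \bigcup_(i in `I_L) (blockmap L blk i @` [set x : oneseq | forall j, (x j <= kq)%N]).

Lemma block_range_closed : closed block_range.
Proof.
apply: closed_bigcup; first exact: finite_II.
move=> i _; apply: closed_image; first exact: continuous_blockmap.
exact: compact_letters_le.
Qed.

Lemma blockmap_range i x : (i < L)%N -> block_range (blockmap L blk i x).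
Proof.
move=> iL; exists i => //; exists (fun j => minn (x j) kq) => [j|].
  exact: geq_minr.
by apply/funext => m; rewrite /blockmap blkq.
Qed.

Lemma block_range_sub :
  block_range `<=` proj_pos @` (Psi alpha beta @` paths alpha beta block_vertices).
Proof. by move=> _ [i _ [x _ <-]]; exact: blockmap_path. Qed.

End BlockPaths.

(** * Convergence on cylinders implies weak* convergence *)

Section WeakStar.
Context {R : realType}.
Variables (k : nat) (S : set oneseq).
Hypothesis Sk : forall x, S x -> forall i, (x i < k)%N.
Hypothesis cS : compact S.
Let clS : closed S := compact_closed oneseq_hausdorff cS.
Let mS : measurable (S : set borel_oneseq) := measurable_closed clS.

Lemma unif_agree (f : oneseq -> R) (e : R) : {within S, continuous f} -> 0 < e ->
  exists r, forall x y, S x -> S y -> agree r x y -> `|f x - f y| < e.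
Proof.
move=> cf e0.
pose P (n : nat) (x : oneseq) := S x -> forall y, S y -> agree n x y -> `|f x - f y| < e.
have : \forall n \near \oo, S `<=` P n.
  apply: (proj1 (compact_near_coveringP S) cS) => x Sx.
  have h : nbhs (within S (nbhs x)) (f @^-1` ball (f x) (e / 2)).
    have := proj1 (subspace_continuousP _ _) cf x Sx.
    by apply; apply: nbhsx_ballx; rewrite divr_gt0.
  have [n hn] := nbhs_agree h.
  exists (agree n x, [set m | (n <= m)%N]); first by split; [exact: agree_nbhs|exists n].
  move=> [x' m] /= [hx' nm] Sx' y Sy hy.
  have h1 := hn x' hx' Sx'.
  have h2 : ball (f x) (e / 2) (f y).
    by apply: hn => // i hi; rewrite hy ?hx' //; exact: leq_trans nm.
  rewrite /ball /= in h1 h2.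
  have -> : f x' - f y = (f x - f y) - (f x - f x') by ring.
  by apply: le_lt_trans (ler_normB _ _) _; lra.
by case=> N _ /(_ N (leqnn N)) h; exists N => x y Sx Sy hxy; exact: h.
Qed.

Lemma within_measurable (f : borel_oneseq -> R) :
  {within S, continuous (f : oneseq -> R)} -> measurable_fun (S : set borel_oneseq) f.
Proof.
move=> cf; apply: (measurability _ (RGenOpens.measurableE R)) => _ [_ [a [b ->]] <-].
have /continuousP cf' := cf.
have /open_subspaceP[V oV VE] := cf' _ (@interval_open R (BRight a) (BLeft b) isT isT).
have -> : S `&` f @^-1` `]a, b[ = V `&` S by rewrite VE setIC.
by apply: measurableI => //; exact: measurable_open.
Qed.

Section Approximation.
Variables (mu : probability borel_oneseq R) (f : oneseq -> R) (r : nat)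
  (G : seq nat -> R) (d : R).
Hypothesis muS : carried mu S.
Hypothesis cf : {within S, continuous f}.
Hypothesis fG : forall x, S x -> `|f x - G (mkseq x r)| <= d.

Lemma within_integrable : mu.-integrable (S : set borel_oneseq) (EFin \o f).
Proof.
apply: measurable_bounded_integrable => //.
- by apply: le_lt_trans (probability_le1 _ _) _; rewrite ?ltry.
- exact: within_measurable.
pose M := \sum_(w <- kwords k r) `|G w| + d.
exists M; split; first exact: num_real.
move=> x Mx y Sy /=.
have hw : mkseq y r \in kwords k r.
  by rewrite mem_kwords size_mkseq eqxx /=; apply/allP => a /mapP[i _ ->]; exact: Sk.
apply: le_trans (ltW Mx).
have -> : f y = (f y - G (mkseq y r)) + G (mkseq y r) by ring.
apply: le_trans (ler_normD _ _) _; rewrite addrC lerD //; last exact: fG.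
by rewrite (big_rem _ hw) /= lerDl; apply: sumr_ge0.
Qed.

(** On each cylinder of length [r] the function is within [d] of the constant [G w], and the
    cylinder measures sum to 1. *)
Lemma Rintegral_step :
  `|(\int[mu]_(x in S) f x)%R - \sum_(w <- kwords k r) G w * marg mu 0 w| <= d.
Proof.
pose F w := (S : set borel_oneseq) `&` cyl 0 w.
have mF w : measurable (F w) by apply: measurableI => //; exact: measurable_cyl.
have iF w : mu.-integrable (F w) (EFin \o f).
  by apply: (@integrableS _ _ _ mu S) => //; [move=> x []|exact: within_integrable].
have SE : (S : set borel_oneseq) = \big[setU/set0]_(w <- kwords k r) F w.
  rewrite -bigcup_seq; apply/seteqP; split=> [x Sx|x [w _ []//]].
  exists (mkseq x r); last by split=> //; exact: cyl_mkseq.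
  rewrite /= mem_kwords size_mkseq eqxx /=; apply/allP => a /mapP[i _ ->].
  exact: Sk.
have split : (\int[mu]_(x in S) f x)%R = \sum_(w <- kwords k r) (\int[mu]_(x in F w) f x)%R.
  apply: EFin_inj; rewrite -sumEFin /Rintegral fineK; last first.
    exact: integrable_fin_num within_integrable.
  rewrite {1}SE integral_bigsetU_EFin //.
  - apply: eq_bigr => w _; rewrite fineK //.
    exact: integrable_fin_num (iF w).
  - exact: kwords_uniq.
  - move=> u v /= hu hv [x [[_ /cylP xu] [_ /cylP xv]]].
    move: hu hv; rewrite !mem_kwords => /andP[/eqP su _] /andP[/eqP sv _].
    by rewrite -xu -xv su sv.
  - by rewrite -SE; apply/measurable_EFinP; exact: within_measurable.
have FE w : fine (mu (F w)) = marg mu 0 w.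
  by rewrite /marg (carriedI mS muS) //; exact: measurable_cyl.
rewrite split -sumrB; apply: le_trans (ler_norm_sum _ _ _) _.
apply: (@le_trans _ _ (\sum_(w <- kwords k r) d * marg mu 0 w)); last first.
  by rewrite -mulr_sumr (marg_sum (carried_bounded Sk mS muS)) mulr1.
rewrite big_seq [leRHS]big_seq; apply: ler_sum => w.
rewrite mem_kwords => /andP[/eqP sw _].
have ic c : mu.-integrable (F w) (EFin \o cst c) by exact: finite_measure_integrable_cst.
rewrite -FE -!Rintegral_cst // -RintegralB //; last exact: ic.
have iB : mu.-integrable (F w) (EFin \o (fun x => f x - G w)).
  have := integrableB (mF w) (iF w) (ic (G w)).
  exact: eq_integrable.
apply: le_trans (le_normr_Rintegral _ _) _ => //.
apply: le_Rintegral => //; [exact: integrable_norm|exact: ic|].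
by move=> x [Sx /cylP]; rewrite sw => <-; exact: fG.
Qed.

End Approximation.

Lemma pairing_cvg (mu : probability borel_oneseq R) (rho : nat -> probability borel_oneseq R)
    (f : oneseq -> R) :
  carried mu S -> (forall n, carried (rho n) S) -> {within S, continuous f} ->
  (forall v, marg (rho n) 0 v @[n --> \oo] --> marg mu 0 v) ->
  (\int[rho n]_(x in S) f x)%R @[n --> \oo] --> (\int[mu]_(x in S) f x)%R.
Proof.
move=> muS rhoS cf hm; apply/cvgrPdist_lt => e e0.
(* Three errors of this size: replacing [f] by a step function for [mu] and for [rho n], and the
   convergence of the step integrals. *)
have e4 : 0 < e / 4 by rewrite divr_gt0.
have [r hr] := unif_agree cf e4.
pose G w := f (xget point [set x | S x /\ mkseq x r = w]).
have fG x : S x -> `|f x - G (mkseq x r)| <= e / 4.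
  move=> Sx; rewrite /G; set y := xget _ _.
  have [Sy hy] : S y /\ mkseq y r = mkseq x r.
    by apply: (@xgetPex _ point [set z | S z /\ mkseq z r = mkseq x r]); exists x.
  apply/ltW/hr => // i hi.
  by have := congr1 (nth 0%N ^~ i) hy; rewrite !nth_mkseq.
have hs : \sum_(w <- kwords k r) G w * marg (rho n) 0 w @[n --> \oo] -->
    \sum_(w <- kwords k r) G w * marg mu 0 w.
  elim: (kwords k r) => [|w s IH].
    by under eq_fun do rewrite big_nil; rewrite big_nil; exact: cvg_cst.
  under eq_fun do rewrite big_cons; rewrite big_cons.
  by apply: cvgD => //; apply: cvgM; [exact: cvg_cst|exact: hm].
move/cvgrPdist_lt : hs => /(_ _ e4) [N _ hN]; exists N => // n /hN /= h.
have h1 := Rintegral_step muS cf fG.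
have h2 := Rintegral_step (rhoS n) cf fG.
move: h h1 h2; rewrite ltr_norml !ler_norml ltr_norml.
by move=> /andP[? ?] /andP[? ?] /andP[? ?]; apply/andP; split; lra.
Qed.

Lemma weak_star_cvg (mu : weak_star (R := R) S) (rho : nat -> weak_star (R := R) S) :
  (forall v, marg (set_val (rho n)) 0 v @[n --> \oo] --> marg (set_val mu) 0 v) ->
  rho @ \oo --> mu.
Proof.
move=> hm.
have hp : (fun n => pairing (rho n)) @ \oo --> pairing mu.
  apply/cvg_sup => f U [V [[W oW <-] Wmu] WU].
  apply: (filterS WU).
  have h : (\int[set_val (rho n)]_(x in S) set_val f x)%R @[n --> \oo] -->
      (\int[set_val mu]_(x in S) set_val f x)%R.
    apply: pairing_cvg => //.
    - exact: (set_valP mu).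
    - by move=> n; exact: (set_valP (rho n)).
    - exact: (set_valP f).
  by apply: h; exact: open_nbhs_nbhs.
move=> U [V [[W oW <-] Wmu] WU].
apply: (filterS WU); apply: hp; exact: open_nbhs_nbhs.
Qed.

End WeakStar.

(** * The approximating measure, with explicit errors *)

Section Approximation.
Context {R : realType}.
Variables alpha beta : R.
Hypothesis halpha : 0 <= alpha < 1.
Hypothesis hbeta : 2 < beta.

Local Notation K := (nsymb alpha beta).
Local Notation full := (full alpha beta).
Local Notation ok := (ok alpha beta).
Local Notation Sg := (Sigma_plus alpha beta).
Local Notation k := K.+1.

Lemma Sigma_lt x : Sg x -> forall i, (x i < k)%N.
Proof. by move=> Sx i; have /andP[] := Sigma_letter halpha hbeta i Sx. Qed.

Let mSg : measurable (Sg : set borel_oneseq) := measurable_closed (@Sigma_closed R alpha beta).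

Variable mu : probability borel_oneseq R.
Hypothesis muS : carried mu Sg.
Hypothesis mu_inv : shift_invariant mu.

Local Notation h := (entropy Sg mu).

Lemma carried_nonempty : Sg !=set0.
Proof.
apply: contrapT => e.
have e0 : ~` Sg = setT by apply/seteqP; split => // x _ Sx; apply: e; exists x.
have : mu (~` Sg : set borel_oneseq) = 0%E.
  by apply/(negligibleP mu) => //; exact: measurableC.
rewrite e0; have -> : mu setT = 1%E := probability_setT mu.
by case=> /eqP; rewrite oner_eq0.
Qed.

Lemma marg_ok n w : size w = n -> 0 < marg mu 0 w -> ok w.
Proof.
move=> sw; rewrite /marg -(carriedI mSg muS); last exact: measurable_cyl.
have [[x [Sx /cylP hx]] _|e] := pselect (Sg `&` cyl 0 w !=set0).
  by rewrite -hx; exact: Sigma_ok.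
have -> : Sg `&` cyl 0 w = set0 by apply/seteqP; split => // x hx; apply: e; exists x.
by rewrite measure0 ltxx.
Qed.

(** The cube of exp (x / 3) >= 1 + x / 3 at x = n / D is at least ((n + 1) / (3 D))^3, and one
    factor n + 1 absorbs 27 D^3 C. *)
Lemma poly_le_exp (C D n : nat) : (0 < C)%N -> (0 < D)%N -> (27 * D ^ 3 * C <= n)%N ->
  ln (C * n.+1 ^ 2)%:R <= n%:R / D%:R :> R.
Proof.
move=> C0 D0 hn; have D0' : 0 < D%:R :> R by rewrite ltr0n.
rewrite -[leRHS]expRK ler_ln ?posrE ?expR_gt0 ?ltr0n ?muln_gt0 ?C0 ?expn_gt0 //.
have -> : n%:R / D%:R = 3%:R * (n%:R / D%:R / 3) :> R by field; rewrite gt_eqF.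
rewrite expRM_natl.
have h1 : n.+1%:R / (3 * D%:R) <= expR (n%:R / D%:R / 3) :> R.
  apply: le_trans (expR_ge1Dx _).
  have D1 : 1 <= D%:R :> R by rewrite ler1n.
  rewrite -natr1 ler_pdivrMr ?mulr_gt0 //.
  have -> : (1 + n%:R / D%:R / 3) * (3 * D%:R) = 3 * D%:R + n%:R :> R by field; rewrite gt_eqF.
  by lra.
apply: le_trans (_ : (n.+1%:R / (3 * D%:R)) ^+ 3 <= _); last first.
  by rewrite lerXn2r // nnegrE ?expR_ge0 // divr_ge0 // mulr_ge0 // ltW.
rewrite expr_div_n ler_pdivlMr ?exprn_gt0 ?mulr_gt0 // exprMn.
have -> : (3 : R) ^+ 3 = 27%:R by rewrite -natrX.
rewrite -!natrX -!natrM ler_nat.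
by move: hn; rewrite [(n.+1 ^ 3)%N]expnS; move: (n.+1 ^ 2)%N; nia.
Qed.

(** All errors are expressed through the single scale [1 / D], so that one limit in [D] handles the
    entropy and all cylinders. *)
Lemma approximation (D : nat) : (0 < D)%N ->
  exists (F : set (set oneseq)) (rho : probability borel_oneseq R),
  [/\ F `<=` vertices alpha beta, finite_set F,
      carried rho (proj_pos @` (Psi alpha beta @` paths alpha beta F)) & carried rho Sg] /\
  [/\ ergodic rho,
      `|h - entropy Sg rho| <= (2 + 2 * h) / D%:R &
      forall v, (size v <= D)%N ->
        `|marg rho 0 v - marg mu 0 v| <= (19 + 11 * (size v)%:R) / D%:R].
Proof.
move=> D0; have D0' : 0 < D%:R :> R by rewrite ltr0n.
have [y0 Sy0] := carried_nonempty.
have mu0 := carried_bounded Sigma_lt mSg muS.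
have [hcv hle] := entropy_spec Sigma_lt mSg muS mu_inv.
have h0 : 0 <= h.
  apply: (closed_cvg (fun x : R => 0 <= x)) hcv; first exact: closed_ge.
  by near=> n; rewrite mulr_ge0 ?invr_ge0 ?bent_ge0.
have [C [dec [hdec hcode]]] := coding halpha hbeta D0.
have Di : 0 < D%:R^-1 :> R by rewrite invr_gt0.
have [N1 _ hN1] : \forall n \near \oo, `|h - n%:R^-1 * bent k mu 0 n| < D%:R^-1.
  by move/cvgrPdist_lt : hcv; apply.
(* The summands serve, in order, for the polynomial factor of the decoder, for [C <= n / D], for
   [size v <= n / D] when [size v <= D], for positivity, and for the convergence of the block
   entropies of [mu]. *)
pose n := (27 * D ^ 3 * C + C * D + D ^ 2 + 1 + N1)%N.
have n0 : (0 < n)%N by rewrite /n; clear; lia.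
have n0' : 0 < n%:R :> R by rewrite ltr0n.
have nN1 : (N1 <= n)%N by rewrite leq_addl.
have nC3 : (27 * D ^ 3 * C <= n)%N by rewrite /n; clear; lia.
have nCD : (C * D <= n)%N by rewrite /n; clear; lia.
have nDD : (D ^ 2 <= n)%N by rewrite /n; clear; lia.
clearbody n.
pose L := (n + n %/ D + C)%N.
have L0 : (0 < L)%N by rewrite /L -addnA addn_gt0 n0.
have L0' : 0 < L%:R :> R by rewrite ltr0n.
pose X := (2 * (n %/ D) + 2 * C)%N; pose Y := (10 * (n %/ D) + C)%N.
have [t0 [ft0 st0 _ _]] := hcode n _ (Sigma_ok halpha hbeta n Sy0) (size_mkseq _ _).
(* Words of length [n] that are not [ok] have measure zero; like words of other lengths, they
   receive the fixed full word [t0]. *)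
have /choice[Phi hPhi] : forall w, exists t, [/\ full t, size t = L &
    ok w -> size w = n -> w \in dec n t /\ near_word w t X Y].
  move=> w; have [[okw sw]|hw] := pselect (ok w /\ size w = n).
    have [t [ft st wt nt]] := hcode n w okw sw; by exists t; split.
  by exists t0; split => // okw sw; case: hw.
pose W := kwords k n; pose kq := size W.
(* A letter [j] names the [j]-th word of length [n], with its probability under [mu]; from [kq] on,
   the default of [nth] makes the blocks constant. *)
pose q j := if (j < kq)%N then marg mu 0 (nth [::] W j) else 0.
pose blk j := Phi (nth [::] W j).
have sumW (g : seq nat -> R) (P : pred (seq nat)) :
    \sum_(a < kq | P (nth [::] W a)) g (nth [::] W a) = \sum_(w <- W | P w) g w.
  by rewrite [RHS](big_nth [::]) big_mkord.
have sumq (P : pred (seq nat)) :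
    \sum_(a < kq | P (nth [::] W a)) q a = \sum_(w <- W | P w) marg mu 0 w.
  by rewrite -sumW; apply: eq_bigr => a _; rewrite /q ltn_ord.
have q0 a : 0 <= q a by rewrite /q; case: ifP => // _; exact: marg_ge0.
have qk a : (kq <= a)%N -> q a = 0 by rewrite /q leqNgt => /negbTE ->.
have q1 : \sum_(a < kq) q a = 1 by rewrite (sumq predT) /W marg_sum.
have blkL j : size (blk j) = L by have [] := hPhi (nth [::] W j).
have blkF j : full (blk j) by have [] := hPhi (nth [::] W j).
have blkq j : blk (minn j kq) = blk j.
  rewrite /blk; congr Phi; have [jk|kj] := leqP j kq; first by [].
  by rewrite !nth_default // ltnW.
have blkk j : all (fun a => (a < k)%N) (blk j).
  apply/(all_nthP 0%N) => i hi.
  by have /andP[] := full_letter halpha hbeta Sy0 (blkF j) hi.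
have [nu [nuE nu0]] := bernoulli q0 qk q1.
have [la laE] := block_law L blk nu.
have [rho rhoE] := block_measure nu blk L0.
have erg : ergodic rho := rho_ergodic q0 q1 nuE nu0 L0 rhoE.
have rhoS : carried rho Sg.
  apply: (rho_carried rhoE) => // i x _.
  exact: (blockmap_Sigma halpha hbeta Sy0 L0 blkL blkF).
exists (block_vertices alpha beta L kq blk), rho; split.
  split => //.
  - exact: (block_vertices_sub halpha hbeta Sy0 blkL blkF).
  - exact: block_vertices_finite.
  - have sub := block_range_sub halpha hbeta Sy0 L0 blkL blkF blkq.
    apply: (@negligibleS _ _ _ rho (~` block_range L kq blk)).
      by move=> x hx /sub.
    apply: (rho_carried rhoE).
      by apply: measurable_closed; exact: block_range_closed.
    by move=> i x iL; exact: blockmap_range.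
have margE t : size t = L -> marg la 0 t = mass W Phi (marg mu 0) t.
  by move=> st; rewrite (marg_block nuE nu0 blkL laE st) (sumq (fun w => Phi w == t)).
have PhiW w : w \in W -> Phi w \in kwords k L.
  move=> wW; have := blkk (index w W); have := blkL (index w W).
  by rewrite /blk nth_index // mem_kwords => -> ->; rewrite eqxx.
have lab := block_bounded L0 blkL blkk laE.
have bentE : bent k la 0 L = \sum_(t <- kwords k L) ent (mass W Phi (marg mu 0) t).
  rewrite /bent big_seq [RHS]big_seq; apply: eq_bigr => t.
  by rewrite mem_kwords => /andP[/eqP st _]; rewrite margE.
have mge (w : seq nat) : 0 <= marg mu 0 w by exact: marg_ge0.
have uL : uniq (kwords k L) by exact: kwords_uniq.
have [rcv rle] := entropy_spec Sigma_lt mSg rhoS (proj1 erg).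
have LhE := rho_entropy q0 q1 nuE nu0 L0 blkL blkk laE rhoE rcv rle.
have nD : (n %/ D)%:R <= n%:R / D%:R :> R.
  by rewrite ler_pdivlMr // -natrM ler_nat leq_trunc_div.
have CD : C%:R <= n%:R / D%:R :> R by rewrite ler_pdivlMr // -natrM ler_nat.
have LE : L%:R = n%:R + (n %/ D)%:R + C%:R :> R by rewrite /L !natrD.
have nL : n%:R <= L%:R :> R by rewrite LE; have := ler0n R (n %/ D); have := ler0n R C; lra.
have e0 : 0 <= n%:R / D%:R :> R by rewrite divr_ge0.
split=> //.
  have up : bent k la 0 L <= bent k mu 0 n by rewrite bentE; exact: entropy_code_le.
  pose bnd : R := (C * n.+1 ^ 2)%:R * (1 + D%:R^-1) ^+ n.
  have bnd0 : 0 <= bnd by rewrite mulr_ge0 // exprn_ge0 // addr_ge0 // ltW.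
  pose F := Num.truncn bnd.
  have decF t : (size (dec n t) <= F)%N by rewrite Num.Theory.truncn_ge_nat.
  have F0 : (0 < F)%N.
    have [_ _ hw] := hPhi (mkseq y0 n).
    have [wd _] := hw (Sigma_ok halpha hbeta n Sy0) (size_mkseq _ _).
    by apply: leq_trans (decF (Phi (mkseq y0 n))); case: (dec _ _) wd.
  have F0' : 0 < F%:R :> R by rewrite ltr0n.
  have Fb : F%:R <= bnd by rewrite Num.Theory.truncn_le.
  have C0 : (0 < C)%N.
    by rewrite lt0n; apply/eqP => C0; move: Fb; rewrite /bnd C0 mul0n mul0r leNgt F0'.
  (* One [n / D] for the polynomial factor and one for the exponential, by ln (1 + 1 / D) <= 1 /
     D. *)
  have lnF : ln F%:R <= 2 * (n%:R / D%:R) :> R.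
    apply: (@le_trans _ _ (ln bnd)).
      by rewrite ler_ln // posrE; exact: lt_le_trans Fb.
    have l1 : 0 < 1 + D%:R^-1 :> R by rewrite addr_gt0.
    rewrite lnM ?posrE ?exprn_gt0 ?ltr0n ?muln_gt0 ?C0 ?expn_gt0 // lnXn //.
    have h1 := poly_le_exp C0 D0 nC3.
    have h2 : ln (1 + D%:R^-1) *+ n <= n%:R / D%:R :> R.
      rewrite -[leLHS]mulr_natl ler_pM2l //; apply: le_ln1Dx.
      by apply: lt_trans Di; rewrite ltrN10.
    by lra.
  have lo : bent k mu 0 n <= bent k la 0 L + ln F%:R.
    have fib t : (count (fun w => (Phi w == t) && (0 < marg mu 0 w)%R) W <= F)%N.
      rewrite -size_filter; apply: leq_trans (decF t).
      apply: uniq_leq_size; first by rewrite filter_uniq // kwords_uniq.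
      move=> w; rewrite mem_filter mem_kwords => /andP[/andP[/eqP <- wp] /andP[/eqP sw _]].
      by have [_ _ /(_ (marg_ok sw wp) sw)[]] := hPhi w.
    have := entropy_code_ge uL PhiW mge F0 fib.
    have -> : \sum_(w <- W) marg mu 0 w = 1 := marg_sum mu0 0 n.
    by rewrite mul1r -bentE.
  rewrite -LhE in up lo.
  have hn := hle n n0.
  have hn2 : bent k mu 0 n <= n%:R * h + n%:R / D%:R.
    have := hN1 n nN1; rewrite /= distrC ltr_norml => /andP[_ hh].
    rewrite -mulrDr -ler_pdivrMl //; lra.
  set g := entropy _ rho in up lo *.
  (* So far [L * g] lies between [n * h - 2 n / D] and [n * h + n / D]; since [L] exceeds [n] by at
     most [2 n / D], this is where [2 + 2 * h] comes from. *)
  have e1 : n%:R * h <= L%:R * h by rewrite ler_wpM2r.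
  have e2 : L%:R * h <= n%:R * h + 2 * (n%:R / D%:R) * h.
    by rewrite -mulrDl ler_wpM2r //; lra.
  have e3 : n%:R / D%:R <= L%:R / D%:R :> R by rewrite ler_pM2r.
  have e4 : n%:R / D%:R * h <= L%:R / D%:R * h by rewrite ler_wpM2r.
  have e5 : L%:R * ((2 + 2 * h) / D%:R) = 2 * (L%:R / D%:R) + 2 * (L%:R / D%:R * h).
    by field; rewrite gt_eqF.
  have e6 : 0 <= L%:R / D%:R * h by rewrite mulr_ge0 // divr_ge0.
  rewrite -(ler_pM2l L0') -{1}(ger0_norm (ltW L0')) -normrM e5 mulrBr ler_norml.
  by apply/andP; split; lra.
move=> v vD; set r := size v.
have rD : r%:R <= n%:R / D%:R :> R.
  rewrite ler_pdivlMr // -natrM ler_nat; apply: leq_trans nDD.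
  by rewrite expnS expn1 leq_mul2r vD orbT.
have a1 := sum_marg lab L v; have a2 := sum_marg mu0 n v.
have b1 : \sum_(i < L) marg la i v = L%:R * marg rho 0 v.
  by rewrite (marg_rho laE rhoE) mulVKf // gt_eqF.
have b2 : \sum_(i < n) marg mu i v = n%:R * marg mu 0 v.
  rewrite (eq_bigr (fun=> marg mu 0 v)) => [|i _]; last exact: marg_stationary.
  by rewrite big_const_ord iter_addr_0 mulr_natl.
have b3 : \sum_(t <- kwords k L) marg la 0 t * (cnt v t)%:R =
    \sum_(w <- W) marg mu 0 w * (cnt v (Phi w))%:R.
  rewrite -(sum_mass _ uL PhiW (fun t => (cnt v t)%:R)) big_seq [RHS]big_seq; apply: eq_bigr => t.
  by rewrite mem_kwords => /andP[/eqP st _]; rewrite margE.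
have b4 : `|\sum_(w <- W) marg mu 0 w * (cnt v (Phi w))%:R -
    \sum_(w <- W) marg mu 0 w * (cnt v w)%:R| <= (X + Y * r.+1)%:R.
  rewrite -sumrB; apply: le_trans (ler_norm_sum _ _ _) _.
  apply: (@le_trans _ _ (\sum_(w <- W) marg mu 0 w * (X + Y * r.+1)%:R)); last first.
    rewrite -mulr_suml; have -> : \sum_(w <- W) marg mu 0 w = 1 := marg_sum mu0 0 n.
    by rewrite mul1r.
  rewrite big_seq [leRHS]big_seq.
  apply: ler_sum => w; rewrite mem_kwords => /andP[/eqP sw _].
  rewrite -mulrBr normrM ger0_norm //.
  have := mge w; rewrite le_eqVlt => /orP[/eqP <-|wp]; first by rewrite !mul0r.
  rewrite ler_pM2l //.
  have [_ _ /(_ (marg_ok sw wp) sw)[_ [_ /(_ v)]]] := hPhi w.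
  rewrite -/r => -[]; rewrite -!(ler_nat R) !natrD => c1 c2.
  by have x0 := ler0n R X; rewrite ler_norml; apply/andP; split; lra.
have XY : (X + Y * r.+1)%:R <= (15 + 11 * r%:R) * (n%:R / D%:R) :> R.
  have y1 : Y%:R <= 11 * (n%:R / D%:R) :> R by rewrite /Y natrD natrM; lra.
  have y2 : Y%:R * r.+1%:R <= 11 * (n%:R / D%:R) * r.+1%:R :> R by rewrite ler_wpM2r.
  have x1 : X%:R <= 4 * (n%:R / D%:R) :> R by rewrite /X natrD !natrM; lra.
  by rewrite natrD natrM; move: y2; rewrite -natr1; lra.
rewrite b1 b3 in a1; rewrite b2 in a2.
have m0 := mge v; have m1 : marg mu 0 v <= 1 := marg_le1 mu 0 v.
set m := marg mu 0 v in a2 m0 m1 *; set m' := marg rho 0 v in a1 *.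
(* The recoding contributes [15 + 11 * r] and the ends of the words of lengths [L] and [n]
   contribute 2; the step from [n * m] to [L * m] adds the last 2. *)
have c1 : `|L%:R * m' - n%:R * m| <= (17 + 11 * r%:R) * (n%:R / D%:R).
  have a3 : 2 * r%:R <= 2 * (n%:R / D%:R) :> R by lra.
  move: a1 a2 b4 XY; rewrite -/r !ler_norml => /andP[? ?] /andP[? ?] /andP[? ?] ?.
  by apply/andP; split; lra.
have c2 : n%:R * m <= L%:R * m <= n%:R * m + 2 * (n%:R / D%:R).
  rewrite ler_wpM2r //=.
  have : (L%:R - n%:R) * m <= (L%:R - n%:R) * 1 by rewrite ler_wpM2l // subr_ge0.
  by lra.
have c3 : (19 + 11 * r%:R) * (n%:R / D%:R) <= L%:R * ((19 + 11 * r%:R) / D%:R) :> R.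
  have -> : L%:R * ((19 + 11 * r%:R) / D%:R) = (19 + 11 * r%:R) * (L%:R / D%:R) :> R.
    by field; rewrite gt_eqF.
  by rewrite ler_wpM2l ?addr_ge0 ?mulr_ge0 // ler_pM2r.
rewrite -(ler_pM2l L0') -{1}(ger0_norm (ltW L0')) -normrM; apply: le_trans c3.
move: c1; rewrite mulrBr !ler_norml => /andP[? ?]; move/andP: c2 => [? ?].
by apply/andP; split; lra.
Unshelve. all: by end_near.
Qed.

End Approximation.

Theorem proposition3p1 (R : realType) (alpha beta : R)
    (halpha : 0 <= alpha < 1) (hbeta : 2 < beta)
    (mu : weak_star (R := R) (Sigma_plus alpha beta))
    (mu_inv : shift_invariant (set_val mu))
    (mu_pos : 0 < entropy (Sigma_plus alpha beta) (set_val mu))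
    (eps : R) (heps : 0 < eps)
    (U : set (weak_star (R := R) (Sigma_plus alpha beta)))
    (hU : nbhs mu U) :
  exists F : set (set oneseq),
    [/\ F `<=` vertices alpha beta,
        finite_set F &
        exists rho : weak_star (R := R) (Sigma_plus alpha beta),
          [/\ carried (set_val rho)
                (proj_pos @` (Psi alpha beta @` paths alpha beta F)),
              ergodic (set_val rho),
              U rho &
              `|entropy (Sigma_plus alpha beta) (set_val mu)
                - entropy (Sigma_plus alpha beta) (set_val rho)| <= eps]].
Proof.
set Sg := Sigma_plus alpha beta in mu mu_inv mu_pos U hU *.
have muS : carried (set_val mu) Sg := set_valP mu.
(* One approximation is chosen at each scale [N + 1]; the resulting sequence converges to [mu], so
   it enters [U] without any description of a neighbourhood base. *)
have /choice[Fs hF] : forall N : nat, exists p : set (set oneseq) * weak_star (R := R) Sg,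
    [/\ p.1 `<=` vertices alpha beta, finite_set p.1 &
        carried (set_val p.2) (proj_pos @` (Psi alpha beta @` paths alpha beta p.1))] /\
    [/\ ergodic (set_val p.2),
      `|entropy Sg (set_val mu) - entropy Sg (set_val p.2)| <=
         (2 + 2 * entropy Sg (set_val mu)) / N.+1%:R &
      forall v, (size v <= N.+1)%N ->
        `|marg (set_val p.2) 0 v - marg (set_val mu) 0 v| <=
          (19 + 11 * (size v)%:R) / N.+1%:R].
  move=> N; have [F [rho [[h1 h2 h3 h4] h5]]] := approximation halpha hbeta muS mu_inv (ltn0Sn N).
  pose A := [set m : probability borel_oneseq R | carried m Sg].
  pose rho' : weak_star Sg := exist (fun m => m \in A) rho (mem_set (A := A) h4).
  by exists (F, rho'); split.
pose rho N := (Fs N).2.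
have small (c e : R) : 0 < e -> \forall N \near \oo, c / N.+1%:R < e.
  move=> e0; near=> N; rewrite ltr_pdivrMr ?ltr0n // -ltr_pdivrMl //.
  apply: lt_trans (_ : N%:R < _); last by rewrite ltr_nat.
  by near: N; exact: nbhs_infty_gtr.
have cv : rho @ \oo --> mu.
  apply: (weak_star_cvg (k := (nsymb alpha beta).+1)).
  - exact: Sigma_lt.
  - exact: Sigma_compact.
  move=> v; apply/cvgrPdist_lt => e e0; near=> N.
  have [_ [_ _ /(_ v) hv]] := hF N; rewrite distrC; apply: le_lt_trans (hv _) _.
    by apply: leqW; near: N; exact: nbhs_infty_ge.
  by near: N; exact: small.
have [N [UN eN]] : exists N, U (rho N) /\
    (2 + 2 * entropy Sg (set_val mu)) / N.+1%:R < eps.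
  have [M1 _ hM1] := cv _ hU; have [M2 _ hM2] := small (2 + 2 * entropy Sg (set_val mu)) _ heps.
  exists (maxn M1 M2); split; [apply: hM1; exact: leq_maxl|apply: hM2; exact: leq_maxr].
have [[h1 h2 h3] [h4 h5 _]] := hF N.
exists (Fs N).1; split=> //; exists (rho N); split=> //.
exact: le_trans h5 (ltW eN).
Unshelve. all: by end_near.
Qed.
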